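(* Let $X$ be an infinite-dimensional complex Banach space and $T\in L(X)$. (a) Let $\mathbf R$ be one of $\mathcal B_+$, $\mathcal B_-$, $\mathcal B$, $\Phi_+$, $\Phi_-$, $\Phi$, $\mathcal W_+$, $\mathcal W_-$, $\mathcal W$. If $\partial\sigma_{\mathbf R}(T)\subset\operatorname{acc}\sigma_{\mathbf R}(T)$, then $$\partial\sigma_{\mathbf R}(T)\subset\sigma_{gKR}(T)\subset\sigma_{gK}(T)\subset\sigma_{Kt}(T)\subset\sigma_{eK}(T)\subset\sigma_{\mathbf R}(T),$$ $$\partial\sigma_{\mathbf R}(T)\subset\sigma_{gKR}(T)\subset\sigma_{gK}(T)\subset\sigma_{\mathbf{gDR}\mathbf R}(T)\subset\sigma_{\mathbf R}(T),$$ and $\eta\sigma_{\mathbf R}(T)=\eta\sigma_{gKR}(T)=\eta\sigma_{gK}(T)=\eta\sigma_{Kt}(T)=\eta\sigma_{eK}(T)=\eta\sigma_{\mathbf{gDR}\mathbf R}(T)$. (b) Let $(\mathbf R,\mathbf R')$ be one of the pairs $(\mathcal M,\mathcal B_+)$, $(\mathcal Q,\mathcal B_-)$, $(L(X)^{-1},\mathcal B)$. If $\partial\sigma_{\mathbf R}(T)\subset\operatorname{acc}\sigma_{\mathbf R'}(T)$, then $$\partial\sigma_{\mathbf R}(T)\subset\sigma_{gKR}(T)\subset\sigma_{gK}(T)\subset\sigma_{Kt}(T)\subset\sigma_{eK}(T)\subset\sigma_K(T)\subset\sigma_{\mathbf R}(T)$$ and $\eta\sigma_{\mathbf R}(T)=\eta\sigma_{gKR}(T)=\eta\sigma_{gK}(T)=\eta\sigma_{Kt}(T)=\eta\sigma_{eK}(T)=\eta\sigma_K(T)=\eta\sigma_{\mathbf{gDR}\mathbf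 R}(T)$.
   Context: $S$ is Kato if $R(S)$ is closed and $N(S)\subset R(S^n)$ for all $n$; $S$ is Riesz if $S-\lambda$ is Fredholm for all $\lambda\ne0$. For an operator $S$ and closed $S$-invariant $M,N$ with $X=M\oplus N$ and $S_M$ Kato: if $S_N$ is Riesz, $S$ admits a GKRD; if $S_N$ is quasinilpotent, a GKD; if $S_N$ is nilpotent, $S$ is of Kato type; if $N$ is finite-dimensional and $S_N$ nilpotent, $S$ is essentially Kato. $\sigma_{gKR}$, $\sigma_{gK}$, $\sigma_{Kt}$, $\sigma_{eK}$, $\sigma_K$: sets of $\lambda$ with $T-\lambda$ not admitting a GKRD, not admitting a GKD, not of Kato type, not essentially Kato, not Kato. Classes: $\mathcal M$ bounded below; $\mathcal Q$ surjective; $L(X)^{-1}$ invertible; $\Phi_+$: finite-dimensional kernel and closed range; $\Phi_-$: finite-codimensional range; $\Phi=\Phi_+\cap\Phi_-$; $\mathcal W_+,\mathcal W_-,\mathcal W$: in $\Phi_+,\Phi_-,\Phi$ with index $\le0,\ge0,=0$; $\mathcal B_+$: $\Phi_+$ with finite ascent; $\mathcal B_-$: $\Phi_-$ with finite descent; $\mathcal B$: Fredholm with finite ascent and descent. $\sigma_{\mathbf R}(T)=\{\lambda:T-\lambda\notin\mathbf R\}$; $\sigma_{\mathbf{gDR}\mathbf R}(T)$ is the set of $\lambda$ for which there are no closed $(T-\lambda)$-invariant $M,N$ with $X=M\oplus N$, $(T-\lambda)_M\in\mathbf R$, $(T-\lambda)_N$ Riesz. For compact $K\subset\mathbb C$,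 $\eta K$ is the complement of the unbounded component of $\mathbb C\setminus K$; $\partial$, $\operatorname{acc}$: boundary, accumulation points. *)

(* Defs.v *)
From HB Require Import structures.
From mathcomp Require Import all_boot all_order all_algebra.
From mathcomp Require Import all_classical all_reals topology normedtype.
From mathcomp Require Export complex.
Import Order.TTheory GRing.Theory Num.Theory.
Import numFieldNormedType.Exports.
Import numFieldTopology.Exports.

Set Implicit Arguments.
Unset Strict Implicit.
Unset Printing Implicit Defensive.

Local Open Scope ring_scope.
Local Open Scope classical_set_scope.

Section OperatorNotions.
Context {R : realType} {X : normedModType (R[i])}.
Local Notation C := (R[i]).

Definition span (s : seq X) : set X :=
  [set x | exists c : 'I_(size s) -> C, x = \sum_(i < size s) c i *: s`_i].

Definition free (s : seq X) : Prop :=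
  forall c : 'I_(size s) -> C,
    \sum_(i < size s) c i *: s`_i = 0 -> forall i, c i = 0.

Definition closed_subspace (M : set X) : Prop :=
  [/\ M 0, (forall x y, M x -> M y -> M (x + y)),
      (forall (a : C) x, M x -> M (a *: x)) & closed M].

Definition invariant (S : X -> X) (M : set X) : Prop :=
  forall x, M x -> M (S x).

Definition direct_decomp (M N : set X) : Prop :=
  [/\ closed_subspace M, closed_subspace N,
      (forall x, exists y z, [/\ M y, N z & x = y + z]) &
      (forall x, M x -> N x -> x = 0)].

Definition dim_eq (A : set X) (n : nat) : Prop :=
  exists s : seq X, [/\ size s = n, free s & span s = A].

Definition finite_dim (A : set X) : Prop := exists n, dim_eq A n.

Definition codim_eq (M B : set X) (n : nat) : Prop :=
  exists s : seq X, [/\ size s = n, free s, (forall x, x \in s -> M x),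
    (forall x, M x <-> exists b y, [/\ B b, span s y & x = b + y]) &
    (forall x, B x -> span s x -> x = 0)].

Definition finite_codim (M B : set X) : Prop := exists n, codim_eq M B n.

Definition kerM (S : X -> X) (M : set X) : set X := [set x | M x /\ S x = 0].
Definition rangeM (S : X -> X) (M : set X) : set X := S @` M.

Definition injM (S : X -> X) (M : set X) : Prop :=
  forall x, M x -> S x = 0 -> x = 0.

Definition KatoM (S : X -> X) (M : set X) : Prop :=
  closed (rangeM S M) /\ forall n, kerM S M `<=` rangeM (iter n S) M.

Definition bounded_belowM (S : X -> X) (M : set X) : Prop :=
  exists c : C, 0 < c /\ forall x, M x -> c * `|x| <= `|S x|.
Definition surjectiveM (S : X -> X) (M : set X) : Prop := rangeM S M = M.
Definition invertibleM (S : X -> X) (M : set X) : Prop :=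
  exists g : X -> X, [/\ (forall x, M x -> M (g x)),
     (forall x, M x -> g (S x) = x), (forall x, M x -> S (g x) = x) &
     {within M, continuous g}].
Definition upper_semiFredholmM (S : X -> X) (M : set X) : Prop :=
  finite_dim (kerM S M) /\ closed (rangeM S M).
Definition lower_semiFredholmM (S : X -> X) (M : set X) : Prop :=
  finite_codim M (rangeM S M).
Definition FredholmM (S : X -> X) (M : set X) : Prop :=
  upper_semiFredholmM S M /\ lower_semiFredholmM S M.
(* index <= 0 (index = dim N(S) - codim R(S), possibly -oo or +oo) *)
Definition index_le0M (S : X -> X) (M : set X) : Prop :=
  forall m n, dim_eq (kerM S M) m -> codim_eq M (rangeM S M) n -> (m <= n)%N.
Definition index_ge0M (S : X -> X) (M : set X) : Prop :=
  forall m n, dim_eq (kerM S M) m -> codim_eq M (rangeM S M) n -> (n <= m)%N.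
Definition finite_ascentM (S : X -> X) (M : set X) : Prop :=
  exists p, kerM (iter p S) M = kerM (iter p.+1 S) M.
Definition finite_descentM (S : X -> X) (M : set X) : Prop :=
  exists q, rangeM (iter q S) M = rangeM (iter q.+1 S) M.

Definition shift (S : X -> X) (l : C) : X -> X := fun x => S x - l *: x.

Definition RieszM (S : X -> X) (N : set X) : Prop :=
  forall l : C, l != 0 -> FredholmM (shift S l) N.
Definition quasinilpotentM (S : X -> X) (N : set X) : Prop :=
  forall l : C, l != 0 -> invertibleM (shift S l) N.
Definition nilpotentM (S : X -> X) (N : set X) : Prop :=
  exists n, forall x, N x -> iter n S x = 0.

Definition decomp_with (P : (X -> X) -> set X -> Prop)
    (Q : (X -> X) -> set X -> Prop) (S : X -> X) : Prop :=
  exists M N : set X, [/\ direct_decomp M N, invariant S M, invariant S N,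
                          P S M & Q S N].

Definition GKRD (S : X -> X) : Prop := decomp_with KatoM RieszM S.
Definition GKD (S : X -> X) : Prop := decomp_with KatoM quasinilpotentM S.
Definition Kato_type (S : X -> X) : Prop := decomp_with KatoM nilpotentM S.
Definition essentially_Kato (S : X -> X) : Prop :=
  decomp_with KatoM (fun S N => finite_dim N /\ nilpotentM S N) S.
Definition Kato (S : X -> X) : Prop := KatoM S setT.

Inductive opclass :=
  | cM | cQ | cInv | cPhip | cPhim | cPhi | cWp | cWm | cW | cBp | cBm | cB.

Definition in_classM (c : opclass) (S : X -> X) (M : set X) : Prop :=
  match c with
  | cM => bounded_belowM S M
  | cQ => surjectiveM S M
  | cInv => invertibleM S M
  | cPhip => upper_semiFredholmM S M
  | cPhim => lower_semiFredholmM S M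
  | cPhi => FredholmM S M
  | cWp => upper_semiFredholmM S M /\ index_le0M S M
  | cWm => lower_semiFredholmM S M /\ index_ge0M S M
  | cW => FredholmM S M /\ index_le0M S M /\ index_ge0M S M
  | cBp => upper_semiFredholmM S M /\ finite_ascentM S M
  | cBm => lower_semiFredholmM S M /\ finite_descentM S M
  | cB => FredholmM S M /\ finite_ascentM S M /\ finite_descentM S M
  end.

Definition sigma_cls (c : opclass) (T : X -> X) : set C :=
  [set l | ~ in_classM c (shift T l) setT].
Definition sigma_gKR (T : X -> X) : set C := [set l | ~ GKRD (shift T l)].
Definition sigma_gK (T : X -> X) : set C := [set l | ~ GKD (shift T l)].
Definition sigma_Kt (T : X -> X) : set C := [set l | ~ Kato_type (shift T l)].
Definition sigma_eK (T : X -> X) : set C :=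
  [set l | ~ essentially_Kato (shift T l)].
Definition sigma_K (T : X -> X) : set C := [set l | ~ Kato (shift T l)].
Definition sigma_gDR (c : opclass) (T : X -> X) : set C :=
  [set l | ~ decomp_with (in_classM c) RieszM (shift T l)].

Definition infinite_dimensional : Prop := ~ exists s : seq X, span s = setT.

End OperatorNotions.

Section PlaneSets.
Context {R : realType}.
Local Notation C := (R[i]).

Definition boundaryC (K : set C) : set C :=
  closure (K : set C^o) `\` interior (K : set C^o).

Definition accC (K : set C) : set C :=
  [set l | forall e : C, 0 < e -> exists2 m, K m & m != l /\ `|m - l| < e].

Definition boundedC (A : set C) : Prop :=
  exists r : C, forall z, A z -> `|z| <= r.

Definition etaC (K : set C) : set C :=
  [set l | ~ (~ K l /\ ~ boundedC (connected_component (~` K : set C^o) l))].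

End PlaneSets.

(* Main.v *)
(* The two facts behind the theorem are perturbation results.  If S is Kato on M, then for
   all small l the operator S - l is Kato on M with the same nullity and defect; and if S is
   Riesz on N, then S - l is Browder on N for every l <> 0.  The membership of a direct sum
   in one of the nine (semi-)Fredholm classes does not depend on its Browder summand, so if
   T - l0 has a GKRD, then either all T - l with l near l0, l <> l0, lie in the class or none
   does.  Hence l0 cannot be both a boundary point and an accumulation point of the spectrum.
   In the same way l0 is not an accumulation point when T - l0 is the direct sum of an
   operator of the class and a Riesz operator.  The inclusions of the essentially Kato
   spectrum rest on Kato's decomposition of semi-Fredholm operators, obtained by splitting
   off Jordan chains one at a time, and the hulls agree because a set between the boundary of
   a compact K and K has the same hull as K. *)
Require Import Defs.
From HB Require Import structures.
From mathcomp Require Import all_boot all_order all_algebra.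
From mathcomp Require Import all_classical all_reals topology normedtype.
From mathcomp Require Import complex ring lra zify.
Import Order.TTheory GRing.Theory Num.Theory.
Import numFieldNormedType.Exports.
(* [shift], [span] and [free] also name MathComp notions; this makes them refer to Defs. *)
Import Defs.
Set Implicit Arguments.
Unset Strict Implicit.
Unset Printing Implicit Defensive.
Local Open Scope ring_scope.
Local Open Scope classical_set_scope.

(** The classes concern restrictions to subspaces, so every notion carries a set [M], and no
    subspace or quotient is made into a space of its own. Nullity and defect both become dimensions
    of one set relative to another ([cge], [cd]), and finitely many biorthogonal functionals take
    the place of adjoints. The analysis rests on one device, [approx_solve]: solvability up to half
    of the norm implies exact solvability with a bound. It yields the open mapping theorem,
    closedness of ranges, the Neumann series, and the equation (S - l) x = y on the hyper-range of a
    Kato operator. Persistence of nullity and defect then splits into four estimates, each number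
    being bounded below and above. The boundary argument has one delicate case, a boundary point l
    at which T - l itself belongs to the class; the trivial decomposition with zero Riesz part
    settles it. Part (b) follows the path of part (a): points near l are tested in the class R',
    which contains R and ignores Browder summands. *)

Inductive zexp := ZVar of nat | ZZero | ZAdd of zexp & zexp | ZOpp of zexp.

Fixpoint zeval (V : zmodType) (env : seq V) (e : zexp) : V :=
  match e with
  | ZVar n => env`_n
  | ZZero => 0
  | ZAdd a b => zeval env a + zeval env b
  | ZOpp a => - zeval env a
  end.

Fixpoint zcoef (e : zexp) (i : nat) : int :=
  match e with
  | ZVar n => if n == i then 1 else 0
  | ZZero => 0
  | ZAdd a b => zcoef a i + zcoef b i
  | ZOpp a => - zcoef a i
  end.

Lemma zevalE (V : zmodType) (env : seq V) e :
  zeval env e = \sum_(i < size env) env`_i *~ zcoef e i.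
Proof.
elim: e => [n||a IHa b IHb|a IHa] /=.
- have [ns|ns] := ltnP n (size env).
    rewrite (bigD1 (Ordinal ns)) //= eqxx big1 ?addr0 // => i /negPf ni.
    by case: eqP => // E; rewrite -val_eqE /= E eqxx in ni.
  rewrite nth_default // big1 // => i _; case: eqP => // E.
  by have := ltn_ord i; rewrite -E ltnNge ns.
- by rewrite big1.
- by rewrite IHa IHb -big_split; apply: eq_bigr => i _; rewrite mulrzDr.
- by rewrite IHa -sumrN; apply: eq_bigr => i _; rewrite mulrNz.
Qed.

(** The premise is a boolean over integer coefficients that evaluates on reified terms with the
    vectors left opaque; this is why [isT] proves it in [abelian_group]. *)
Lemma zeval_eq (V : zmodType) (env : seq V) a b :
  all (fun i => zcoef a i == zcoef b i) (iota 0 (size env)) -> zeval env a = zeval env b.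
Proof.
move=> /allP h; rewrite !zevalE; apply: eq_bigr => i _.
by have /h/eqP -> : nat_of_ord i \in iota 0 (size env) by rewrite mem_iota ltn_ord.
Qed.

(** The dummy [match constr:(Set)] lets the tactic [unify] run while a term is being built, so atoms
    are identified up to unification and not only syntactically. *)
Ltac zindex x l :=
  match l with
  | ?y :: _ => let _ := match constr:(Set) with _ => unify x y end in constr:(O)
  | _ :: ?t => let n := zindex x t in constr:(S n)
  end.
Ltac zmember x l :=
  match l with
  | nil => constr:(false)
  | ?y :: _ => let _ := match constr:(Set) with _ => unify x y end in constr:(true)
  | _ :: ?t => zmember x t
  end.
Ltac zatoms t l :=
  lazymatch t with
  | GRing.add ?a ?b => let l := zatoms a l in zatoms b l
  | GRing.opp ?a => zatoms a l
  | GRing.zero => l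
  | _ => let b := zmember t l in
         lazymatch b with true => l | false => constr:(t :: l) end
  end.
Ltac zreify t l :=
  lazymatch t with
  | GRing.add ?a ?b => let a := zreify a l in let b := zreify b l in constr:(ZAdd a b)
  | GRing.opp ?a => let a := zreify a l in constr:(ZOpp a)
  | GRing.zero => constr:(ZZero)
  | _ => let n := zindex t l in constr:(ZVar n)
  end.
(* [ring] does not see the additive group of a module; this decides equalities of
   integer combinations of vectors by comparing coefficients. *)
Ltac abelian_group :=
  lazymatch goal with
  | |- @eq ?V ?a ?b =>
    let l := zatoms a (@nil V) in
    let l := zatoms b l in
    let ea := zreify a l in
    let eb := zreify b l in
    exact: (@zeval_eq _ l ea eb isT)
  end.

Lemma addr_cross (V : zmodType) (a b c d : V) : a + b = c + d -> a - c = d - b.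
Proof.
move=> E; have -> : a = c + d - b by rewrite -E; abelian_group.
abelian_group.
Qed.

(** * The real-valued norm, bounded linear maps and completeness *)

Section RealNorm.
Context {R : realType}.
Local Notation C := R[i].

(* The library norm takes values in R[i], which is only partially ordered. *)
Definition nr {V : normedZmodType C} (x : V) : R := complex.Re `|x|.

Section Zmod.
Context {V : normedZmodType C}.
Implicit Types x y : V.

Lemma normE x : `|x| = (real_complex R (nr x)).
Proof. by rewrite /nr RRe_real // normr_real. Qed.

Lemma nr_ge0 x : 0 <= nr x.
Proof. by rewrite -ler0c -normE normr_ge0. Qed.

Lemma nr0 : nr (0 : V) = 0.
Proof. by rewrite /nr normr0. Qed.

Lemma nr_eq0 x : nr x = 0 -> x = 0.
Proof. by move=> h; apply/normr0_eq0; rewrite normE h. Qed.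

Lemma nr_gt0 x : x <> 0 -> 0 < nr x.
Proof.
move=> x0; rewrite lt_neqAle nr_ge0 andbT; apply/eqP => /esym h.
exact: x0 (nr_eq0 h).
Qed.

Lemma nrD x y : nr (x + y) <= nr x + nr y.
Proof. by have := ler_normD x y; rewrite !normE -rmorphD lecR. Qed.

Lemma nrN x : nr (- x) = nr x.
Proof. by rewrite /nr normrN. Qed.

Lemma nrBC x y : nr (x - y) = nr (y - x).
Proof. by rewrite -nrN opprB. Qed.

Lemma nrB x y : nr (x - y) <= nr x + nr y.
Proof. by rewrite -(nrN y) nrD. Qed.

Lemma nrtri (z x y : V) : nr (x - y) <= nr (x - z) + nr (z - y).
Proof. by rewrite -[x - y](_ : (x - z) + (z - y) = _) ?nrD // addrA subrK. Qed.

Lemma nr_sum n (F : 'I_n -> V) : nr (\sum_(i < n) F i) <= \sum_(i < n) nr (F i).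
Proof.
apply: (big_ind2 (fun (a : V) b => nr a <= b)) => //; first by rewrite nr0.
by move=> x a y b ha hb; apply: le_trans (nrD _ _) (lerD ha hb).
Qed.

Lemma nr_small0 x : (forall e, 0 < e -> nr x <= e) -> x = 0.
Proof.
move=> h; apply: nr_eq0; apply/eqP; rewrite eq_le nr_ge0 andbT leNgt.
by apply/negP => x0; have := h (nr x / 2); lra.
Qed.
End Zmod.

Lemma nrZ (V : normedModType C) (a : C) (x : V) : nr (a *: x) = nr a * nr x.
Proof. by have := normrZ a x; rewrite !normE -rmorphM => /complexI. Qed.

Lemma nrM (a b : C) : nr (a * b) = nr a * nr b.
Proof. by have := normrM a b; rewrite !normE -rmorphM => /complexI. Qed.

Lemma nrV (a : C) : nr a^-1 = (nr a)^-1.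
Proof. by have := normfV a; rewrite !normE -fmorphV => /complexI. Qed.

Lemma nrR (r : R) : nr (real_complex R r) = `|r|.
Proof.
apply: complexI; rewrite -normE normc_def /= expr0n /= addr0 sqrtr_sqr //.
Qed.

Lemma nr_RZ (V : normedModType C) (r : R) (x : V) : 0 <= r ->
  nr (real_complex R r *: x) = r * nr x.
Proof. by move=> r0; rewrite nrZ nrR ger0_norm. Qed.

Lemma posC (e : C) : 0 < e -> e = real_complex R (complex.Re e) /\ 0 < complex.Re e.
Proof. by case: e => a b; rewrite ltcE /= => /andP[/eqP -> ->]. Qed.

Lemma nbhs_nr (V : pseudoMetricNormedZmodType C) (x : V) (A : set V) :
  nbhs x A <-> exists2 e : R, 0 < e & forall y, nr (y - x) < e -> A y.
Proof.
rewrite -nbhs_ballE; split => [[e /= e0 eA]|[e e0 eA]].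
  have [eE re0] := posC e0; exists (complex.Re e) => // y yx; apply: eA.
  by rewrite -ball_normE /= -opprB normrN normE eE ltcR.
exists (real_complex R e); first by rewrite /= ltcR.
move=> y; rewrite -ball_normE /= -opprB normrN normE ltcR; exact: eA.
Qed.

Lemma closed_nr (V : pseudoMetricNormedZmodType C) (A : set V) :
  closed A <->
  (forall x, (forall e : R, 0 < e -> exists y, A y /\ nr (y - x) < e) -> A x).
Proof.
split=> [cA x h|h x clx].
  apply: cA => B /nbhs_nr[e e0 eB].
  by have [y [Ay yx]] := h e e0; exists y; split => //; exact: eB.
apply: h => e e0.
have /clx[y [Ay yx]] : nbhs x [set y | nr (y - x) < e].
  by apply/nbhs_nr; exists e.
by exists y.
Qed.

Definition lin (V W : lmodType C) (S : V -> W) : Prop :=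
  forall a x y, S (a *: x + y) = a *: S x + S y.

Definition bnd (V W : normedModType C) (S : V -> W) : Prop :=
  exists2 b : R, 0 < b & forall x, nr (S x) <= b * nr x.

Section Lin.
Context {V W : lmodType C} {S : V -> W}.
Hypothesis lS : lin S.

Lemma lin0 : S 0 = 0.
Proof. by have := lS (-1) 0 0; rewrite scaler0 addr0 scaleN1r addNr. Qed.
Lemma linD x y : S (x + y) = S x + S y.
Proof. by have := lS 1 x y; rewrite !scale1r. Qed.
Lemma linZ a x : S (a *: x) = a *: S x.
Proof. by have := lS a x 0; rewrite !addr0 lin0 addr0. Qed.
Lemma linN x : S (- x) = - S x.
Proof. by rewrite -scaleN1r linZ scaleN1r. Qed.
Lemma linB x y : S (x - y) = S x - S y.
Proof. by rewrite linD linN. Qed.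
Lemma lin_sum n (F : 'I_n -> V) : S (\sum_(i < n) F i) = \sum_(i < n) S (F i).
Proof.
apply: (big_ind2 (fun a b => S a = b)) => //; first exact: lin0.
by move=> x1 x2 y1 y2 <- <-; rewrite linD.
Qed.
Lemma lin_comb n (c : 'I_n -> C) (e : 'I_n -> V) :
  S (\sum_(i < n) c i *: e i) = \sum_(i < n) c i *: S (e i).
Proof. by rewrite lin_sum; apply: eq_bigr => i _; rewrite linZ. Qed.
End Lin.

Section Endo.
Context {X : normedModType C}.
Implicit Types S : X -> X.

Lemma lin_iter S n : lin S -> lin (iter n S).
Proof.
by move=> lS; elim: n => [|n IH] a x y //=; rewrite IH lS.
Qed.

Lemma bnd_iter S n : bnd S -> bnd (iter n S).
Proof.
move=> [b b0 hb]; elim: n => [|n [c c0 hc]].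
  by exists 1 => // x; rewrite mul1r.
exists (b * c); first by rewrite mulr_gt0.
by move=> x /=; apply: le_trans (hb _) _; rewrite -mulrA ler_pM2l.
Qed.

Lemma lin_shift S l : lin S -> lin (shift S l).
Proof.
move=> lS a x y; rewrite /shift lS scalerDr scalerBr opprD !scalerA (mulrC l).
by rewrite addrACA.
Qed.

Lemma bnd_shift S l : bnd S -> bnd (shift S l).
Proof.
move=> [b b0 hb]; exists (b + nr l); first by rewrite ltr_wpDr // nr_ge0.
move=> x; rewrite /shift mulrDl; apply: le_trans (nrB _ _) _.
by rewrite nrZ lerD2r.
Qed.

Lemma shift_shift S l m : shift (shift S l) m = shift S (l + m).
Proof. by apply/funext => x; rewrite /shift scalerDl opprD addrA. Qed.

Lemma shift_zero S : shift S 0 = S.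
Proof. by apply/funext => x; rewrite /shift scale0r subr0. Qed.

Lemma lin_bnd_continuous (W : normedModType C) (S : X -> W) :
  lin S -> continuous S -> bnd S.
Proof.
move=> lS /(_ 0); rewrite /continuous_at (lin0 lS) => cS.
have /cS/nbhs_nr[e e0 he] : nbhs (0 : W) [set y | nr (y - 0) < 1].
  by apply/nbhs_nr; exists 1.
exists (2 / e); first by rewrite divr_gt0.
move=> x; have [->|/eqP x0] := eqVneq x 0; first by rewrite lin0 // !nr0 mulr0.
have nx := nr_gt0 x0.
(* Scaling by this factor brings x to norm e / 2, inside the ball given by continuity at 0. *)
have t0 : 0 < e / 2 / nr x by rewrite !divr_gt0.
have := he (real_complex R (e / 2 / nr x) *: x).
rewrite /= !subr0 (linZ lS) !nr_RZ ?(ltW t0) //.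
rewrite divfK ?gt_eqF // => /(_ ltac:(lra)).
rewrite mulrAC ltr_pdivrMr // mul1r => h.
rewrite ltW // mulrAC ltr_pdivlMr //; lra.
Qed.
End Endo.

Section Complete.
Context {X : completeNormedModType C}.

(* Geometric control of the increments is the only form in which completeness is used. *)
Lemma geometric_limit (u : nat -> X) (b : R) : 0 <= b ->
  (forall k, nr (u k.+1 - u k) <= b * 2^-1 ^+ k) ->
  exists l, forall k, nr (l - u k) <= 2 * b * 2^-1 ^+ k.
Proof.
move=> b0 hu.
(* The partial geometric sum is kept exact, with the factor [1 - 2^-1 ^+ m], so that the induction
   on m closes. *)
have hm k m : nr (u (k + m)%N - u k) <= 2 * b * 2^-1 ^+ k * (1 - 2^-1 ^+ m).
  elim: m => [|m IH]; first by rewrite addn0 subrr nr0 expr0 subrr mulr0.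
  apply: le_trans (nrtri (u (k + m)%N) _ _) _.
  have := hu (k + m)%N; rewrite addnS => h.
  apply: le_trans (lerD h IH) _.
  by rewrite exprD exprS; lra.
have hm' k m : nr (u (k + m)%N - u k) <= 2 * b * 2^-1 ^+ k.
    have := hm k m.
have : 0 <= b * 2^-1 ^+ k by rewrite mulr_ge0 ?exprn_ge0 ?invr_ge0.
have : 0 <= (2^-1 : R) ^+ m by rewrite exprn_ge0 ?invr_ge0.
nra.
have small e : 0 < e -> exists k, 2 * b * 2^-1 ^+ k < e.
  move=> e0; have [k hk] : exists k : nat, 2 * b / e < 2 ^+ k.
    exists (Num.truncn (2 * b / e)).+1.
    apply: lt_le_trans (truncnS_gt _) _; rewrite -natrX ler_nat.
    by rewrite ltnW // ltn_expl.
  exists k; rewrite exprVn ltr_pdivrMr ?exprn_gt0 //.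
  by rewrite -ltr_pdivrMl // mulrC.
have cu : cauchy (u @ \oo).
  apply/cauchyP => /= e /posC[eE e0].
  have [k hk] := small _ e0.
  exists (u k); exists k => // m /= km; rewrite -ball_normE /= -opprB normrN.
  by rewrite normE eE ltcR -(subnKC km) (le_lt_trans (hm' _ _)).
have /cauchy_cvg/cvg_ex[l ul] := cu.
(* If the bound failed, its excess would be a radius within which some [u (k + N)] approaches [l],
   against [hm']. *)
exists l => k; rewrite leNgt; apply/negP => hk.
have d0 : 0 < nr (l - u k) - 2 * b * 2^-1 ^+ k by rewrite subr_gt0.
have /ul[N _ hN] : nbhs l [set y | nr (y - l) < nr (l - u k) - 2 * b * 2^-1 ^+ k].
  by apply/nbhs_nr; exists (nr (l - u k) - 2 * b * 2^-1 ^+ k).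
have := hN (k + N)%N (leq_addl _ _); rewrite /= => h.
have := nrtri (u (k + N)%N) l (u k); rewrite (nrBC l (u (k + N)%N)).
have := hm' k N; lra.
Qed.
End Complete.
End RealNorm.

(** * The Hahn-Banach theorem and biorthogonal functionals *)

Section HahnBanach.
Context {R : realType}.
Local Notation C := R[i].
Local Notation "r %:C" := (real_complex R r).

Section Inf.
Context {I : Type} {A : set I} {f : I -> R} {m : R}.
Hypotheses (A0 : A !=set0) (hm : forall i, A i -> m <= f i).

Lemma inf_image_le i : A i -> inf (f @` A) <= f i.
Proof.
move=> Ai; apply: ge_inf; last by exists i.
by exists m => _ [j Aj <-]; exact: hm.
Qed.

Lemma le_inf_image b : (forall i, A i -> b <= f i) -> b <= inf (f @` A).
Proof.
move=> hb; apply: lb_le_inf; first by case: A0 => i Ai; exists (f i), i.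
by move=> _ [j Aj <-]; exact: hb.
Qed.
End Inf.

Section Sublinear.
Context {V : lmodType C}.
Implicit Types (p q : V -> R) (x y z a : V).

(** Homogeneity is asked only as an inequality for r > 0, the form that is checked on infima;
    [sublinZ] recovers equality by applying it to the inverse of r. *)
Definition sublin q := [/\ q 0 = 0, (forall x y, q (x + y) <= q x + q y) &
  (forall (r : R) x, 0 < r -> q (r%:C *: x) <= r * q x)].

Lemma sublin_ge q x : sublin q -> - q (- x) <= q x.
Proof. by move=> [q0 qD _]; have := qD x (- x); rewrite subrr q0; lra. Qed.

Lemma sublinZ q r x : sublin q -> 0 <= r -> q (r%:C *: x) = r * q x.
Proof.
move=> [q0 qD qZ]; rewrite le_eqVlt => /predU1P[<-|r0].
  by rewrite scale0r q0 mul0r.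
apply/eqP; rewrite eq_le qZ //=.
have := qZ r^-1 (r%:C *: x); rewrite invr_gt0 => /(_ r0).
rewrite scalerA -rmorphM mulVf ?gt_eqF // scale1r mulrC.
by rewrite ler_pdivlMr // mulrC.
Qed.

(** The auxiliary functional of the Hahn-Banach theorem by minimal sublinear functionals: it is
    sublinear, lies below q, and takes a value at most - q a at - a. If q is minimal, then
    [slide q a = q], and so q (- a) = - q a. *)
Definition slide q a x := inf ((fun t => q (x + t%:C *: a) - t * q a) @` [set t | 0 <= t]).

Section Slide.
Variables (q : V -> R) (a : V).
Hypothesis sq : sublin q.

Let nonempty : [set t : R | 0 <= t] !=set0.
Proof. by exists 0 => /=. Qed.

Let bounded x (t : R) : 0 <= t -> - q (- x) <= q (x + t%:C *: a) - t * q a.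
Proof.
move=> t0; have [q0 qD qZ] := sq.
have := qD (x + t%:C *: a) (- x); rewrite addrAC subrr add0r sublinZ //; lra.
Qed.

Let slide_le_at x (t : R) : 0 <= t -> slide q a x <= q (x + t%:C *: a) - t * q a.
Proof. by move=> t0; apply: (inf_image_le (@bounded x)). Qed.

Lemma slide_le x : slide q a x <= q x.
Proof.
have := slide_le_at x (lexx 0).
by rewrite scale0r addr0 mul0r subr0.
Qed.

Lemma slideN : slide q a (- a) <= - q a.
Proof.
have [q0 _ _] := sq.
have := slide_le_at (- a) ler01.
by rewrite scale1r addNr q0; lra.
Qed.

Lemma sublin_slide : sublin (slide q a).
Proof.
have [q0 qD qZ] := sq; split.
- apply/eqP; rewrite eq_le; apply/andP; split.
    by have := slide_le 0; rewrite q0.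
  apply: le_inf_image => // t t0; rewrite add0r sublinZ //; lra.
- move=> x y; rewrite -lerBlDr; apply: le_inf_image => // s s0.
  rewrite lerBlDr -lerBlDl; apply: le_inf_image => // t t0.
  have := slide_le_at (x + y) (addr_ge0 s0 t0).
  have := qD (x + s%:C *: a) (y + t%:C *: a).
  rewrite addrACA -scalerDl -rmorphD; lra.
- move=> r x r0; rewrite mulrC -ler_pdivrMr //; apply: le_inf_image => // t t0.
  rewrite ler_pdivrMr //.
  have := slide_le_at (r%:C *: x) (mulr_ge0 (ltW r0) t0).
  have := qZ r (x + t%:C *: a) r0.
  rewrite scalerDr scalerA -rmorphM; lra.
Qed.
End Slide.

(* A minimal sublinear functional is linear: sliding it along any vector does not lower it. *)
Lemma sublin_minimal p : sublin p -> exists q, [/\ sublin q, (forall x, q x <= p x) &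
  forall q', sublin q' -> (forall x, q' x <= q x) -> q' = q].
Proof.
move=> sp; pose T := {q | sublin q /\ forall x, q x <= p x}.
(* The order is reversed, so that the maximal element given by Zorn's lemma is a minimal
   functional. *)
pose rel (q1 q2 : T) := `[< forall x, sval q2 x <= sval q1 x >].
have [||||[q [sq qp]] qmin] := @Zorn T rel.
- by move=> q; apply/asboolP.
- by move=> q1 q2 q3 /asboolP h1 /asboolP h2; apply/asboolP => x;
    apply: le_trans (h2 x) (h1 x).
- move=> [q1 h1] [q2 h2] /asboolP /= h12 /asboolP /= h21; apply: eq_exist.
  by apply/funext => x; apply/eqP; rewrite eq_le h12 h21.
- move=> A Atot; have [A0|/set0P/negP/negPn/eqP A0] := pselect (A !=set0); last first.
    have hp : sublin p /\ forall x, p x <= p x by [].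
    by exists (exist _ p hp) => s; rewrite A0.
  (* A lower bound common to the whole chain, which makes the pointwise infimum [g] meaningful. *)
  have lb x (q : T) : A q -> - p (- x) <= sval q x.
    case: q => q [sq qp] _ /=; apply: le_trans (sublin_ge x sq).
    by rewrite lerN2.
  pose g x := inf ((fun q : T => sval q x) @` A).
  have gle x (q : T) : A q -> g x <= sval q x by apply: (inf_image_le (@lb x)).
  have sg : sublin g.
    split.
    + case: A0 => q Aq; apply/eqP; rewrite eq_le; apply/andP; split.
        by have := gle 0 q Aq; case: (svalP q) => -[-> _ _].
      apply: le_inf_image; first by exists q.
      by move=> q' _; case: (svalP q') => -[-> _ _].
    (* Two members of a chain are comparable, and the smaller one serves for both arguments. *)
    + move=> x y; rewrite -lerBlDr; apply: le_inf_image => // q1 A1.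
      rewrite lerBlDr -lerBlDl; apply: le_inf_image => // q2 A2.
      rewrite lerBlDr; have [/asboolP h|/asboolP h] := Atot _ _ A1 A2.
        apply: le_trans (gle _ _ A2) _; case: (svalP q2) => -[_ qD _] _.
        by apply: le_trans (qD _ _) _; rewrite addrC lerD2l.
      apply: le_trans (gle _ _ A1) _; case: (svalP q1) => -[_ qD _] _.
      by apply: le_trans (qD _ _) _; rewrite addrC lerD2r.
    + move=> r x r0; rewrite mulrC -ler_pdivrMr //; apply: le_inf_image => // q Aq.
      rewrite ler_pdivrMr //; apply: le_trans (gle _ _ Aq) _.
      by case: (svalP q) => -[_ _ qZ] _; rewrite mulrC qZ.
  have gp : forall x, g x <= p x.
    case: A0 => q Aq x; apply: le_trans (gle _ _ Aq) _.
    by case: (svalP q).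
  by exists (exist _ g (conj sg gp)) => q Aq; apply/asboolP => x; exact: gle.
- exists q; split => // q' sq' q'q.
  have hq' : sublin q' /\ forall x, q' x <= p x.
    by split => // x; apply: le_trans (q'q x) (qp x).
  have /(_ (exist _ q' hq')) := qmin.
  by move=> /(_ ltac:(exact/asboolP)) [].
Qed.

(** A minimal functional below p is linear but uncontrolled at [x0]. Sliding p along [x0] beforehand
    forces u (- x0) <= - p x0, hence equality at [x0]. *)
Lemma real_hahn_banach p x0 : sublin p -> exists u : V -> R,
  [/\ forall x y, u (x + y) = u x + u y, forall r x, u (r%:C *: x) = r * u x,
      forall x, u x <= p x & u x0 = p x0].
Proof.
move=> sp; have sp' := sublin_slide x0 sp.
have [u [su up' umin]] := sublin_minimal sp'.
have [u0 uD uZ] := su.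
have up x : u x <= p x by apply: le_trans (up' x) (slide_le _ sp x).
have uN x : u (- x) = - u x.
  have := slideN x su; rewrite (umin _ (sublin_slide x su) (slide_le x su)).
  have := sublin_ge (x) su; lra.
have uadd x y : u (x + y) = u x + u y.
  apply/eqP; rewrite eq_le uD /=.
  by have := uD (- x) (- y); rewrite -opprD !uN; lra.
exists u; split => //.
  move=> r x; have [r0|/ltW r0] := leP 0 r; first exact: sublinZ.
  rewrite -[r]opprK rmorphN scaleNr uN sublinZ ?oppr_ge0 //; lra.
apply/eqP; rewrite eq_le up /=.
have := up' (- x0); have := slideN x0 sp; rewrite uN; lra.
Qed.
End Sublinear.

Section Separation.
Context {X : normedModType C}.

Definition dist (Y : set X) (x : X) : R := inf ((fun y => nr (x - y)) @` Y).

Section Dist.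
Variable Y : set X.
Hypothesis cY : closed_subspace Y.

Let Y0 : Y !=set0. Proof. by case: cY => Y0 _ _ _; exists 0. Qed.

Lemma dist_le x y : Y y -> dist Y x <= nr (x - y).
Proof. by apply: (@inf_image_le _ _ _ 0) => z _; exact: nr_ge0. Qed.

Lemma le_dist x b : (forall y, Y y -> b <= nr (x - y)) -> b <= dist Y x.
Proof. exact: le_inf_image. Qed.

Lemma dist_mem y : Y y -> dist Y y = 0.
Proof.
move=> Yy; apply/eqP; rewrite eq_le; apply/andP; split.
  by have := dist_le y Yy; rewrite subrr nr0.
by apply: le_dist => z _; exact: nr_ge0.
Qed.

Lemma sublin_dist : sublin (dist Y).
Proof.
have [Yz YD YZ _] := cY; split; first exact: dist_mem.
- move=> x y; rewrite -lerBlDr; apply: le_dist => s Ys.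
  rewrite lerBlDr -lerBlDl; apply: le_dist => t Yt.
  rewrite lerBlDr; apply: le_trans (dist_le _ (YD _ _ Ys Yt)) _.
  by rewrite opprD addrACA addrC; apply: le_trans (nrD _ _) _; rewrite addrC lexx.
- move=> r x r0; rewrite mulrC -ler_pdivrMr //; apply: le_dist => s Ys.
  rewrite ler_pdivrMr // mulrC -(nr_RZ _ (ltW r0)) scalerBr.
  exact/dist_le/YZ.
Qed.

Lemma dist_gt0 x : ~ Y x -> 0 < dist Y x.
Proof.
move=> Yx; rewrite lt_neqAle; apply/andP; split; last first.
  by apply: le_dist => z _; exact: nr_ge0.
apply/negP => /eqP d0; apply: Yx; have [_ _ _ /closed_nr] := cY; apply => e e0.
apply: contrapT => h; have : e <= dist Y x; last by rewrite -d0; lra.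
apply: le_dist => y Yy; rewrite leNgt; apply/negP => hy; apply: h.
by exists y; rewrite nrBC.
Qed.
End Dist.

Lemma nr_complex_le (a b : R) : nr (Complex a b : C) <= `|a| + `|b|.
Proof.
have -> : (Complex a b) = a%:C + 'i%C * b%:C :> C by rewrite (complexE (Complex a b)).
apply: le_trans (nrD _ _) _; rewrite nrM !nrR.
suff -> : nr ('i%C : C) = 1 by rewrite mul1r.
by apply: complexI; rewrite -normE normc_def /= expr0n add0r expr1n sqrtr1.
Qed.

(** The real theorem is applied to the distance from Y, which vanishes on Y and is positive at [x0].
    The real functional u is complexified as u x - i u (i x); its value at [x0] has real part
    [dist Y x0], so it can be divided out. *)
Lemma hahn_banach (Y : set X) (x0 : X) : closed_subspace Y -> ~ Y x0 ->
  exists f : X -> C^o, [/\ lin f, bnd f, (forall y, Y y -> f y = 0) & f x0 = 1].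
Proof.
move=> cY Yx0; have [Yz YD YZ _] := cY.
have [u [uD uZ up ux0]] := real_hahn_banach x0 (sublin_dist cY).
have u0 : u 0 = 0 by have := uD 0 0; rewrite addr0; lra.
have uN x : u (- x) = - u x by have := uD x (- x); rewrite subrr u0; lra.
have uabs x : `|u x| <= nr x.
  have h y : u y <= nr y.
    by apply: le_trans (up y) _; rewrite -{2}[y]subr0; exact: dist_le.
  by rewrite ler_norml h andbT lerNl -uN -(nrN x) h.
pose f0 x : C^o := Complex (u x) (- u ('i%C *: x)).
have lf0 : lin f0.
  move=> [r s] x y.
  have E : (Complex r s : C) = r%:C + s%:C * 'i%C by rewrite (complexE (Complex r s)) mulrC.
  have E2 : ('i%C * (Complex r s : C)) = r%:C * 'i%C + (- s)%:C.
    by rewrite E mulrDr mulrCA -expr2 sqr_i mulrN1 -rmorphN mulrC.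
  rewrite /f0 scalerDr scalerA E2 {1}E !scalerDl !uD -!scalerA !uZ.
  by apply/eqP; rewrite eq_complex /=; apply/andP; split; apply/eqP; ring.
have bf0 x : nr (f0 x) <= 2 * nr x.
  apply: le_trans (nr_complex_le _ _) _; rewrite normrN.
  have := uabs x; have := uabs ('i%C *: x); rewrite nrZ.
  suff -> : nr ('i%C : C) = 1 by lra.
  by apply: complexI; rewrite -normE normc_def /= expr0n add0r expr1n sqrtr1.
have f0Y y : Y y -> f0 y = 0.
  have uY z : Y z -> u z = 0.
    move=> Yz'; apply/eqP; rewrite eq_le -{1}(dist_mem cY Yz') up /=.
    rewrite -oppr_le0 -uN; apply: le_trans (up _) _; rewrite dist_mem //.
    by rewrite -scaleN1r; exact: YZ.
  by move=> Yy; rewrite /f0 !uY ?oppr0 //; exact: YZ.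
have fx0 : f0 x0 != 0.
  rewrite /f0 eq_complex /= negb_and ux0 gt_eqF //; exact: dist_gt0.
exists (fun x => (f0 x0)^-1 *: f0 x); split.
- by move=> a x y; rewrite lf0 scalerDr !scalerA (mulrC a).
- exists (nr (f0 x0)^-1 * 2 + 1).
    by rewrite ltr_wpDl // mulr_ge0 ?nr_ge0.
  move=> x; rewrite nrZ mulrDl mul1r -mulrA.
  have := nr_ge0 x; have := nr_ge0 (f0 x0)^-1; have := bf0 x; nra.
- by move=> y Yy; rewrite (f0Y y Yy) scaler0.
- by rewrite /GRing.scale /= mulVf.
Qed.

Lemma closed_preimage (V W : normedModType C) (S : V -> W) (A : set W) :
  lin S -> bnd S -> closed A -> closed [set x | A (S x)].
Proof.
move=> lS [b b0 hb] /closed_nr cA; apply/closed_nr => x h; apply: cA => e e0.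
have [y [Ay yx]] := h _ (divr_gt0 e0 b0); exists (S y); split => //.
rewrite -(linB lS); apply: le_lt_trans (hb _) _.
by rewrite mulrC -ltr_pdivlMr.
Qed.

Lemma closed_subspace_preimage (S : X -> X) (A : set X) :
  lin S -> bnd S -> closed_subspace A -> closed_subspace [set x | A (S x)].
Proof.
move=> lS bS [A0 AD AZ cA]; split => /=; first by rewrite lin0.
- by move=> x y; rewrite (linD lS); exact: AD.
- by move=> a x; rewrite (linZ lS); exact: AZ.
- exact: closed_preimage.
Qed.

Definition addspan (B : set X) n (e : 'I_n -> X) : set X :=
  [set x | exists c : 'I_n -> C, B (x - \sum_(i < n) c i *: e i)].

(** If e is outside B, a functional f that vanishes on B with f e = 1 reads off the coefficient of
    e. The sum is then the preimage of B under the bounded map x - f x e. *)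
Lemma closed_add_line (B : set X) (e : X) : closed_subspace B ->
  closed_subspace [set x | exists a : C, B (x - a *: e)].
Proof.
move=> cB; have [B0 BD BZ clB] := cB.
have [Be|Be] := pselect (B e).
  rewrite [X in closed_subspace X](_ : _ = B) //; apply/seteqP; split => x /=.
    by move=> [a h]; rewrite -[x](subrK (a *: e)); exact/BD/BZ.
  by move=> Bx; exists 0; rewrite scale0r subr0.
have [f [lf [b b0 hb] fB fe]] := hahn_banach cB Be.
pose S x := x - f x *: e.
have lS : lin S.
  by move=> a x y; rewrite /S lf scalerDl scalerBr opprD addrACA scalerA.
have bS : bnd S.
  exists (1 + b * nr e); first by rewrite ltr_wpDr // mulr_ge0 ?nr_ge0 ?ltW.
  move=> x; apply: le_trans (nrB _ _) _; rewrite nrZ mulrDl mul1r lerD2l mulrAC.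
  by rewrite ler_wpM2r ?nr_ge0.
rewrite [X in closed_subspace X](_ : _ = [set x | B (S x)]).
  exact: closed_subspace_preimage.
apply/seteqP; split => x /=; last by move=> h; exists (f x).
move=> [a h]; suff -> : S x = x - a *: e by [].
have := fB _ h; rewrite (linB lf) (linZ lf) fe => /eqP; rewrite subr_eq0 => /eqP E.
by rewrite /S E /GRing.scale /= mulr1.
Qed.

Lemma closed_addspan (B : set X) n (e : 'I_n -> X) : closed_subspace B ->
  closed_subspace (addspan B e).
Proof.
move=> cB; elim: n e => [|n IH] e.
  rewrite (_ : addspan B e = B) //; apply/seteqP; split => x /=.
    by move=> [c]; rewrite big_ord0 subr0.
  by move=> Bx; exists (fun=> 0); rewrite big_ord0 subr0.
have := closed_add_line (e ord0) (IH (fun i => e (lift ord0 i))).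
congr closed_subspace; apply/seteqP; split => x /=.
  move=> [a [c h]]; exists (fun i => oapp c a (unlift ord0 i)).
  rewrite big_ord_recl unlift_none /= opprD addrA.
  by under eq_bigr do rewrite liftK /=.
move=> [c]; rewrite big_ord_recl opprD addrA => h.
by exists (c ord0), (fun i => c (lift ord0 i)).
Qed.

Definition indep (B : set X) n (e : 'I_n -> X) : Prop :=
  forall c : 'I_n -> C, B (\sum_(i < n) c i *: e i) -> forall i, c i = 0.

(** Each functional separates one vector from the closed subspace generated by B and the other
    vectors. *)
Lemma biorthogonal (B : set X) n (e : 'I_n -> X) :
  closed_subspace B -> indep B e ->
  exists f : 'I_n -> X -> C^o, forall i, [/\ lin (f i), bnd (f i),
    (forall y, B y -> f i y = 0) & forall j, f i (e j) = (i == j)%:R].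
Proof.
move=> cB ie; have [B0 _ _ _] := cB.
suff /choice[f hf] : forall i, exists f : X -> C^o, [/\ lin f, bnd f,
    (forall y, B y -> f y = 0) & forall j, f (e j) = (i == j)%:R].
  by exists f.
(* Replacing the i-th vector by 0 instead of deleting it keeps the index type. *)
move=> i; pose e' j := if j == i then 0 else e j.
have cY := closed_addspan e' cB.
have Yi : ~ addspan B e' (e i).
  move=> [c h]; pose d j := if j == i then 1 else - c j.
  suff /ie/(_ i) : B (\sum_(j < n) d j *: e j).
    by rewrite /d eqxx => /eqP; rewrite oner_eq0.
  move: h; congr B; rewrite (bigD1 i) //= [RHS](bigD1 i) //= /d /e' eqxx.
  rewrite scaler0 add0r scale1r -sumrN; congr (_ + _); apply: eq_bigr => j /negPf ->.
  by rewrite scaleNr.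
have [f [lf bf fY fi]] := hahn_banach cY Yi.
exists f; split => //.
  move=> y By; apply: fY; exists (fun=> 0); rewrite big1 ?subr0 // => j _.
  by rewrite scale0r.
move=> j; have [<-//|ij] := eqVneq i j.
apply: fY; exists (fun k => (k == j)%:R).
rewrite (bigD1 j) //= big1 ?addr0 => [|k /negPf ->]; last by rewrite scale0r.
by rewrite eqxx scale1r /e' eq_sym (negPf ij) subrr.
Qed.
End Separation.
End HahnBanach.

(** * Dimension of one subspace relative to another *)

Section Codimension.
Context {R : realType} {X : normedModType R[i]}.
Local Notation C := R[i].
Implicit Types (M N B L : set X) (m n : nat).

Definition subsp M : Prop :=
  [/\ M 0, (forall x y, M x -> M y -> M (x + y)) & (forall (a : C) x, M x -> M (a *: x))].

Lemma closed_subsp M : closed_subspace M -> subsp M.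
Proof. by case. Qed.

Section Subsp.
Variable M : set X.
Hypothesis sM : subsp M.

Lemma subsp0 : M 0. Proof. by case: sM. Qed.
Lemma subspD x y : M x -> M y -> M (x + y). Proof. by case: sM => _ h _; exact: h. Qed.
Lemma subspZ (a : C) x : M x -> M (a *: x). Proof. by case: sM => _ _ h; exact: h. Qed.
Lemma subspN x : M x -> M (- x).
Proof. by move=> Mx; rewrite -scaleN1r; exact: subspZ. Qed.
Lemma subspB x y : M x -> M y -> M (x - y).
Proof. by move=> Mx My; apply: subspD => //; exact: subspN. Qed.
Lemma subsp_sum n (F : 'I_n -> X) : (forall i, M (F i)) -> M (\sum_(i < n) F i).
Proof. by move=> h; elim/big_ind : _ => //; [exact: subsp0 | exact: subspD]. Qed.
Lemma subsp_comb n (c : 'I_n -> C) (e : 'I_n -> X) :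
  (forall i, M (e i)) -> M (\sum_(i < n) c i *: e i).
Proof. by move=> h; apply: subsp_sum => i; exact: subspZ. Qed.
Lemma subspBl x y : M (x - y) -> M y -> M x.
Proof. by move=> h My; rewrite -(subrK y x); exact: subspD. Qed.
End Subsp.

Lemma subsp_zero : subsp [set 0 : X].
Proof.
split=> //= [x y -> ->|a x ->]; [exact: addr0|exact: scaler0].
Qed.

Lemma comb_lin n (a : C) (c d : 'I_n -> C) (e : 'I_n -> X) :
  \sum_(i < n) (a * c i + d i) *: e i =
  a *: (\sum_(i < n) c i *: e i) + \sum_(i < n) d i *: e i.
Proof.
rewrite scaler_sumr -big_split; apply: eq_bigr => i _.
by rewrite scalerDl scalerA.
Qed.

Lemma subsp_addspan B n (e : 'I_n -> X) : subsp B -> subsp (addspan B e).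
Proof.
move=> sB; split.
- by exists (fun=> 0); rewrite big1 ?subr0 => [|i _]; [exact: subsp0|rewrite scale0r].
- move=> x y [c hc] [d hd]; exists (fun i => 1 * c i + d i).
  by rewrite comb_lin scale1r opprD addrACA; exact: subspD.
- move=> a x [c hc]; exists (fun i => a * c i + 0).
  rewrite comb_lin [X in _ - (_ + X)]big1 ?addr0 => [|i _]; last by rewrite scale0r.
  by rewrite -scalerBr; exact: subspZ.
Qed.

Lemma comb_delta n (e : 'I_n -> X) (j : 'I_n) :
  \sum_(i < n) (i == j)%:R *: e i = e j.
Proof.
rewrite (bigD1 j) //= eqxx scale1r big1 ?addr0 // => i /negPf ->.
by rewrite scale0r.
Qed.

Lemma addspan_gen B n (e : 'I_n -> X) j : subsp B -> addspan B e (e j).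
Proof.
move=> sB; exists (fun i => (i == j)%:R).
by rewrite comb_delta subrr; exact: subsp0.
Qed.

(* [cge M B n] and [cd M B n]: the quotient of M by its intersection with B has dimension
   at least n, respectively exactly n.  With B = [set 0] this is the dimension of M. *)
Definition cge M B n : Prop :=
  exists e : 'I_n -> X, (forall i, M (e i)) /\ indep B e.

Definition cspan M B n : Prop :=
  exists e : 'I_n -> X, (forall i, M (e i)) /\ (forall x, M x -> addspan B e x).

Definition cd M B n : Prop := cge M B n /\ ~ cge M B n.+1.

(** For n < m the coefficient matrix of the [e i] in terms of the [f j] modulo B has a nonzero left
    kernel, and each row of that kernel is a relation among the [e i] modulo B. *)
Lemma steinitz M B m n : subsp B -> cge M B m -> cspan M B n -> (m <= n)%N.
Proof.
move=> sB [e [Me ie]] [f [_ hf]]; rewrite leqNgt; apply/negP => nm.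
have /choice[A hA] : forall i, exists c : 'I_n -> C, B (e i - \sum_(j < n) c j *: f j).
  by move=> i; apply: hf.
pose K := kermx (\matrix_(i < m, j < n) A i j).
have : (0 < \rank K)%N by rewrite mxrank_ker subn_gt0 (leq_ltn_trans (rank_leq_col _)).
rewrite lt0n mxrank_eq0 => /eqP K0; apply: K0; apply/matrixP => k i; rewrite [RHS]mxE.
move: i; apply: ie.
rewrite (_ : \sum_i _ = \sum_(i < m) K k i *: (e i - \sum_(j < n) A i j *: f j)).
  by apply: subsp_comb.
under [RHS]eq_bigr do rewrite scalerBr scaler_sumr.
rewrite sumrB [X in _ - X]exchange_big [X in _ - X]big1 ?subr0 // => j _.
under eq_bigr do rewrite scalerA.
rewrite -scaler_suml.
rewrite (_ : \sum_i _ = (K *m \matrix_(i < m, j < n) A i j) k j).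
  by rewrite mulmx_ker mxE scale0r.
by rewrite [RHS]mxE; apply: eq_bigr => i _; congr (_ * _); rewrite mxE.
Qed.

Lemma cge0 M B : cge M B 0.
Proof. by exists (fun=> 0); split => [[]|c _ []]. Qed.

Lemma cge_S M B n : cge M B n.+1 -> cge M B n.
Proof.
move=> [e [Me ie]]; exists (fun i => e (lift ord0 i)); split => // c h i.
have /ie/(_ (lift ord0 i)) : B (\sum_(j < n.+1) oapp c 0 (unlift ord0 j) *: e j).
  rewrite big_ord_recl unlift_none /= scale0r add0r.
  by under eq_bigr do rewrite liftK.
by rewrite liftK.
Qed.

Lemma cge_le M B m n : (m <= n)%N -> cge M B n -> cge M B m.
Proof.
by move=> /subnK <-; elim: (n - m)%N => // k IH; rewrite addSn => /cge_S.
Qed.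

Lemma cge_sub M M' B n : M `<=` M' -> cge M B n -> cge M' B n.
Proof. by move=> MM' [e [Me ie]]; exists e; split => // i; apply/MM'. Qed.

Lemma cd_exists M B m : ~ cge M B m -> exists2 n, (n < m)%N & cd M B n.
Proof.
elim: m => [|m IH] h; first by case: h; exact: cge0.
have [hm|/IH[n nm hn]] := pselect (cge M B m); first by exists m.
by exists n => //; exact: ltnW.
Qed.

Lemma cd_uniq M B m n : cd M B m -> cd M B n -> m = n.
Proof.
move=> [hm hm'] [hn hn']; apply/eqP; rewrite eqn_leq; apply/andP; split.
  by rewrite leqNgt; apply/negP => h; apply: hn'; apply: cge_le h hm.
by rewrite leqNgt; apply/negP => h; apply: hm'; apply: cge_le h hn.
Qed.

(** An independent family of maximal length generates: a vector outside its span could be put in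
    front of it. *)
Lemma cd_basis M B n : subsp B -> cd M B n ->
  exists e : 'I_n -> X, [/\ (forall i, M (e i)), indep B e &
                            forall x, M x -> addspan B e x].
Proof.
move=> sB [[e [Me ie]] h]; exists e; split => // x Mx.
apply: contrapT => hx; apply: h.
exists (fun i => oapp e x (unlift ord0 i)); split.
  by move=> i; case: unliftP => [j|] _ /=.
move=> c; rewrite big_ord_recl unlift_none /=.
under eq_bigr do rewrite liftK /=.
move=> hc; have c0 : c ord0 = 0.
  apply/eqP/negPn/negP => c0; apply: hx.
  have sA := subsp_addspan e sB.
  rewrite -[x]scale1r -(mulVf c0) -scalerA; apply: subspZ => //.
  by exists (fun i => - c (lift ord0 i)); under eq_bigr do rewrite scaleNr;
     rewrite sumrN opprK.
move=> i; case: (unliftP ord0 i) => [j|] -> //.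
by move: j; apply: ie; rewrite c0 scale0r add0r in hc.
Qed.

Lemma cdP M B n : subsp B -> cd M B n <-> cge M B n /\ cspan M B n.
Proof.
move=> sB; split => [h|[h1 h2]].
  split; first by case: h.
  by have [e [Me _ se]] := cd_basis sB h; exists e.
by split => // /(steinitz sB)/(_ h2); rewrite ltnn.
Qed.

Lemma basis_cd M B n (e : 'I_n -> X) : subsp B -> (forall i, M (e i)) -> indep B e ->
  (forall x, M x -> addspan B e x) -> cd M B n.
Proof. by move=> sB Me ie se; apply/cdP => //; split; exists e. Qed.

(** Independent families are carried along a linear relation rather than a map, so that the choice
    of preimages, as in x = S x', is covered as well as the application of S. *)
Lemma cge_transfer M B M' B' (r : X -> X -> Prop) n :
  r 0 0 -> (forall a x x' y y', r x x' -> r y y' -> r (a *: x + y) (a *: x' + y')) ->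
  (forall x, M x -> exists2 x', M' x' & r x x') ->
  (forall x x', r x x' -> B' x' -> B x) ->
  cge M B n -> cge M' B' n.
Proof.
move=> r0 rl rM rB [e [Me ie]].
have /choice[e' he'] : forall i, exists x', M' x' /\ r (e i) x'.
  by move=> i; have [x' ? ?] := rM _ (Me i); exists x'.
exists e'; split => [i|c h]; first by case: (he' i).
apply: ie; apply: rB h.
elim/big_ind2 : _ => // [x x' y y' h h'|i _].
  by have := rl 1 _ _ _ _ h h'; rewrite !scale1r.
by have := rl (c i) _ _ _ _ (proj2 (he' i)) r0; rewrite !addr0.
Qed.

Lemma cge_transfer_eq M B M' B' n : M `<=` M' -> (forall x, M x -> B' x -> B x) ->
  subsp M -> cge M B n -> cge M' B' n.
Proof.
move=> MM' BB' sM; apply: (@cge_transfer _ _ _ _ (fun x x' => M x /\ x = x')).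
- by split => //; exact: subsp0.
- by move=> a x x' y y' [Mx <-] [My <-]; split => //; apply: subspD => //; exact: subspZ.
- by move=> x Mx; exists x => //; exact: MM'.
- by move=> x x' [Mx <-]; exact: BB'.
Qed.

Definition cat_ord m n (e : 'I_m -> X) (f : 'I_n -> X) (i : 'I_(m + n)) : X :=
  match fintype.split i with inl j => e j | inr j => f j end.

Lemma comb_cat m n (e : 'I_m -> X) (f : 'I_n -> X) (c : 'I_(m + n) -> C) :
  \sum_i c i *: cat_ord e f i =
  \sum_i c (lshift n i) *: e i + \sum_i c (rshift m i) *: f i.
Proof.
rewrite big_split_ord; congr (_ + _); apply: eq_bigr => i _; rewrite /cat_ord.
  by rewrite (unsplitK (inl i)).
by rewrite (unsplitK (inr i)).
Qed.

Lemma cat_ordP (P : X -> Prop) m n (e : 'I_m -> X) (f : 'I_n -> X) :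
  (forall i, P (e i)) -> (forall i, P (f i)) -> forall i, P (cat_ord e f i).
Proof. by move=> he hf i; rewrite /cat_ord; case: fintype.split. Qed.

Lemma cat_coef m n (c : 'I_(m + n) -> C) :
  (forall i, c (lshift n i) = 0) -> (forall i, c (rshift m i) = 0) -> forall i, c i = 0.
Proof. by move=> h1 h2 i; case: (split_ordP i) => j ->. Qed.

Lemma cat_span m n (e : 'I_m -> X) (f : 'I_n -> X) (c : 'I_m -> C) (d : 'I_n -> C) :
  exists g : 'I_(m + n) -> C, \sum_i g i *: cat_ord e f i =
    \sum_i c i *: e i + \sum_i d i *: f i.
Proof.
exists (fun i => match fintype.split i with inl j => c j | inr j => d j end).
rewrite comb_cat; congr (_ + _); apply: eq_bigr => i _.
  by rewrite (unsplitK (inl i)).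
by rewrite (unsplitK (inr i)).
Qed.

Lemma cd_tower M L B m n : subsp L -> subsp B -> B `<=` L -> L `<=` M ->
  cd M L m -> cd L B n -> cd M B (m + n).
Proof.
move=> sL sB BL LM /(cd_basis sL)[e [Me ie se]] /(cd_basis sB)[f [Lf jf sf]].
apply: (@basis_cd _ _ _ (cat_ord e f)) => //.
- by apply: cat_ordP => // i; exact: LM.
- move=> c; rewrite comb_cat => h.
  have h1 : forall i, c (lshift n i) = 0.
    apply: ie; apply: (@subspBl _ sL _ (- \sum_i c (rshift m i) *: f i)).
      by rewrite opprK; exact: BL.
    by apply: subspN => //; exact: subsp_comb.
  apply: cat_coef => //; apply: jf; move: h; rewrite big1 ?add0r // => i _.
  by rewrite h1 scale0r.
- move=> x /se[c /sf[d h]]; have [g hg] := cat_span e f c d.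
  by exists g; rewrite hg opprD addrA.
Qed.

Definition issum M M1 N : Prop :=
  (forall x, M x <-> exists y z, [/\ M1 y, N z & x = y + z]) /\
  (forall x, M1 x -> N x -> x = 0).

Section Sum.
Variables M M1 N B B1 B2 : set X.
Hypotheses (sM1 : subsp M1) (sN : subsp N) (sB1 : subsp B1) (sB2 : subsp B2).
Hypotheses (BM1 : B1 `<=` M1) (BN : B2 `<=` N).
Hypothesis hM : issum M M1 N.
Hypothesis hB : forall x, B x <-> exists y z, [/\ B1 y, B2 z & x = y + z].

Lemma issum_split y z : M1 y -> N z -> B (y + z) -> B1 y /\ B2 z.
Proof.
move=> My Nz /hB[y' [z' [By Bz E]]].
have E' : y - y' = z' - z by apply/eqP; rewrite subr_eq addrAC eq_sym subr_eq E addrC.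
have h0 : y - y' = 0.
  apply: (proj2 hM); first by apply: subspB => //; exact: BM1.
  by rewrite E'; apply: subspB => //; exact: BN.
have -> : y = y' by apply/eqP; rewrite -subr_eq0 h0.
by have -> : z = z' by apply/esym/eqP; rewrite -subr_eq0 -E' h0.
Qed.

Lemma subsp_issum : subsp B.
Proof.
split; first by apply/hB; exists 0, 0; split; rewrite ?addr0 //; exact: subsp0.
- move=> x x' /hB[y [z [h1 h2 ->]]] /hB[y' [z' [h1' h2' ->]]]; apply/hB.
  by exists (y + y'), (z + z'); split; rewrite 1?addrACA //; exact: subspD.
- move=> a x /hB[y [z [h1 h2 ->]]]; apply/hB.
  by exists (a *: y), (a *: z); split; rewrite ?scalerDr //; exact: subspZ.
Qed.

Lemma cd_sum m n : cd M1 B1 m -> cd N B2 n -> cd M B (m + n).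
Proof.
move=> /(cd_basis sB1)[e [Me ie se]] /(cd_basis sB2)[f [Lf jf sf]].
apply: (@basis_cd _ _ _ (cat_ord e f)); first exact: subsp_issum.
- apply: cat_ordP => i; apply/(proj1 hM).
    by exists (e i), 0; split; rewrite ?addr0 //; exact: subsp0.
  by exists 0, (f i); split; rewrite ?add0r //; exact: subsp0.
- move=> c; rewrite comb_cat => /issum_split[||h1 h2].
  + exact: subsp_comb.
  + exact: subsp_comb.
  + by apply: cat_coef; [exact: ie|exact: jf].
- move=> x /(proj1 hM)[y [z [/se[c hc] /sf[d hd] ->]]].
  have [g hg] := cat_span e f c d; exists g; rewrite hg.
  by apply/hB; exists (y - \sum_i c i *: e i), (z - \sum_i d i *: f i); split => //;
    rewrite opprD addrACA.
Qed.

Lemma cge_sum_l n : cge M1 B1 n -> cge M B n.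
Proof.
apply: cge_transfer_eq => // [x Mx|x Mx Bx].
  by apply/(proj1 hM); exists x, 0; split; rewrite ?addr0 //; exact: subsp0.
by have [|//] := @issum_split x 0 Mx (subsp0 sN); rewrite addr0.
Qed.

Lemma cd_sum_l k n : cd M B k -> cd N B2 n -> exists2 m, cd M1 B1 m & k = (m + n)%N.
Proof.
move=> hk hn; have /cd_exists[m _ hm] : ~ cge M1 B1 k.+1.
  by move=> /cge_sum_l; case: hk.
by exists m => //; apply: cd_uniq hk _; exact: cd_sum.
Qed.
End Sum.

Lemma cd_zero M B : M `<=` B -> cd M B 0.
Proof.
move=> MB; split; first exact: cge0.
move=> [e [Me ie]]; have /ie/(_ ord0)/eqP : B (\sum_(i < 1) 1 *: e i).
  by rewrite big_ord1 scale1r; exact: MB.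
by rewrite oner_eq0.
Qed.

Lemma cd0_sub M B : cd M B 0 -> forall x, M x -> exists2 a : C, a != 0 & B (a *: x).
Proof.
move=> [_ h] x Mx; apply: contrapT => hx; apply: h; exists (fun=> x); split => // c.
rewrite big_ord1 => Bc i; rewrite ord1; apply/eqP/negPn/negP => c0.
by apply: hx; exists (c ord0).
Qed.

Lemma cd0P M B : subsp B -> cd M B 0 <-> M `<=` B.
Proof.
move=> sB; split; last exact: cd_zero.
move=> h x /(cd0_sub h)[a a0 Bx].
by rewrite -[x]scale1r -(mulVf a0) -scalerA; exact: subspZ.
Qed.

Lemma ord_fun_nth n (e : 'I_n -> X) :
  exists2 s : seq X, size s = n & e = (fun i : 'I_n => s`_i).
Proof.
exists [seq e i | i <- enum 'I_n]; first by rewrite size_map size_enum_ord.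
apply/funext => i; rewrite (nth_map i) ?size_enum_ord //.
by congr e; apply: val_inj; rewrite /= nth_enum_ord.
Qed.

(** A bridge, like [dim_eqP] below, from the list-based definitions to [cd], in which all counting
    is done. *)
Lemma codim_eqP M B n : subsp M -> subsp B -> B `<=` M ->
  codim_eq M B n <-> cd M B n.
Proof.
move=> sM sB BM; split.
  move=> [s [<- fs sM' hM hB]]; apply: (@basis_cd _ _ _ (fun i => s`_i)) => //.
  - by move=> i; apply/sM'/mem_nth.
  - by move=> c hc; apply: fs; apply: hB => //; exists c.
  - move=> x /hM[b [y [Bb [c ->] ->]]]; exists c.
    by rewrite addrK.
move=> /(cd_basis sB)[e [Me ie se]]; have [s sz eE] := ord_fun_nth e.
subst n; exists s; split => //.
- move=> c hc; apply: ie; rewrite eE hc; exact: subsp0.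
- by move=> x /(nthP 0)[i isz <-]; have := Me (Ordinal isz); rewrite eE.
- move=> x; split.
    move=> /se[c hc]; exists (x - \sum_i c i *: e i), (\sum_i c i *: e i).
    by split; rewrite ?subrK //; exists c; rewrite eE.
  move=> [b [y [Bb [c ->] ->]]]; apply: subspD => //; first exact: BM.
  by apply: subsp_comb => // i; have := Me i; rewrite eE.
- move=> x Bx [c E]; rewrite E big1 // => i _.
  by rewrite (ie c) ?scale0r // eE -E.
Qed.

Lemma dim_eqP A n : subsp A -> dim_eq A n <-> cd A [set 0] n.
Proof.
move=> sA; split.
  move=> [s [<- fs sE]]; apply: (@basis_cd _ _ _ (fun i => s`_i)).
  - exact: subsp_zero.
  - move=> i; rewrite -sE; exists (fun j => (j == i)%:R).
    by rewrite (comb_delta (fun j : 'I__ => s`_j)).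
  - by move=> c; exact: fs.
  - by move=> x; rewrite -sE => -[c ->]; exists c; rewrite /= subrr.
move=> /(cd_basis subsp_zero)[e [Me ie se]]; have [s sz eE] := ord_fun_nth e.
subst n; exists s; split => //.
- by move=> c hc; apply: ie; rewrite eE.
- apply/seteqP; split => x.
    by move=> [c ->]; apply: subsp_comb => // i; have := Me i; rewrite eE.
  by move=> /se[c /eqP]; rewrite subr_eq0 => /eqP ->; exists c; rewrite eE.
Qed.

Lemma finite_dimP A : subsp A -> finite_dim A <-> exists n, ~ cge A [set 0] n.
Proof.
move=> sA; split => [[n /dim_eqP[]]|[n /cd_exists[m _ h]]] //.
  by exists n.+1.
by exists m; apply/dim_eqP.
Qed.
End Codimension.

(** * Successive approximation, open mapping and closed ranges *)

Section OpenMapping.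
Context {R : realType} {X : completeNormedModType R[i]}.
Local Notation C := R[i].
Local Notation "r %:C" := (real_complex R r).
Implicit Types (S : X -> X) (M N Y W Z : set X).

Lemma geometric_small (K e : R) : 0 < e -> exists k, K * 2^-1 ^+ k < e.
Proof.
move=> e0; exists (Num.truncn (K / e)).+1.
rewrite exprVn ltr_pdivrMr ?exprn_gt0 // -ltr_pdivrMl // mulrC.
apply: lt_trans (truncnS_gt _) _; rewrite -natrX ltr_nat.
by rewrite ltn_expl.
Qed.

Lemma half_gt0 k : 0 < (2^-1 : R) ^+ k.
Proof. by rewrite exprn_gt0 // invr_gt0. Qed.

(* Successive approximation turns approximate into exact solvability.  The second summand f,
   on which S does not act, makes the lemma cover complements of a range. *)
Lemma approx_solve S W1 W2 Y (c : R) : 0 <= c -> lin S -> bnd S ->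
  closed_subspace W1 -> closed_subspace W2 ->
  (forall y, Y y -> exists x f, [/\ W1 x, W2 f, Y (y - (S x + f)),
     nr x <= c * nr y /\ nr f <= c * nr y & nr (y - (S x + f)) <= nr y / 2]) ->
  forall y, Y y -> exists x f, [/\ W1 x, W2 f, y = S x + f,
    nr x <= 2 * c * nr y & nr f <= 2 * c * nr y].
Proof.
move=> c0 lS [b b0 hb] cW1 cW2 hY y Yy.
have [W10 W1D _ /closed_nr clW1] := cW1; have [W20 W2D _ /closed_nr clW2] := cW2.
have /choice[g hg] : forall z, exists p : X * X, Y z ->
    [/\ W1 p.1, W2 p.2, Y (z - (S p.1 + p.2)),
     nr p.1 <= c * nr z /\ nr p.2 <= c * nr z & nr (z - (S p.1 + p.2)) <= nr z / 2].
  move=> z; have [Yz|Yz] := pselect (Y z); last by exists (0, 0).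
  by have [x [f h]] := hY z Yz; exists (x, f).
(* [v k] is the residual after k corrections; [u i k] adds up their first ([i = fst]) or second
   components. *)
pose v k := iter k (fun z => z - (S (g z).1 + (g z).2)) y.
have vS k : v k.+1 = v k - (S (g (v k)).1 + (g (v k)).2) by [].
have Yv k : Y (v k) by elim: k => // k; rewrite vS => /hg[].
have vle k : nr (v k) <= nr y * 2^-1 ^+ k.
  elim: k => [|k IH]; first by rewrite expr0 mulr1.
  have [_ _ _ _] := hg _ (Yv k); rewrite -vS exprS; lra.
pose u (i : X * X -> X) k : X := \sum_(j < k) i (g (v j)).
have uS i k : u i k.+1 = u i k + i (g (v k)) by rewrite /u big_ord_recr.
have lim (i : X * X -> X) : (forall k, nr (i (g (v k))) <= c * nr (v k)) ->
    exists l, forall k, nr (l - u i k) <= 2 * (c * nr y) * 2^-1 ^+ k.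
  move=> hi; apply: geometric_limit; first by rewrite mulr_ge0 // nr_ge0.
  move=> k; rewrite uS addrAC subrr add0r; apply: le_trans (hi k) _.
  by rewrite -mulrA ler_wpM2l.
have [|x hx] := lim fst; first by move=> k; have [_ _ _ [] ] := hg _ (Yv k).
have [|f hf] := lim snd; first by move=> k; have [_ _ _ [] ] := hg _ (Yv k).
have mem (W : set X) i l : W 0 -> (forall x y, W x -> W y -> W (x + y)) ->
    (forall x, (forall e : R, 0 < e -> exists y, W y /\ nr (y - x) < e) -> W x) ->
    (forall k, W (i (g (v k)))) ->
    (forall k, nr (l - u i k) <= 2 * (c * nr y) * 2^-1 ^+ k) -> W l.
  move=> W0 WD cW Wi hl; apply: cW => e e0.
  have [k hk] := geometric_small (2 * (c * nr y)) e0.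
  exists (u i k); split; last by rewrite nrBC; exact: le_lt_trans (hl k) hk.
  by elim: k {hk} => [|k IH]; [rewrite /u big_ord0|rewrite uS; exact: WD].
exists x, f; split.
- by apply: mem hx => // k; have [] := hg _ (Yv k).
- by apply: mem hf => // k; have [] := hg _ (Yv k).
(* The error of the limit consists of the residual [v k] and the contributions of the two tails,
   each of order [2^-1 ^+ k]. *)
- apply/eqP; rewrite -subr_eq0; apply/eqP/nr_small0 => e e0.
  have [k hk] := geometric_small (nr y + b * (2 * (c * nr y)) + 2 * (c * nr y)) e0.
  have -> : y - (S x + f) = v k - (S (x - u fst k) + (f - u snd k)).
    have E : y = v k + S (u fst k) + u snd k.
      elim: k {hk} => [|k IH]; first by rewrite /u !big_ord0 (lin0 lS) !addr0.
      rewrite {1}IH !uS vS (linD lS).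
      abelian_group.
    rewrite {1}E (linB lS).
    abelian_group.
  apply: ltW; apply: le_lt_trans hk.
  apply: le_trans (nrB _ _) _; rewrite mulrDl mulrDl -addrA; apply: lerD => //.
  apply: le_trans (nrD _ _) _; apply: lerD => //.
  by apply: le_trans (hb _) _; rewrite -mulrA ler_pM2l.
- by have := hx 0; rewrite /u big_ord0 subr0 expr0 mulr1 mulrA.
- by have := hf 0; rewrite /u big_ord0 subr0 expr0 mulr1 mulrA.
Qed.

(** Baire's theorem relative to Y: if every [A n] failed to be dense in every relative ball, nested
    balls avoiding A 0, A 1, ... would shrink to a point of Y that lies in no [A n]. *)
Lemma baire_closed Y (A : nat -> set X) : closed Y -> Y !=set0 ->
  (forall y, Y y -> exists n, A n y) ->
  exists n y0 (r : R), [/\ Y y0, 0 < r & forall y, Y y -> nr (y - y0) < r ->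
    forall d : R, 0 < d -> exists a, A n a /\ nr (a - y) < d].
Proof.
move=> /closed_nr cY [y0 Yy0] YA; apply: contrapT => H.
have step (p : nat * (X * R)) : exists q : X * R, Y p.2.1 -> 0 < p.2.2 ->
    [/\ Y q.1, 0 < q.2, q.2 <= p.2.2 / 2, nr (q.1 - p.2.1) <= p.2.2 / 2 &
        forall a, A p.1 a -> q.2 < nr (a - q.1)].
  case: p => n [y r] /=.
  have [[Yy r0]|h] := pselect (Y y /\ 0 < r); last by exists (0, 0) => ? ?; case: h.
  have [z [d [Yz yz d0 hd]]] : exists z d, [/\ Y z, nr (z - y) < r / 2, 0 < d &
      forall a, A n a -> d <= nr (a - z)].
    apply: contrapT => h; apply: H; exists n, y, (r / 2); split => //.
      by rewrite divr_gt0.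
    move=> z Yz zy d d0; apply: contrapT => h'; apply: h; exists z, d; split => //.
    by move=> a Aa; rewrite leNgt; apply/negP => ad; apply: h'; exists a.
  (* Points of [A n] have distance at least d from z, so d / 2 keeps them strictly outside the new
     ball; r / 2 makes the radii decrease geometrically. *)
  exists (z, Num.min (d / 2) (r / 2)) => _ _; split => //=.
  - by rewrite lt_min !divr_gt0.
  - by rewrite ge_min lexx orbT.
  - exact: ltW.
  - move=> a /hd da; rewrite gt_min; apply/orP; left; lra.
have [g hg] := choice step.
pose fix s n : X * R := if n is k.+1 then g (k, s k) else (y0, 1).
have hs k : Y (s k).1 /\ 0 < (s k).2.
  by elim: k => [|k [Yk rk]] /=; [split|have [] := hg (k, s k) Yk rk].
have sS k : [/\ (s k.+1).2 <= (s k).2 / 2, nr ((s k.+1).1 - (s k).1) <= (s k).2 / 2 &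
    forall a, A k a -> (s k.+1).2 < nr (a - (s k.+1).1)].
  by have [Yk rk] := hs k; have [] := hg (k, s k) Yk rk.
have rle n k : (s (n + k)%N).2 <= (s n).2 * 2^-1 ^+ k.
  elim: k => [|k IH]; first by rewrite addn0 expr0 mulr1.
  by rewrite addnS exprS; have [h _ _] := sS (n + k)%N; lra.
have dle n k : nr ((s (n + k)%N).1 - (s n).1) <= (s n).2 * (1 - 2^-1 ^+ k).
  elim: k => [|k IH]; first by rewrite addn0 subrr nr0 expr0 subrr mulr0.
  apply: le_trans (nrtri (s (n + k)%N).1 _ _) _.
  rewrite addnS exprS; have [_ h _] := sS (n + k)%N; have := rle n k; lra.
have [|k|l hl] := @geometric_limit _ _ (fun k => (s k).1) (2^-1); first lra.
  have [_ h _] := sS k; apply: le_trans h _; have := rle 0 k; rewrite /= mul1r; lra.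
have Yl : Y l.
  apply: cY => e e0; have [k hk] := geometric_small (2 * 2^-1) e0.
  exists (s k).1; split; first by case: (hs k).
  by rewrite nrBC; exact: le_lt_trans (hl k) hk.
have [n An] := YA l Yl; have [_ _ /(_ l An)] := sS n.
rewrite ltNge => /negP; apply; rewrite leNgt; apply/negP => h.
have e0 : 0 < nr (l - (s n.+1).1) - (s n.+1).2 by rewrite subr_gt0.
have [k hk] := geometric_small (2 * 2^-1) e0.
have := dle n.+1 k; have := hl (n.+1 + k)%N.
have := nrtri (s (n.+1 + k)%N).1 l (s n.+1).1.
have h2 : 2 * 2^-1 * 2^-1 ^+ (n.+1 + k) <= 2 * 2^-1 * (2^-1 : R) ^+ k.
  apply: ler_wpM2l; first by rewrite divr_ge0.
  by apply: ler_wiXn2l; rewrite ?invr_ge0 ?invf_le1 ?ler1n ?leq_addl.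
have := mulr_gt0 (proj2 (hs n.+1)) (half_gt0 k); lra.
Qed.

(** By Baire's theorem the images of pairs of norm at most n are dense in some ball of Y.
    Differences move this ball to the origin, and [approx_solve] turns density into exact
    solutions. *)
Lemma open_mapping S W1 W2 : lin S -> bnd S ->
  closed_subspace W1 -> closed_subspace W2 ->
  closed [set y | exists x f, [/\ W1 x, W2 f & y = S x + f]] ->
  exists2 c : R, 0 < c & forall y x f, W1 x -> W2 f -> y = S x + f ->
    exists x' f', [/\ W1 x', W2 f', y = S x' + f', nr x' <= c * nr y & nr f' <= c * nr y].
Proof.
move=> lS bS cW1 cW2; set Y := [set y | _] => cY.
have sW1 := closed_subsp cW1; have sW2 := closed_subsp cW2.
have YB y z : Y y -> Y z -> Y (y - z).
  move=> [x [f [Wx Wf ->]]] [x' [f' [Wx' Wf' ->]]].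
  exists (x - x'), (f - f'); split; [exact: subspB|exact: subspB|].
  by rewrite (linB lS) opprD addrACA.
have YZ (a : C) y : Y y -> Y (a *: y).
  move=> [x [f [Wx Wf ->]]]; exists (a *: x), (a *: f).
  by split; [exact: subspZ|exact: subspZ|rewrite (linZ lS) scalerDr].
have Y0 : Y 0.
  by exists 0, 0; split; [exact: subsp0|exact: subsp0|rewrite (lin0 lS) addr0].
pose A n := [set y | exists x f, [/\ W1 x, W2 f, y = S x + f, nr x <= n%:R & nr f <= n%:R]].
have [||n [y0 [r [Yy0 r0 hr]]]] := @baire_closed Y A cY; first by exists 0.
  move=> y [x [f [Wx Wf ->]]]; exists (Num.truncn (nr x + nr f)).+1, x, f.
  have := truncnS_gt (nr x + nr f); have := nr_ge0 x; have := nr_ge0 f.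
  by split => //; lra.
(* In [hY], t scales y to norm r / 2, and both y0 and y0 + t y are approximated from [A n] up to r /
   8. After division by t the error is at most nr y / 2, and the difference of two preimages of norm
   at most n is bounded by 4 n / r times nr y. *)
pose c : R := 4 * n%:R / r.
have c0 : 0 <= c by rewrite divr_ge0 ?mulr_ge0 // ltW.
have hY y : Y y -> exists x f, [/\ W1 x, W2 f, Y (y - (S x + f)),
     nr x <= c * nr y /\ nr f <= c * nr y & nr (y - (S x + f)) <= nr y / 2].
  move=> Yy; have [->|/eqP/nr_gt0 ny] := eqVneq y 0.
    exists 0, 0; rewrite (lin0 lS) addr0 subr0 !nr0.
    by split; rewrite ?mulr0 ?mul0r //; exact: subsp0.
  pose t := r / (2 * nr y).
  have t0 : 0 < t by rewrite divr_gt0 // mulr_gt0.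
  have tE : t * nr y = r / 2 by rewrite /t; field; lra.
  have tV : t^-1 = 2 * nr y / r by rewrite invf_div.
  have Y1 : Y (y0 + t%:C *: y) by rewrite -[_ *: y]opprK -scaleNr; apply/YB/YZ.
  have d0 : 0 < r / 8 by rewrite divr_gt0.
  have [|a [[x [f [Wx Wf aE nx nf]]] ha]] := hr _ Y1 _ _ d0.
    by rewrite addrAC subrr add0r nr_RZ ?ltW // tE; lra.
  have [|a' [[x' [f' [Wx' Wf' aE' nx' nf']]] ha']] := hr _ Yy0 _ _ d0.
    by rewrite subrr nr0.
  have tb (p q : X) : nr p <= n%:R -> nr q <= n%:R -> nr (t^-1%:C *: (p - q)) <= c * nr y.
    move=> hp hq; rewrite nr_RZ ?invr_ge0 ?(ltW t0) // tV.
    have := nrB p q => h.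
    have -> : c * nr y = 2 * nr y / r * (2 * n%:R) by rewrite /c; field; lra.
    by rewrite ler_wpM2l ?divr_ge0 ?mulr_ge0 ?nr_ge0 ?(ltW r0) //; lra.
  exists (t^-1%:C *: (x - x')), (t^-1%:C *: (f - f')).
  have E : S (t^-1%:C *: (x - x')) + t^-1%:C *: (f - f') = t^-1%:C *: (a - a').
    by rewrite (linZ lS) (linB lS) -scalerDr aE aE' opprD addrACA.
  rewrite E; split; [by apply: subspZ => //; exact: subspB
                    |by apply: subspZ => //; exact: subspB| |by split; exact: tb|].
    by apply: (YB) => //; apply: YZ; apply: YB; [exists x, f|exists x', f'].
  have -> : y - t^-1%:C *: (a - a') = t^-1%:C *: ((a' - y0) - (a - (y0 + t%:C *: y))).
    have yE : y = t^-1%:C *: (t%:C *: y).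
      by rewrite scalerA -rmorphM mulVf ?gt_eqF // scale1r.
    rewrite {1}yE -scalerBr; congr (_ *: _); abelian_group.
  rewrite nr_RZ ?invr_ge0 ?(ltW t0) // ler_pdivrMl //.
  have := nrB (a' - y0) (a - (y0 + t%:C *: y)); lra.
(* The added 1 keeps the constant positive when n, hence c, is 0. *)
exists (2 * c + 1); first by lra.
move=> y x f Wx Wf yE.
have Yy : Y y by exists x, f.
have [x' [f' [Wx' Wf' yE' nx nf]]] := approx_solve c0 lS bS cW1 cW2 hY Yy.
by exists x', f'; split => //; rewrite mulrDl mul1r; have := nr_ge0 y; lra.
Qed.

Lemma closed_subspace0 : closed_subspace [set 0 : X].
Proof.
case: (@subsp_zero R X) => h1 h2 h3; split => //; apply/closed_nr => x h /=.
apply: nr_small0 => e /h[y [-> ]]; rewrite add0r nrN; exact: ltW.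
Qed.

(** For c > 0 this bounds the reduced minimum modulus of S on M below by 1 / c, with a witness in
    place of the distance to the kernel. *)
Definition solvable_bound S M (c : R) : Prop :=
  forall x, M x -> exists2 x', M x' /\ S x' = S x & nr x' <= c * nr (S x).

Lemma closed_range_bound S M : lin S -> bnd S -> closed_subspace M ->
  closed (rangeM S M) -> exists2 c : R, 0 < c & solvable_bound S M c.
Proof.
move=> lS bS cM cR; have [|c c0 hc] := open_mapping lS bS cM closed_subspace0.
  rewrite (_ : [set y | _] = rangeM S M) //; apply/seteqP; split => y.
    by move=> [x [f [Mx /= -> ->]]]; exists x; rewrite ?addr0.
  by move=> [x Mx <-]; exists x, 0; rewrite addr0.
exists c => // x Mx.
have [|x' [f' [Mx' /= -> E h1 _]]] := hc (S x) x 0 Mx erefl; first by rewrite addr0.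
by exists x' => //; split => //; rewrite E addr0.
Qed.

Lemma bound_closed_range S M (c : R) : lin S -> bnd S -> closed_subspace M ->
  0 <= c -> solvable_bound S M c -> closed (rangeM S M).
Proof.
move=> lS bS cM c0 hc; have sM := closed_subsp cM; apply/closed_nr => y hy.
pose Y := [set y | forall e : R, 0 < e -> exists z, rangeM S M z /\ nr (z - y) < e].
(* A point of the range within nr y / 2 of y has norm at most 3 / 2 times nr y. *)
have cc : 0 <= 3 / 2 * c by lra.
have [|x [f [Mx /= -> -> _ _]]] := approx_solve cc lS bS cM closed_subspace0 _ (hy : Y y).
  move=> {hy} {}y hy; have [->|/eqP/nr_gt0 ny] := eqVneq y 0.
    exists 0, 0; rewrite (lin0 lS) addr0 subr0 !nr0.
    split; rewrite ?mulr0 ?mul0r //; first exact: subsp0.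
    by move=> e e0; exists 0; rewrite subrr nr0; split => //; exists 0; [exact: subsp0|exact: lin0].
  have /hy[_ [[x Mx <-] xy]] : 0 < nr y / 2 by lra.
  have [x' [Mx' E] nx'] := hc x Mx.
  exists x', 0; rewrite addr0 nr0 E; split => //=.
  - move=> e /hy[_ [[z Mz <-] zy]]; exists (S (z - x)); split.
      by exists (z - x) => //; exact: subspB.
    by rewrite (_ : S (z - x) - (y - S x) = S z - y) ?(linB lS) //; abelian_group.
  - split; last by rewrite mulr_ge0 ?nr_ge0.
    have := nrtri y (S x) 0; rewrite !subr0 => h.
    have : c * nr (S x) <= c * (3 / 2 * nr y) by rewrite ler_wpM2l //; lra.
    lra.
  - by rewrite nrBC ltW.
by exists x; rewrite ?addr0.
Qed.

Lemma subsp_range S M : lin S -> subsp M -> subsp (rangeM S M).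
Proof.
move=> lS sM; split; first by exists 0; [exact: subsp0|exact: lin0].
- move=> _ _ [x Mx <-] [y My <-]; exists (x + y); [exact: subspD|exact: linD].
- move=> a _ [x Mx <-]; exists (a *: x); [exact: subspZ|exact: linZ].
Qed.

Lemma subsp_ker S M : lin S -> subsp M -> subsp (kerM S M).
Proof.
move=> lS sM; split; first by split; [exact: subsp0|exact: lin0].
- move=> x y [Mx Sx] [My Sy]; split; first exact: subspD.
  by rewrite (linD lS) Sx Sy addr0.
- by move=> a x [Mx Sx]; split; [exact: subspZ|rewrite (linZ lS) Sx scaler0].
Qed.

Lemma closed_subsp_range S M : lin S -> closed_subspace M -> closed (rangeM S M) ->
  closed_subspace (rangeM S M).
Proof. by move=> lS /closed_subsp/(subsp_range lS)[h1 h2 h3] h4; split. Qed.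

(** A basis modulo the range spans a complement F. By the open mapping theorem for (x, f) -> S x +
    f, the F-component of a vector is bounded by its norm; subtracting points of the range leaves it
    unchanged, so it vanishes for a limit of such points. *)
Lemma finite_codim_closed S M n : lin S -> bnd S -> closed_subspace M ->
  invariant S M -> ~ cge M (rangeM S M) n -> closed (rangeM S M).
Proof.
move=> lS bS cM iM /cd_exists[k _ hk]; have sM := closed_subsp cM.
have sR := subsp_range lS sM; have [e [Me ie se]] := cd_basis sR hk.
have cF := closed_addspan e closed_subspace0.
have FM f : addspan [set 0] e f -> M f.
  by move=> [c /= /eqP]; rewrite subr_eq0 => /eqP ->; exact: subsp_comb.
have FR f : addspan [set 0] e f -> rangeM S M f -> f = 0.
  move=> [c /= /eqP]; rewrite subr_eq0 => /eqP -> /ie c0.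
  by rewrite big1 // => i _; rewrite c0 scale0r.
have sF := closed_subsp cF.
have MY : [set y | exists x f, [/\ M x, addspan [set 0] e f & y = S x + f]] = M.
  apply/seteqP; split => y; last first.
    move=> /se[c [x Mx E]]; exists x, (\sum_i c i *: e i); split => //.
      by exists c; rewrite subrr.
    by rewrite E subrK.
  by move=> [x [f [Mx Ff ->]]]; apply: subspD => //; [exact: iM|exact: FM].
have clM : closed M by case: cM.
have [|c c0 hc] := open_mapping lS bS cM cF; first by rewrite MY.
apply/closed_nr => y hy.
have My : M y.
  move/closed_nr: clM; apply => d /hy[_ [[x Mx <-] xy]].
  by exists (S x); split => //; exact: iM.
have : [set y | exists x f, [/\ M x, addspan [set 0] e f & y = S x + f]] y by rewrite MY.
move=> [x [f [Mx Ff yE]]].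
suff f0 : f = 0 by exists x => //; rewrite yE f0 addr0.
apply: nr_small0 => d d0; have /hy[_ [[z Mz <-] zy]] : 0 < d / c by rewrite divr_gt0.
have E : y - S z = S (x - z) + f by rewrite yE (linB lS) addrAC.
have [x' [f' [Mx' Ff' E' _ nf']]] := hc _ _ _ (subspB sM Mx Mz) Ff E.
have ff : f = f'.
  apply/eqP; rewrite -subr_eq0; apply/eqP/FR; first exact: subspB.
  exists (x' - (x - z)); first by do 2 apply: subspB => //.
  by rewrite (linB lS); apply: addr_cross; rewrite -E' E.
rewrite ff; apply: le_trans nf' _; rewrite nrBC -ler_pdivlMl // mulrC.
exact: ltW.
Qed.

(** [K] is Z plus the kernel of S on M, and it is closed because it is finite-dimensional over Z. If
    S z tends to S x, a small correction u with S (x + u) = S z puts x + u in [K]; so x lies in [K],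
    and S x in the image of Z. *)
Lemma closed_image S M Z n : lin S -> bnd S -> closed_subspace M -> closed (rangeM S M) ->
  closed_subspace Z -> Z `<=` M ->
  ~ cge [set x | M x /\ exists2 z, Z z & S x = S z] Z n -> closed (rangeM S Z).
Proof.
move=> lS bS cM cR cZ ZM; set K := [set x | _] => /cd_exists[k _ hk].
have sM := closed_subsp cM; have sZ := closed_subsp cZ.
have sK : subsp K.
  split; first by split; [exact: subsp0|exists 0 => //; exact: subsp0].
  - move=> x y [Mx [z Zz E]] [My [z' Zz' E']]; split; first exact: subspD.
    by exists (z + z'); [exact: subspD|rewrite !(linD lS) E E'].
  - move=> a x [Mx [z Zz E]]; split; first exact: subspZ.
    by exists (a *: z); [exact: subspZ|rewrite !(linZ lS) E].
have [e [Ke _ se]] := cd_basis sZ hk.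
have KE : K = addspan Z e.
  apply/seteqP; split => // x [c h]; apply: (subspBl sK) (subsp_comb sK c Ke).
  by split; [exact: ZM|exists (x - \sum_i c i *: e i)].
have /closed_nr clK : closed K by rewrite KE; case: (closed_addspan e cZ).
have [c c0 hc] := closed_range_bound lS bS cM cR.
apply/closed_nr => y hy.
have [x Mx xE] : rangeM S M y.
  move/closed_nr: cR; apply => d /hy[_ [[z Zz <-] zy]].
  by exists (S z); split => //; exists z => //; exact: ZM.
suff [_ [z Zz E]] : K x by exists z => //; rewrite -E.
apply: clK => d d0; have /hy[_ [[z Zz <-] zy]] : 0 < d / c by rewrite divr_gt0.
have [u [Mu uE] nu] := hc (z - x) (subspB sM (ZM _ Zz) Mx).
exists (x + u); split; last first.
  rewrite addrAC subrr add0r; apply: le_lt_trans nu _.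
  by rewrite (linB lS) xE -ltr_pdivlMl // mulrC.
split; first exact: subspD.
by exists z => //; rewrite (linD lS) uE (linB lS) addrC subrK.
Qed.

(** A direct decomposition relative to a closed subspace, since summands are decomposed again. *)
Definition ddec M M1 N : Prop :=
  [/\ closed_subspace M, closed_subspace M1, closed_subspace N & issum M M1 N].

(** The open mapping theorem for (y, z) -> y + z; uniqueness of the components identifies the
    bounded solution with y and z. *)
Lemma ddec_bound M M1 N : ddec M M1 N -> exists2 c : R, 0 < c &
  forall y z, M1 y -> N z -> nr y <= c * nr (y + z) /\ nr z <= c * nr (y + z).
Proof.
move=> [cM cM1 cN [hM h0]].
have [|||c c0 hc] := @open_mapping id M1 N _ _ cM1 cN; first by [].
  by exists 1 => // x; rewrite mul1r.
  rewrite (_ : [set y | _] = M); first by case: cM.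
  by apply/seteqP; split => x /hM.
exists c => // y z My Nz.
have [y' [z' [My' Nz' E hy hz]]] := hc _ y z My Nz erefl.
have E' : y - y' = z' - z.
  exact: addr_cross.
have yy : y - y' = 0.
  apply: h0; first by apply: subspB => //; exact: closed_subsp.
  by rewrite E'; apply: subspB => //; exact: closed_subsp.
move: (yy); rewrite E' => /eqP; rewrite subr_eq0 => /eqP zz.
by move: yy hy hz => /eqP; rewrite subr_eq0 => /eqP <-; rewrite zz.
Qed.

Lemma ddec_sym M M1 N : ddec M M1 N -> ddec M N M1.
Proof.
move=> [cM cM1 cN [hM h0]]; split => //; split; last by move=> x Nx Mx; exact: h0.
move=> x; rewrite hM; split => -[y [z [hy hz ->]]]; exists z, y; split => //;
  exact: addrC.
Qed.

Lemma ddec_subl M M1 N : ddec M M1 N -> M1 `<=` M.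
Proof.
move=> [_ _ cN [hM _]] x Mx; apply/hM; exists x, 0.
by split; rewrite ?addr0 //; exact: subsp0 (closed_subsp cN).
Qed.

Lemma ddec_subr M M1 N : ddec M M1 N -> N `<=` M.
Proof. by move=> /ddec_sym; exact: ddec_subl. Qed.

Lemma ddec_closed_sum M M1 N A B : ddec M M1 N -> A `<=` M1 -> B `<=` N ->
  closed A -> closed B -> closed [set x | exists y z, [/\ A y, B z & x = y + z]].
Proof.
move=> dM AM BN /closed_nr cA /closed_nr cB; have [c c0 hc] := ddec_bound dM.
have [cM cM1 cN [hM h0]] := dM.
have sM1 := closed_subsp cM1; have sN := closed_subsp cN.
apply/closed_nr => x hx.
have /hM[y [z [My Nz xE]]] : M x.
  case: (cM) => _ _ _ /closed_nr; apply => e /hx[_ [[y [z [Ay Bz ->]]] h]].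
  by exists (y + z); split => //; apply/hM; exists y, z; split; [exact: AM|exact: BN|].
have appr e : 0 < e -> exists y' z', [/\ A y', B z', nr (y' - y) < e & nr (z' - z) < e].
  move=> e0; have /hx[_ [[y' [z' [Ay Bz ->]]] h]] : 0 < e / c by rewrite divr_gt0.
  have [h1 h2] := hc _ _ (subspB sM1 (AM _ Ay) My) (subspB sN (BN _ Bz) Nz).
  have h3 : nr (y' - y + (z' - z)) < e / c by rewrite addrACA -opprD -xE.
  have h4 : c * nr (y' - y + (z' - z)) < e by rewrite -ltr_pdivlMl // mulrC.
  by exists y', z'; split => //; [exact: le_lt_trans h1 h4|exact: le_lt_trans h2 h4].
exists y, z; split => //.
  by apply: cA => e /appr[y' [z' [? ? ? ?]]]; exists y'.
by apply: cB => e /appr[y' [z' [? ? ? ?]]]; exists z'.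
Qed.
End OpenMapping.

(** * Kato's decomposition of semi-Fredholm operators *)

Section KatoDecomposition.
Context {R : realType} {X : completeNormedModType R[i]}.
Local Notation C := R[i].
Implicit Types (S : X -> X) (M N A B : set X).

Definition addset A B : set X := [set x | exists y z, [/\ A y, B z & x = y + z]].

Lemma subsp_addset A B : subsp A -> subsp B -> subsp (addset A B).
Proof.
move=> sA sB; split; first by exists 0, 0; split; rewrite ?addr0 //; exact: subsp0.
- move=> x x' [y [z [h1 h2 ->]]] [y' [z' [h1' h2' ->]]].
  by exists (y + y'), (z + z'); split; rewrite 1?addrACA //; exact: subspD.
- move=> a x [y [z [h1 h2 ->]]].
  by exists (a *: y), (a *: z); split; rewrite ?scalerDr //; exact: subspZ.
Qed.

Lemma addset_closed M M1 N A B : ddec M M1 N -> A `<=` M1 -> B `<=` N ->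
  closed_subspace A -> closed_subspace B -> closed_subspace (addset A B).
Proof.
move=> dM AM BN cA cB.
case: (subsp_addset (closed_subsp cA) (closed_subsp cB)) => h1 h2 h3; split => //.
by apply: (ddec_closed_sum dM) => //; [case: cA|case: cB].
Qed.

Lemma invariant_iter S M n : invariant S M -> invariant (iter n S) M.
Proof. by move=> iM; elim: n => // n IH x /IH /iM. Qed.

Lemma ddec_trans M M1 N A B : ddec M M1 N -> ddec M1 A B -> ddec M A (addset B N).
Proof.
move=> dM dM1; have [cM cM1 cN [hM h0]] := dM; have [_ cA cB [hM1 h1]] := dM1.
have sB := closed_subsp cB; have sM1 := closed_subsp cM1.
split => //; first exact: (addset_closed dM (ddec_subr dM1)).
split=> [x|x Ax [b [n [Bb Nn E]]]].
  split=> [/hM[y [n [/hM1[a [b [Aa Bb ->]]] Nn ->]]]|[a [_ [Aa [b [n [Bb Nn ->]]] ->]]]].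
    by exists a, (b + n); split; rewrite ?addrA //; exists b, n.
  apply/hM; exists (a + b), n; split; rewrite ?addrA //.
  by apply/hM1; exists a, b.
have n0 : n = 0.
  apply: h0 => //; have -> : n = x - b by rewrite E addrAC subrr add0r.
  by apply: subspB => //; [exact: (ddec_subl dM1)|exact: (ddec_subr dM1)].
by apply: h1 => //; rewrite E n0 addr0.
Qed.

Section Parts.
Variables (S : X -> X) (M M1 N : set X).
Hypotheses (lS : lin S) (dM : ddec M M1 N) (iM1 : invariant S M1) (iN : invariant S N).

Let sM1 : subsp M1. Proof. by case: dM => _ /closed_subsp. Qed.
Let sN : subsp N. Proof. by case: dM => _ _ /closed_subsp. Qed.
Let hM : issum M M1 N. Proof. by case: dM. Qed.

Lemma ddec_invariant : invariant S M.
Proof.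
move=> x /(proj1 hM)[y [z [My Nz ->]]]; apply/(proj1 hM).
by exists (S y), (S z); split; [exact: iM1|exact: iN|exact: linD].
Qed.

Lemma issum_ker : issum (kerM S M) (kerM S M1) (kerM S N).
Proof.
split=> [x|x [Mx _] [Nx _]]; last exact: (proj2 hM).
split=> [[/(proj1 hM)[y [z [My Nz ->]]]]|[y [z [[My Sy] [Nz Sz] ->]]]].
  rewrite (linD lS) => /eqP; rewrite addr_eq0 => /eqP E.
  have Sy0 : S y = 0.
    apply: (proj2 hM); first exact: iM1.
    by rewrite E; apply: subspN => //; exact: iN.
  exists y, z; split => //; split => //.
  by apply/eqP; rewrite -oppr_eq0 -E Sy0.
split; last by rewrite (linD lS) Sy Sz addr0.
by apply/(proj1 hM); exists y, z.
Qed.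

Lemma ddec_range x : rangeM S M x <->
  exists y z, [/\ rangeM S M1 y, rangeM S N z & x = y + z].
Proof.
split=> [[_ /(proj1 hM)[y [z [My Nz ->]]] <-]|[_ [_ [[y My <-] [z Nz <-] ->]]]].
  by exists (S y), (S z); split; [exists y|exists z|exact: linD].
exists (y + z); last exact: linD.
by apply/(proj1 hM); exists y, z.
Qed.

Lemma range_sub1 : rangeM S M1 `<=` M1.
Proof. by move=> _ [x Mx <-]; exact: iM1. Qed.

Lemma range_subN : rangeM S N `<=` N.
Proof. by move=> _ [x Mx <-]; exact: iN. Qed.

Lemma ddec_range_l : rangeM S M1 = rangeM S M `&` M1.
Proof.
apply/seteqP; split => [_ [x Mx <-]|x [/ddec_range[y [z [hy hz ->]]] Mx]].
  by split; [exists x => //; exact: (ddec_subl dM)|exact: iM1].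
have -> : z = 0; last by rewrite addr0.
apply: (proj2 hM); last exact: range_subN.
have -> : z = y + z - y by abelian_group.
by apply: subspB => //; exact: range_sub1.
Qed.

Lemma ddec_closed_range_l : closed (rangeM S M) -> closed (rangeM S M1).
Proof. by move=> h; rewrite ddec_range_l; apply: closedI => //; case: dM => _ []. Qed.

Lemma ddec_closed_range : closed (rangeM S M1) -> closed (rangeM S N) -> closed (rangeM S M).
Proof.
move=> h1 h2; rewrite (_ : rangeM S M = addset (rangeM S M1) (rangeM S N)).
  by apply: (ddec_closed_sum dM) => //; [exact: range_sub1|exact: range_subN].
by apply/seteqP; split => x /ddec_range.
Qed.

Lemma ddec_cd_ker m n : cd (kerM S M1) [set 0] m -> cd (kerM S N) [set 0] n ->
  cd (kerM S M) [set 0] (m + n).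
Proof.
apply: cd_sum; last first.
- by move=> x; split => [-> |[y [z [-> -> ->]]]]; rewrite /= ?addr0 //; exists 0, 0; rewrite addr0.
- exact: issum_ker.
- by move=> _ ->; apply: subsp0; exact: subsp_ker.
- by move=> _ ->; apply: subsp0; exact: subsp_ker.
- exact: subsp_zero.
- exact: subsp_zero.
- exact: subsp_ker.
- exact: subsp_ker.
Qed.

Lemma ddec_cd_ker_l k n : cd (kerM S M) [set 0] k -> cd (kerM S N) [set 0] n ->
  exists2 m, cd (kerM S M1) [set 0] m & k = (m + n)%N.
Proof.
apply: cd_sum_l; last first.
- by move=> x; split => [-> |[y [z [-> -> ->]]]]; rewrite /= ?addr0 //; exists 0, 0; rewrite addr0.
- exact: issum_ker.
- by move=> _ ->; apply: subsp0; exact: subsp_ker.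
- by move=> _ ->; apply: subsp0; exact: subsp_ker.
- exact: subsp_zero.
- exact: subsp_zero.
- exact: subsp_ker.
- exact: subsp_ker.
Qed.

Lemma ddec_cd_range m n : cd M1 (rangeM S M1) m -> cd N (rangeM S N) n ->
  cd M (rangeM S M) (m + n).
Proof.
apply: cd_sum => //; [exact: subsp_range|exact: subsp_range|exact: range_sub1|
  exact: range_subN|exact: ddec_range].
Qed.

Lemma ddec_cd_range_l k n : cd M (rangeM S M) k -> cd N (rangeM S N) n ->
  exists2 m, cd M1 (rangeM S M1) m & k = (m + n)%N.
Proof.
apply: cd_sum_l => //; [exact: subsp_range|exact: subsp_range|exact: range_sub1|
  exact: range_subN|exact: ddec_range].
Qed.
End Parts.

Lemma cd_fin_sub A B n : A `<=` B -> ~ cge B [set 0] n -> exists m, cd A [set 0] m.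
Proof.
by move=> AB nB; have [|m _ h] := @cd_exists _ _ A [set 0] n; [move/(cge_sub AB)|exists m].
Qed.

Lemma finite_dim_closed M n : subsp M -> ~ cge M [set 0] n -> closed M.
Proof.
move=> sM /cd_exists[k _ /(cd_basis subsp_zero)[e [Me _ se]]].
rewrite (_ : M = addspan [set 0] e); first by case: (closed_addspan e closed_subspace0).
apply/seteqP; split => // x [c /= /eqP]; rewrite subr_eq0 => /eqP ->.
exact: subsp_comb.
Qed.

Lemma range_iterS S M n : rangeM (iter n.+1 S) M = rangeM S (rangeM (iter n S) M).
Proof.
apply/seteqP; split => [_ [x Mx <-]|_ [_ [x Mx <-] <-]]; last by exists x.
by exists (iter n S x) => //; exists x.
Qed.

(** The number k, the nullity or the defect, is the induction measure of [kato_decomposition]. *)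
Definition semi_Fredholm S M : Prop := closed (rangeM S M) /\
  exists k, cd (kerM S M) [set 0] k \/ cd M (rangeM S M) k.

(** S^n induces a map from M modulo S(M) onto the quotient of two consecutive ranges, and lifts of
    independent vectors stay independent. *)
Lemma cge_pow S M n m : lin S -> cge (rangeM (iter n S) M) (rangeM (iter n.+1 S) M) m ->
  cge M (rangeM S M) m.
Proof.
move=> lS; have lSn := lin_iter n lS.
apply: (@cge_transfer _ _ _ _ _ _ (fun x x' => x = iter n S x')).
- by rewrite (lin0 lSn).
- by move=> a x x' y y' -> ->; rewrite lSn.
- by move=> _ [x Bx <-]; exists x.
- by move=> x x' -> [z Mz <-]; exists z => //; rewrite iterSr.
Qed.

Lemma range_iter_le S M n : invariant S M -> rangeM (iter n.+1 S) M `<=` rangeM (iter n S) M.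
Proof. by move=> iM _ [x Mx <-]; exists (S x); [exact: iM|rewrite iterSr]. Qed.

Lemma range_iter_sub S M n : invariant S M -> rangeM (iter n S) M `<=` M.
Proof. by move=> iM _ [x Mx <-]; exact: invariant_iter. Qed.

Lemma cd_pow S M k n : lin S -> subsp M -> invariant S M ->
  cd M (rangeM S M) k -> exists m, cd M (rangeM (iter n S) M) m.
Proof.
move=> lS sM iM hk; elim: n => [|n [m hm]].
  by exists 0%N; apply: cd_zero => x Mx; exists x.
have [|a _ ha] := @cd_exists _ _ (rangeM (iter n S) M) (rangeM (iter n.+1 S) M) k.+1.
  by move/(cge_pow lS); case: hk.
exists (m + a)%N; apply: (cd_tower _ _ _ _ hm ha).
- by apply: subsp_range sM; exact: lin_iter.
- by apply: subsp_range sM; exact: lin_iter.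
- exact: range_iter_le.
- exact: range_iter_sub.
Qed.

(** Induction by [closed_image], with Z the range of S^n. Modulo Z, the vectors of M that S sends
    into S(Z) are counted by the nullity in one case and by the codimension of Z in the other. *)
Lemma semi_Fredholm_closed_iter S M n : lin S -> bnd S -> closed_subspace M ->
  invariant S M -> semi_Fredholm S M -> closed (rangeM (iter n S) M).
Proof.
move=> lS bS cM iM [cR [k hk]]; have sM := closed_subsp cM.
elim: n => [|n IH].
  rewrite (_ : rangeM _ M = M); first by case: cM.
  by apply/seteqP; split => [_ [x Mx <-]|x Mx] //; exists x.
rewrite range_iterS; set Z := rangeM _ M in IH *.
have sZ : subsp Z by apply: subsp_range => //; exact: lin_iter.
have cZ : closed_subspace Z by case: sZ => ? ? ?; split.
have ZM : Z `<=` M by exact: range_iter_sub.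
suff [m hm] : exists m, ~ cge [set x | M x /\ exists2 z, Z z & S x = S z] Z m.
  exact: (closed_image lS bS cM cR cZ ZM hm).
case: hk => [[_ hk]|hk].
  exists k.+1; apply: contra_not hk.
  apply: (@cge_transfer _ _ _ _ _ _ (fun x x' => Z (x - x'))).
  - by rewrite subr0; exact: subsp0.
  - move=> a x x' y y' h h'; have -> : a *: x + y - (a *: x' + y') = a *: (x - x') + (y - y').
      by rewrite scalerBr; abelian_group.
    by apply: subspD => //; exact: subspZ.
  - move=> x [Mx [z Zz E]]; exists (x - z).
      split; first by apply: subspB => //; exact: ZM.
      by rewrite (linB lS) E subrr.
    by have -> : x - (x - z) = z by abelian_group.
  - by move=> x x' h /= x0; move: h; rewrite x0 subr0.
have [m [_ hm]] := cd_pow n lS sM iM hk; exists m.+1; apply: contra_not hm.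
by apply: cge_sub => x [].
Qed.

Lemma bnd_comp (V1 V2 V3 : normedModType C) (f : V2 -> V3) (g : V1 -> V2) :
  bnd f -> bnd g -> bnd (f \o g).
Proof.
move=> [a a0 ha] [b b0 hb]; exists (a * b); first by rewrite mulr_gt0.
by move=> x; apply: le_trans (ha _) _; rewrite -mulrA ler_pM2l.
Qed.

(* Splits off the Jordan chain y, S y, ..., S^n y = x.  A functional f with f x = 1 that
   vanishes on the range of S^(n+1) makes the matrix f (S^(i+j) y) unitriangular up to the
   order of its rows, so the common kernel of the f \o S^i complements the chain. *)
Lemma split_chain S M x p : lin S -> bnd S -> closed_subspace M -> invariant S M ->
  (forall n, closed (rangeM (iter n S) M)) -> kerM S M x -> ~ rangeM (iter p S) M x ->
  exists M1 N, [/\ ddec M M1 N, invariant S M1, invariant S N, nilpotentM S N &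
    [/\ exists n, ~ cge N [set 0] n, exists2 z, kerM S N z & z <> 0 &
        exists2 z, N z & ~ rangeM S N z]].
Proof.
move=> lS bS cM iM cR [Mx Sx] hp; have sM := closed_subsp cM.
(* n is the last exponent for which x lies in the range of S^n; it exists since x is in the range of
   S^0 but not of S^p. *)
have [n [[y My yE] hn]] : exists n, rangeM (iter n S) M x /\ ~ rangeM (iter n.+1 S) M x.
  apply: contrapT => h; apply: hp; elim: p => [|p IH]; first by exists x.
  by apply: contrapT => h'; apply: h; exists p.
have lSn k := lin_iter k lS.
have iMn k : invariant (iter k S) M by exact: invariant_iter.
have cRn : closed_subspace (rangeM (iter n.+1 S) M).
  by apply: closed_subsp_range.
have [f [lf bf fR fx]] := hahn_banach cRn hn.
have fy k : f (iter k S y) = (k == n)%:R \/ (k < n)%N.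
  have [->|kn] := eqVneq k n; first by left; rewrite yE.
  have [lt|ge] := ltnP k n; first by right.
  left; apply: fR; have nk : (n < k)%N by rewrite ltn_neqAle eq_sym kn.
  exists (iter (k - n.+1) S y); first exact: iMn.
  by rewrite -iterD subnKC.
have fyn : f (iter n S y) = 1 by rewrite yE.
have fyk k : (n < k)%N -> f (iter k S y) = 0.
  move=> nk; case: (fy k) => [->|]; last by rewrite ltnNge ltnW.
  by rewrite gtn_eqF.
pose e (i : 'I_n.+1) := iter i S y.
pose N := addspan [set 0] e.
pose M1 := [set x | M x /\ forall i, (i <= n)%N -> f (iter i S x) = 0].
have cN : closed_subspace N := closed_addspan e closed_subspace0.
have sN := closed_subsp cN.
have Ne k : (k <= n)%N -> N (iter k S y).
  by move=> kn; have := addspan_gen e (Ordinal (kn : (k < n.+1)%N)) (@subsp_zero R X).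
have NE v : N v -> exists c : 'I_n.+1 -> C, v = \sum_i c i *: e i.
  by move=> [c /= /eqP]; rewrite subr_eq0 => /eqP ->; exists c.
have cM1 : closed_subspace M1.
  split; first by split => [|i _]; [exact: subsp0|rewrite (lin0 (lSn i)) (lin0 lf)].
  - move=> u v [Mu hu] [Mv hv]; split => [|i ni]; first exact: subspD.
    by rewrite (linD (lSn i)) (linD lf) hu // hv // addr0.
  - move=> a u [Mu hu]; split => [|i ni]; first exact: subspZ.
    by rewrite (linZ (lSn i)) (linZ lf) hu // scaler0.
  - apply/closed_nr => u hu; split.
      case: cM => _ _ _ /closed_nr; apply => d /hu[v [[Mv _] vu]].
      by exists v.
    move=> i ni; have [b b0 hb] := bnd_comp bf (bnd_iter i bS).
    apply: nr_small0 => d d0; have /hu[v [[_ hv] vu]] : 0 < d / b by rewrite divr_gt0.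
    have -> : f (iter i S u) = - f (iter i S (v - u)).
      by rewrite (linB (lSn i)) (linB lf) hv // sub0r opprK.
    rewrite nrN; apply: le_trans (hb _) _; rewrite -ler_pdivlMl // mulrC.
    exact: ltW.
have NM : N `<=` M.
  by move=> v /NE[c ->]; apply: subsp_comb => // i; exact: iMn.
(* The values f (S^i v) are cleared from i = n downwards. Subtracting a multiple of S^k y adjusts
   the value at i = n - k and none at larger i, since f vanishes on S^j y for j > n. *)
have dec k v : M v -> (k <= n.+1)%N -> exists2 z, N z &
    forall i, (i <= n)%N -> (n < i + k)%N -> f (iter i S (v - z)) = 0.
  move=> Mv; elim: k => [|k IH] kn.
    by exists 0; [exact: subsp0|move=> i ni; rewrite addn0 ltnNge ni].
  have [z Nz hz] := IH (ltnW kn).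
  exists (z + f (iter (n - k) S (v - z)) *: iter k S y).
    by apply: subspD => //; apply: subspZ => //; exact: Ne.
  move=> i ni nik; rewrite opprD addrA (linB (lSn i)) (linB lf).
  rewrite (linZ (lSn i)) (linZ lf) -iterD.
  have [E|ink] := eqVneq (i + k)%N n.
    have -> : i = (n - k)%N by rewrite -E addnK.
    by rewrite subnK // fyn /GRing.scale /= mulr1 subrr.
  have nik' : (n < i + k)%N by rewrite ltn_neqAle eq_sym ink /= -ltnS -addnS.
  by rewrite (hz _ ni nik') (fyk _ nik') scaler0 subr0.
(* Testing with f after S^(n - j) isolates [c j]: earlier coefficients vanish by induction, and
   later ones meet f at powers beyond n. *)
have M1N v : M1 v -> N v -> v = 0.
  move=> [_ hv] /NE[c vE]; rewrite vE big1 // => j _.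
  suff -> : c j = 0 by rewrite scale0r.
  case: j => j jn; elim/ltn_ind: j jn => j IH jn.
  have := hv (n - j)%N (leq_subr _ _); rewrite vE (lin_comb (lSn _)) (lin_comb lf).
  rewrite (bigD1 (Ordinal jn)) //= -iterD subnK // fyn big1 ?addr0.
    by rewrite /GRing.scale /= mulr1.
  move=> [l ln]; rewrite -val_eqE /= => lj; rewrite -iterD.
  have [lt|ge] := ltnP l j; first by rewrite IH // scale0r.
  rewrite fyk ?scaler0 //; have : (j < l)%N by rewrite ltn_neqAle eq_sym lj.
  by move: jn; rewrite /= !ltnS; lia.
have SN1 : iter n.+1 S y = 0 by rewrite /= yE.
have SN k : (n < k)%N -> iter k S y = 0.
  by move=> nk; rewrite -(subnK nk) iterD SN1 (lin0 (lSn _)).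
have nilN v : N v -> iter n.+1 S v = 0.
  move=> /NE[c ->]; rewrite (lin_comb (lSn _)) big1 // => i _.
  by rewrite -iterD SN ?scaler0 // leq_addr.
exists M1, N; split.
- split => //; split => // v; split => [Mv|[u [z [[Mu _] Nz ->]]]]; last first.
    by apply: subspD => //; exact: NM.
  have [z Nz hz] := dec _ _ Mv (leqnn _).
  exists (v - z), z; split; rewrite ?subrK //; split => [|i ni].
    by apply: subspB => //; exact: NM.
  by apply: hz => //; rewrite addnS ltnS leq_addl.
- move=> v [Mv hv]; split => [|i ni]; first exact: iM.
  (* Only i = n is new: S^(n + 1) v lies in the range on which f vanishes. *)
  rewrite -iterSr; move: ni; rewrite leq_eqVlt => /predU1P[->|]; last exact: hv.
  by apply: fR; exists v.
- move=> v /NE[c ->]; rewrite (lin_comb lS); apply: subsp_comb => // i.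
  have := ltn_ord i; rewrite ltnS leq_eqVlt => /predU1P[E|]; last exact: (@Ne i.+1).
  by rewrite /e E -iterS SN1; exact: subsp0.
- by exists n.+1.
- split.
  + have h : cspan N [set 0] n.+1 by exists e; split => // i; apply: Ne; rewrite -ltnS.
    by exists n.+2 => h'; have := steinitz (@subsp_zero R X) h' h; rewrite ltnn.
  + exists x; first by split => //; rewrite -yE; exact: Ne.
    by move=> x0; move: fx; rewrite x0 (lin0 lf) => /esym/eqP; rewrite oner_eq0.
  + exists y; first exact: (Ne 0).
    move=> [v Nv vE]; move: fx; rewrite -yE -vE -iterSr nilN // (lin0 lf) => /esym/eqP.
    by rewrite oner_eq0.
Qed.

Lemma ddec_trivial M : closed_subspace M -> ddec M M [set 0].
Proof.
move=> cM; split => //; first exact: closed_subspace0.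
split => [x|x _ //]; split => [Mx|[y [_ [My -> ->]]]]; last by rewrite addr0.
by exists x, 0; rewrite addr0.
Qed.

Lemma zero_fd : ~ cge [set 0 : X] [set 0] 1.
Proof. by case: (@cd_zero R X [set 0] [set 0]). Qed.

(** Unless S is already Kato on M, [split_chain] removes a nilpotent summand whose nullity and
    defect are both positive, so the number k drops, whichever of the two it is. *)
Theorem kato_decomposition S M : lin S -> bnd S -> closed_subspace M -> invariant S M ->
  semi_Fredholm S M ->
  exists M1 N, [/\ ddec M M1 N, invariant S M1, invariant S N, KatoM S M1 &
    nilpotentM S N /\ exists n, ~ cge N [set 0] n].
Proof.
move=> lS bS cM iM [cR [k hk]].
elim/ltn_ind: k M cM iM cR hk => k IH M cM iM cR hk.
have sM := closed_subsp cM.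
have cRn n : closed (rangeM (iter n S) M).
  by apply: semi_Fredholm_closed_iter => //; split => //; exists k.
have [KM|KM] := pselect (KatoM S M).
  exists M, [set 0]; split => //; first exact: ddec_trivial.
    by move=> _ ->; exact: lin0.
  by split; [exists 0%N|exists 1%N; exact: zero_fd].
have [p [x [kx hx]]] : exists p x, kerM S M x /\ ~ rangeM (iter p S) M x.
  apply: contrapT => h; apply: KM; split => // n x kx; apply: contrapT => hx.
  by apply: h; exists n, x.
have [M1 [N [dM iM1 iN nilN [[m fN] [z kz z0] [w Nw hw]]]]] :=
  split_chain lS bS cM iM cRn kx hx.
have sN : subsp N by case: dM => _ _ /closed_subsp.
have [d1 hd1] : exists d, cd (kerM S N) [set 0] d by apply: cd_fin_sub fN => v [].
have [d2 hd2] : exists d, cd N (rangeM S N) d.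
  have [|d _ h] := @cd_exists _ _ N (rangeM S N) m; last by exists d.
  apply: contra_not fN; apply: cge_transfer_eq => // v _ -> .
  by apply: subsp0; exact: subsp_range.
have d1_gt0 : (0 < d1)%N.
  rewrite lt0n; apply/eqP => d0; move: hd1; rewrite d0 => /(cd0P _ subsp_zero) h.
  exact: z0 (h _ kz).
have d2_gt0 : (0 < d2)%N.
  rewrite lt0n; apply/eqP => d0; move: hd2; rewrite d0 => /(cd0P _ (subsp_range lS sN)) h.
  exact: hw (h _ Nw).
have cR1 := ddec_closed_range_l lS dM iM1 iN cR.
have [k1 lt1 hk1] : exists2 k1, (k1 < k)%N &
    cd (kerM S M1) [set 0] k1 \/ cd M1 (rangeM S M1) k1.
  case: hk => hk.
    have [k1 h ->] := ddec_cd_ker_l lS dM iM1 iN hk hd1.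
    by exists k1; [rewrite -addn1 leq_add2l|left].
  have [k1 h ->] := ddec_cd_range_l lS dM iM1 iN hk hd2.
  by exists k1; [rewrite -addn1 leq_add2l|right].
have cM1 : closed_subspace M1 by case: dM.
have [A [B [dM1 iA iB KA [[n nilB] [b fB]]]]] := IH k1 lt1 M1 cM1 iM1 cR1 hk1.
have sB : subsp B by case: dM1 => _ _ /closed_subsp.
exists A, (addset B N); split => //.
- exact: ddec_trans dM dM1.
- by move=> _ [u [v [Bu Nv ->]]]; exists (S u), (S v); split;
    [exact: iB|exact: iN|exact: linD].
- have [q nilN'] := nilN; split.
    exists (n + q)%N => _ [u [v [Bu Nv ->]]]; rewrite (linD (lin_iter _ lS)).
    have -> : iter (n + q) S u = 0 by rewrite addnC iterD nilB // (lin0 (lin_iter _ lS)).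
    by rewrite iterD nilN' // (lin0 (lin_iter _ lS)) addr0.
  have [b' _ hb'] := cd_exists fB; have [m' _ hm'] := cd_exists fN.
  exists (b' + m').+1; have [_] : cd (addset B N) [set 0] (b' + m'); last by [].
  apply: (@cd_sum _ _ _ B N _ [set 0] [set 0]) hb' hm' => //; try exact: subsp_zero.
  + by move=> _ ->; exact: subsp0.
  + by move=> _ ->; exact: subsp0.
  + split => // v Bv Nv; case: (dM) => _ _ _ [_]; apply => //; exact: (ddec_subr dM1).
  + move=> v; split => [-> |[y [y' [-> -> ->]]]]; rewrite /= ?addr0 //.
    by exists 0, 0; rewrite addr0.
Qed.
End KatoDecomposition.

(** * Small perturbations of Kato operators *)

Section KatoPerturbation.
Context {R : realType} {X : completeNormedModType R[i]}.
Local Notation C := R[i].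
Local Notation "r %:C" := (real_complex R r).
Implicit Types (S : X -> X) (M N A B : set X).

(** Connectedness of the unit interval, by the supremum of the t for which P holds on the whole of
    [0, t]. *)
Lemma segment_induction (P : R -> Prop) :
  (forall t : R, 0 <= t <= 1 -> exists2 d : R, 0 < d &
     forall s : R, 0 <= s <= 1 -> `|s - t| < d -> (P s <-> P t)) ->
  P 0 -> P 1.
Proof.
move=> hP P0; pose A := [set t : R | 0 <= t <= 1 /\ forall s : R, 0 <= s <= t -> P s].
have A0 : A 0.
  by split; [rewrite lexx ler01|move=> s /le_anti <-].
have hA : has_sup A by split; [exists 0|exists 1 => t [/andP[_ ?] _]].
have T0 : 0 <= sup A by exact: ub_le_sup hA.2 _ A0.
have T1 : sup A <= 1 by apply: ge_sup; [exists 0|move=> t [/andP[_ ?] _]].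
have [|d d0 hd] := hP (sup A); first by rewrite T0.
have [t At ht] := sup_adherent d0 hA.
have tT : t <= sup A by exact: ub_le_sup hA.2 _ At.
have [/andP[t0 t1] Pt] := At.
have PT : P (sup A).
  have [||h _] := hd t; rewrite ?t0 //; last by apply/h/Pt; rewrite t0 lexx.
  by rewrite ltr_norml; apply/andP; split; lra.
pose u := Num.min 1 (sup A + d / 2).
have Au : A u.
  split; first by rewrite /u le_min ler01 ge_min lexx; lra.
  move=> s /andP[s0]; rewrite /u le_min => /andP[s1 sT].
  have [st|st] := leP s t; first by apply: Pt; rewrite s0.
  have [||_ h] := hd s; rewrite ?s0 //; last exact: h.
  by rewrite ltr_norml; apply/andP; split; lra.
have := ub_le_sup hA.2 Au; rewrite /u; case: (leP 1 (sup A + d / 2)) => [h h1|h h1].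
  by have <- : sup A = 1 by apply/eqP; rewrite eq_le T1.
lra.
Qed.

(** With more than k vectors, the matrix of the values of the functionals has a nonzero left kernel,
    whose rows give combinations killed by all functionals and hence lying in B. *)
Lemma cge_functionals A B k n (f : 'I_k -> X -> C^o) : subsp A -> (forall i, lin (f i)) ->
  (forall y, A y -> (forall i, f i y = 0) -> B y) -> cge A B n -> (n <= k)%N.
Proof.
move=> sA lf hf [e [Ae ie]]; rewrite leqNgt; apply/negP => kn.
pose F := \matrix_(i < n, j < k) (f j (e i) : C).
have : (0 < \rank (kermx F))%N.
  by rewrite mxrank_ker subn_gt0 (leq_ltn_trans (rank_leq_col _)).
rewrite lt0n mxrank_eq0 => /eqP K0; apply: K0; apply/matrixP => p i; rewrite [RHS]mxE.
move: i; apply: ie; apply: hf => [|j]; first exact: subsp_comb.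
rewrite (lin_comb (lf j)) (_ : \sum_i _ = (kermx F *m F) p j).
  by rewrite mulmx_ker mxE.
by rewrite [RHS]mxE; apply: eq_bigr => i _; rewrite [F i j]mxE.
Qed.

(** Summing the inequalities bounds the sum of the moduli by m d < 1 times itself. This is how
    independence survives a small perturbation. *)
Lemma small_system m (a : 'I_m -> C) (d : R) : m%:R * d < 1 ->
  (forall j, nr (a j) <= d * \sum_(i < m) nr (a i)) -> forall j, a j = 0.
Proof.
move=> md ha; set s := \sum_(i < m) _ in ha.
have s0 : 0 <= s by apply: sumr_ge0 => i _; exact: nr_ge0.
have hs : s <= m%:R * d * s.
  apply: le_trans (ler_sum _ (fun j _ => ha j)) _.
  by rewrite sumr_const card_ord -mulrA mulr_natl.
have {}s0 : s = 0 by nra.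
by move=> j; apply: nr_eq0; apply/eqP; rewrite eq_le nr_ge0 andbT -(mulr0 d) -s0 ha.
Qed.

Lemma uniform_bound m (f : 'I_m -> X -> C^o) : (forall i, bnd (f i)) ->
  exists2 b : R, 0 < b & forall i x, nr (f i x) <= b * nr x.
Proof.
move=> bf; have /choice[b hb] : forall i, exists b : R, 0 < b /\ forall x, nr (f i x) <= b * nr x.
  by move=> i; have [b b0 h] := bf i; exists b.
exists (1 + \sum_i b i).
  by rewrite ltr_wpDr // sumr_ge0 // => i _; rewrite ltW //; case: (hb i).
move=> i x; apply: le_trans (proj2 (hb i) x) _; rewrite ler_wpM2r ?nr_ge0 //.
rewrite (bigD1 i) //= addrCA lerDl addr_ge0 // sumr_ge0 // => j _.
by rewrite ltW //; case: (hb j).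
Qed.

Lemma sum_bound m (e : 'I_m -> X) : exists2 E : R, 0 < E & forall i, nr (e i) <= E.
Proof.
exists (1 + \sum_i nr (e i)).
  by rewrite ltr_wpDr // sumr_ge0 // => i _; exact: nr_ge0.
move=> i; rewrite (bigD1 i) //= addrCA lerDl addr_ge0 // sumr_ge0 // => j _.
exact: nr_ge0.
Qed.

Lemma comb_bound m (a : 'I_m -> C) (e : 'I_m -> X) (E : R) : (forall i, nr (e i) <= E) ->
  nr (\sum_i a i *: e i) <= E * \sum_i nr (a i).
Proof.
move=> hE; apply: le_trans (nr_sum _) _; rewrite mulr_sumr; apply: ler_sum => i _.
by rewrite nrZ mulrC ler_wpM2r // nr_ge0.
Qed.

Lemma shiftE S l x : shift S l x = S x - l *: x.
Proof. by []. Qed.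

Lemma shift_invariant S l M : subsp M -> invariant S M -> invariant (shift S l) M.
Proof. by move=> sM iM x Mx; apply: subspB => //; [exact: iM|exact: subspZ]. Qed.

(** As the kernel lies in every range Z of a power, a vector of M that S sends into S(Z) is already
    in Z, and [closed_image] applies. *)
Lemma Kato_closed_iter S M n : lin S -> bnd S -> closed_subspace M -> invariant S M ->
  KatoM S M -> closed (rangeM (iter n S) M).
Proof.
move=> lS bS cM iM [cR hK]; have sM := closed_subsp cM.
elim: n => [|n IH].
  rewrite (_ : rangeM _ M = M); first by case: cM.
  by apply/seteqP; split => [_ [x Mx <-]|x Mx] //; exists x.
rewrite range_iterS; set Z := rangeM _ M in IH *.
have sZ : subsp Z by apply: subsp_range => //; exact: lin_iter.
have cZ : closed_subspace Z by case: sZ => ? ? ?; split.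
have ZM : Z `<=` M by exact: range_iter_sub.
apply: (closed_image (n := 1) lS bS cM cR cZ ZM).
have [] // := @cd_zero R X [set x | M x /\ exists2 z, Z z & S x = S z] Z.
move=> x [Mx [z Zz E]]; rewrite -(subrK z x); apply: subspD => //.
apply: hK; split; last by rewrite (linB lS) E subrr.
by apply: subspB => //; exact: ZM.
Qed.

Definition hyper_range S M : set X := [set x | forall n, rangeM (iter n S) M x].

Section Kato.
Variables (S : X -> X) (M : set X).
Hypotheses (lS : lin S) (bS : bnd S) (cM : closed_subspace M) (iM : invariant S M).
Hypothesis KM : KatoM S M.

Let sM : subsp M := closed_subsp cM.
Let Y := hyper_range S M.

Let YM : Y `<=` M. Proof. by move=> x /(_ 0)[y My <-]. Qed.

Let sY : subsp Y.
Proof.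
have h n : subsp (rangeM (iter n S) M) by apply: subsp_range => //; exact: lin_iter.
split; first by move=> n; exact: subsp0.
- by move=> x y hx hy n; apply: subspD.
- by move=> a x hx n; exact: subspZ.
Qed.

Let cY : closed_subspace Y.
Proof.
case: sY => ? ? ?; split => //; apply/closed_nr => x hx n.
have /closed_nr := @Kato_closed_iter S M n lS bS cM iM KM; apply => e /hx[y [Yy yx]].
by exists y.
Qed.

Let kerY x : M x -> S x = 0 -> Y x.
Proof. by move=> Mx Sx n; apply: (proj2 KM). Qed.

(** If S x = S^(n + 1) z, then x - S^n z is in the kernel, which the Kato condition places in the
    range of S^n. *)
Let preY x : M x -> Y (S x) -> Y x.
Proof.
move=> Mx YSx n; have [z Mz E] := YSx n.+1; rewrite -(subrK (iter n S z) x).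
apply: subspD; [|apply: (proj2 KM)|by exists z].
  by apply: subsp_range => //; exact: lin_iter.
split; first by apply: subspB => //; exact: invariant_iter.
by rewrite (linB lS) -E iterS subrr.
Qed.

Section Bound.
Variable c : R.
Hypotheses (c0 : 0 < c) (hc : solvable_bound S M c).

(* S maps its hyper-range onto itself, so S - l still does for small l. *)
Lemma hyper_range_solve (l : C) y : nr l * c <= 2^-1 -> Y y ->
  exists x, [/\ Y x, shift S l x = y & nr x <= 2 * c * nr y].
Proof.
move=> lc Yy.
have [|x [f [Yx /= -> -> hx _]]] := approx_solve (ltW c0) (lin_shift l lS) (bnd_shift l bS)
    cY closed_subspace0 _ Yy; last by exists x; rewrite addr0 in hx *.
move=> {Yy} {}y Yy; have [x' Mx' /= xE] := Yy 1%N.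
have [x [Mx E] nx] := hc Mx'.
have Yx : Y x by apply: (preY Mx); rewrite E xE.
(* Since S x = y, the residual is l x, of norm at most [nr l * c * nr y], thus at most half of
   [nr y]. *)
have D : y - (shift S l x + 0) = l *: x.
  by rewrite shiftE E xE; abelian_group.
exists x, 0; rewrite D nr0 nrZ; split => //; first exact: (subspZ sY).
  by split; [rewrite -xE|rewrite mulr_ge0 ?nr_ge0 ?ltW].
rewrite xE in nx.
have := nr_ge0 y; have := nr_ge0 l; nra.
Qed.

(** A solution x is improved as follows. Take a small u with S u = S x; then x - u is in the kernel,
    hence in the hyper-range, where (S - l) w = l (x - u) has a small solution, and u - w is a
    solution again. The bound 1/16 makes the new norm at most 9/8 c nr y + nr x / 4. *)
Lemma shift_solvable (l : C) : nr l * c <= 16^-1 -> solvable_bound (shift S l) M (2 * c).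
Proof.
move=> lc x0 Mx0; set y := shift S l x0.
have lc' : nr l * c <= 2^-1 by lra.
have [y0|/eqP/nr_gt0 y0] := eqVneq y 0.
  exists 0; last by rewrite nr0 mulr_ge0 ?nr_ge0 // mulr_ge0 // ltW.
  by split; [exact: subsp0|rewrite y0 (lin0 (lin_shift l lS))].
pose A := [set x | M x /\ shift S l x = y].
have improve x : A x -> exists2 x', A x' & nr x' <= 9 / 8 * c * nr y + nr x / 4.
  move=> [Mx xE]; have [u [Mu uE] nu] := hc Mx.
  have Yxu : Y (x - u).
    by apply: kerY; [exact: subspB|rewrite (linB lS) uE subrr].
  have [w [Yw wE nw]] := hyper_range_solve lc' (subspZ sY l Yxu).
  exists (u - w).
    split; first by apply: subspB => //; exact: YM.
    rewrite (linB (lin_shift l lS)) wE -xE !shiftE uE scalerBr; abelian_group.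
  have Sx : nr (S x) <= nr y + nr l * nr x.
    have -> : S x = y + l *: x by rewrite -xE shiftE subrK.
    by apply: le_trans (nrD _ _) _; rewrite nrZ.
  have := nrB u w; have := nrB x u; rewrite nrZ in nw.
  have := nr_ge0 l; have := nr_ge0 x; have := nr_ge0 y; have := nr_ge0 u.
  set t := nr l * c in lc lc' *; move=> hu hy hx hl h1 h2.
  have t0 : 0 <= t by rewrite mulr_ge0 // ltW.
  have nu' : nr u <= c * nr y + t * nr x.
    apply: le_trans nu _; apply: le_trans (ler_wpM2l (ltW c0) Sx) _.
    by rewrite mulrDr mulrA (mulrC c (nr l)).
  have nw' : nr w <= 2 * t * (nr x + nr u).
    apply: le_trans nw _; rewrite -mulrA mulrA (mulrCA 2) -!mulrA.
    rewrite /t; have := ler_wpM2l (mulr_ge0 (ltW c0) hl) h1; lra.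
  have : t * nr x <= 16^-1 * nr x by rewrite ler_wpM2r.
  have : t * nr u <= 16^-1 * nr u by rewrite ler_wpM2r.
  have : 0 <= c * nr y by rewrite mulr_ge0 // ltW.
  lra.
have nn x : A x -> 0 <= nr x by move=> _; exact: nr_ge0.
have Ax0 : A x0 by [].
have A0 : A !=set0 by exists x0.
(* By [improve] the infimum of the norms is at most 3/2 c nr y, strictly below 2 c nr y, so it need
   not be attained. *)
have d1 : 4 * (inf (nr @` A) - 9 / 8 * c * nr y) <= inf (nr @` A).
  apply: le_inf_image => // x /improve[x' Ax' h].
  by have := inf_image_le nn Ax'; lra.
apply: contrapT => h; have : 2 * c * nr y <= inf (nr @` A).
  apply: le_inf_image => // x [Mx xE]; rewrite leNgt; apply/negP => hx; apply: h.
  by exists x; rewrite ?xE // ltW.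
have : 0 < c * nr y by rewrite mulr_gt0.
lra.
Qed.

(** The kernel of S - l lies in the hyper-range of S: for l nonzero, S x = l x gives x = S^k (l^-k
    x). As S - l maps the hyper-range onto itself, x is in the range of every power of S - l. *)
Lemma shift_Kato (l : C) : nr l * c <= 16^-1 -> KatoM (shift S l) M.
Proof.
move=> lc; split.
  apply: (bound_closed_range (lin_shift l lS) (bnd_shift l bS) cM _ (shift_solvable lc)).
  by rewrite mulr_ge0 // ltW.
move=> n x [Mx xE].
have Yx : Y x.
  have [l0|l0] := eqVneq l 0.
    by apply: kerY => //; move: xE; rewrite l0 shift_zero.
  have Sx : S x = l *: x by apply/eqP; rewrite -subr_eq0 -shiftE xE.
  move=> k; have -> : x = iter k S (l ^- k *: x).
    rewrite (linZ (lin_iter k lS)); elim: k => [|k IH].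
      by rewrite expr0 invr1 scale1r.
    rewrite iterSr Sx (linZ (lin_iter k lS)) scalerA exprSr invfM mulrAC -mulrA.
    by rewrite mulfV // mulr1.
  by exists (l ^- k *: x) => //; exact: subspZ.
suff onto : forall z, Y z -> exists2 y, Y y & iter n (shift S l) y = z.
  by have [z Yz <-] := onto x Yx; exists z => //; exact: YM.
elim: n => [|n IH] z Yz; first by exists z.
have [y Yy yE] := IH z Yz.
have lc' : nr l * c <= 2^-1 by lra.
by have [u [Yu uE _]] := hyper_range_solve lc' Yy; exists u; rewrite // iterSr uE.
Qed.

Lemma invr_small (K t : R) : 0 < K -> t < K^-1 -> t * K < 1.
Proof. by move=> K0 h; rewrite -ltr_pdivlMr // div1r. Qed.

(** Each kernel vector [e i] is continued to [e i + w i], where [w i] in the hyper-range solves (S -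
    l) w = l e i and has norm of order nr l; [small_system] keeps the family independent. *)
Lemma ker_lower m : cge (kerM S M) [set 0] m -> exists2 d : R, 0 < d &
  forall l : C, nr l < d -> cge (kerM (shift S l) M) [set 0] m.
Proof.
move=> [e [ke ie]]; have [f hf] := biorthogonal closed_subspace0 ie.
have [b b0 hb] : exists2 b : R, 0 < b & forall i x, nr (f i x) <= b * nr x.
  by apply: uniform_bound => i; case: (hf i).
have [E E0 hE] := sum_bound e.
pose q := 2 * c * b * E.
have q0 : 0 < q by rewrite !mulr_gt0.
have m0 : 0 <= m%:R :> R by [].
(* The first term serves [small_system], the second [hyper_range_solve]; it also keeps K positive
   when m is 0. *)
pose K := m%:R * q + 2 * c.
have K0 : 0 < K by rewrite ltr_wpDl // ?mulr_gt0 // mulr_ge0 // ltW.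
exists K^-1; first by rewrite invr_gt0.
move=> l /(invr_small K0) lK; have l0 := nr_ge0 l.
have lc : nr l * c <= 2^-1.
  have : 0 <= nr l * (m%:R * q) by rewrite !mulr_ge0 // ltW.
  by move: lK; rewrite /K mulrDr; lra.
have Ye i : Y (e i) by apply: kerY; case: (ke i).
have /choice[w hw] : forall i, exists w,
    [/\ Y w, shift S l w = l *: e i & nr w <= 2 * c * nr (l *: e i)].
  by move=> i; apply: hyper_range_solve => //; exact: (subspZ sY).
exists (fun i => e i + w i); split => [i|a ha].
  have [Yw wE _] := hw i; split; first by apply: YM; exact: (subspD sY).
  have [_ Se] := ke i.
  by rewrite (linD (lin_shift l lS)) wE shiftE Se; abelian_group.
apply: (@small_system _ _ (b * (2 * c * (nr l * E)))).
  have -> : m%:R * (b * (2 * c * (nr l * E))) = nr l * (m%:R * q) by rewrite /q; ring.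
  have : 0 < nr l * (2 * c) \/ nr l = 0.
    by move: l0; rewrite le_eqVlt => /predU1P[<-|h]; [right|left; rewrite !mulr_gt0].
  by move: lK; rewrite /K mulrDr => h [|->]; [lra|rewrite mul0r].
move=> j; have [lf _ _ fe] := hf j.
have -> : a j = - f j (\sum_i a i *: w i).
  have : f j (\sum_i a i *: e i + \sum_i a i *: w i) = 0.
    rewrite -big_split /= -[RHS](lin0 lf) -[in RHS]ha; congr (f j _).
    by apply: eq_bigr => i _; rewrite scalerDr.
  rewrite (linD lf) (lin_comb lf) (bigD1 j) //= fe eqxx big1 => [|i ij].
    by rewrite addr0 /GRing.scale /= mulr1 => /eqP; rewrite addr_eq0 => /eqP.
  by rewrite fe eq_sym (negPf ij) scaler0.
rewrite nrN; apply: le_trans (hb _ _) _; rewrite -!mulrA ler_wpM2l ?(ltW b0) //.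
rewrite !mulrA; apply: comb_bound => i; have [_ _ h] := hw i; apply: le_trans h _.
rewrite nrZ -!mulrA !ler_wpM2l ?(ltW c0) //; exact: hE.
Qed.

(** A vector y with S y = l y that is killed by the functionals dual to a basis of the kernel must
    vanish: with a small u such that S u = S y, the kernel vector y - u has coefficients - f i u, so
    nr y is bounded by a small multiple of itself. *)
Lemma ker_upper m : ~ cge (kerM S M) [set 0] m -> exists2 d : R, 0 < d &
  forall l : C, nr l < d -> ~ cge (kerM (shift S l) M) [set 0] m.
Proof.
move=> /cd_exists[k km /(cd_basis (@subsp_zero R X))[e [ke ie se]]].
have [f hf] := biorthogonal closed_subspace0 ie.
have [b b0 hb] : exists2 b : R, 0 < b & forall i x, nr (f i x) <= b * nr x.
  by apply: uniform_bound => i; case: (hf i).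
have [E E0 hE] := sum_bound e.
have k0 : 0 <= k%:R :> R by [].
pose K := (1 + E * (k%:R * b)) * c.
have K1 : 0 <= E * (k%:R * b) by rewrite !mulr_ge0 // ltW.
have K0 : 0 < K by rewrite mulr_gt0 // ltr_wpDr.
exists K^-1; first by rewrite invr_gt0.
move=> l /(invr_small K0) lK hcge; move: km; rewrite ltnNge => /negP; apply.
apply: (cge_functionals (f := f) _ _ _ hcge).
- by apply: subsp_ker => //; exact: lin_shift.
- by move=> i; case: (hf i).
move=> y [My yE] fy.
have Sy : S y = l *: y by apply/eqP; rewrite -subr_eq0 -shiftE yE.
have [u [Mu uE] nu] := hc My; rewrite Sy nrZ in nu.
have [a /= /eqP] : addspan [set 0] e (y - u).
  by apply: se; split; [exact: subspB|rewrite (linB lS) uE subrr].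
rewrite subr_eq0 => /eqP zE.
have aE i : nr (a i) <= b * nr u.
  have [lf _ _ fe] := hf i; have -> : a i = - f i u.
    have : f i (y - u) = a i.
      rewrite zE (lin_comb lf) (bigD1 i) //= fe eqxx big1 => [|j ij].
        by rewrite addr0 /GRing.scale /= mulr1.
      by rewrite fe eq_sym (negPf ij) scaler0.
    by rewrite (linB lf) fy sub0r => <-.
  by rewrite nrN.
have nz : nr (y - u) <= E * (k%:R * (b * nr u)).
  rewrite zE; apply: le_trans (comb_bound a hE) _; rewrite ler_wpM2l ?(ltW E0) //.
  apply: le_trans (ler_sum _ (fun i _ => aE i)) _.
  by rewrite sumr_const card_ord mulr_natl.
have ny : nr y <= K * nr l * nr y.
  have -> : y = u + (y - u) by abelian_group.
  apply: le_trans (nrD _ _) _; rewrite subrKC.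
  apply: le_trans (lerD (lexx _) nz) _.
  have -> : nr u + E * (k%:R * (b * nr u)) = (1 + E * (k%:R * b)) * nr u by ring.
  by rewrite /K -!mulrA ler_wpM2l // addr_ge0.
apply: nr_eq0; have := nr_ge0 y; rewrite (mulrC K) in ny; nra.
Qed.

(** If a combination of the [e i] equals (S - l) x with x controlled, functionals vanishing on the
    range of S give a j = - l f j x, to which [small_system] applies. *)
Lemma range_lower m : cge M (rangeM S M) m -> exists2 d : R, 0 < d &
  forall l : C, nr l < d -> cge M (rangeM (shift S l) M) m.
Proof.
move=> [e [Me ie]].
have cRS : closed_subspace (rangeM S M) by apply: closed_subsp_range => //; case: KM.
have [f hf] := biorthogonal cRS ie.
have [b b0 hb] : exists2 b : R, 0 < b & forall i x, nr (f i x) <= b * nr x.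
  by apply: uniform_bound => i; case: (hf i).
have [E E0 hE] := sum_bound e.
pose q := 2 * c * b * E.
have q0 : 0 < q by rewrite !mulr_gt0.
have m0 : 0 <= m%:R :> R by [].
pose K := m%:R * q + 16 * c.
have K0 : 0 < K by rewrite ltr_wpDl // ?mulr_gt0 // mulr_ge0 // ltW.
exists K^-1; first by rewrite invr_gt0.
move=> l /(invr_small K0) lK; have l0 := nr_ge0 l.
have lc : nr l * c <= 16^-1.
  have : 0 <= nr l * (m%:R * q) by rewrite !mulr_ge0 // ltW.
  by move: lK; rewrite /K mulrDr; lra.
exists e; split => // a [x0 Mx0 x0E].
have [x [Mx xE] nx] := shift_solvable lc Mx0; rewrite x0E in xE nx.
apply: (@small_system _ _ (nr l * (b * (2 * c * E)))).
  have -> : m%:R * (nr l * (b * (2 * c * E))) = nr l * (m%:R * q) by rewrite /q; ring.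
  have : 0 < nr l * (16 * c) \/ nr l = 0.
    by move: l0; rewrite le_eqVlt => /predU1P[<-|h]; [right|left; rewrite !mulr_gt0].
  by move: lK; rewrite /K mulrDr => h [|->]; [lra|rewrite mul0r].
move=> j; have [lf _ fR fe] := hf j.
have -> : a j = - (l *: f j x).
  have <- : f j (\sum_i a i *: e i) = a j.
    rewrite (lin_comb lf) (bigD1 j) //= fe eqxx big1 => [|i ij].
      by rewrite addr0 /GRing.scale /= mulr1.
    by rewrite fe eq_sym (negPf ij) scaler0.
  rewrite -xE shiftE (linB lf) (linZ lf) fR ?sub0r //.
  by exists x.
rewrite nrN nrM -mulrA ler_wpM2l //; apply: le_trans (hb _ _) _.
rewrite -mulrA ler_wpM2l ?(ltW b0) //; apply: le_trans nx _.
rewrite -[leRHS]mulrA; apply: ler_wpM2l; first by rewrite mulr_ge0 // ltW.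
exact: comb_bound.
Qed.

(** [P] projects M onto the range of S along a complement. For small l, P after S - l still maps M
    onto that range, so the same complement together with the range of S - l generates M. *)
Lemma range_upper m : ~ cge M (rangeM S M) m -> exists2 d : R, 0 < d &
  forall l : C, nr l < d -> ~ cge M (rangeM (shift S l) M) m.
Proof.
have sR := subsp_range lS sM.
have cRS : closed_subspace (rangeM S M) by apply: closed_subsp_range => //; case: KM.
move=> /cd_exists[k km /(cd_basis sR)[e [Me ie se]]].
have [f hf] := biorthogonal cRS ie.
have [b b0 hb] : exists2 b : R, 0 < b & forall i x, nr (f i x) <= b * nr x.
  by apply: uniform_bound => i; case: (hf i).
have [E E0 hE] := sum_bound e.
have k0 : 0 <= k%:R :> R by [].
have K1 : 0 <= E * (k%:R * b) by rewrite !mulr_ge0 // ltW.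
pose P x := x - \sum_i f i x *: e i.
have lP : lin P.
  move=> a x y; rewrite /P scalerBr addrACA -opprD; congr (_ - _).
  rewrite scaler_sumr -big_split; apply: eq_bigr => i _.
  by have [lf _ _ _] := hf i; rewrite lf scalerDl scalerA.
have nP x : nr (P x) <= (1 + E * (k%:R * b)) * nr x.
  apply: le_trans (nrB _ _) _; rewrite mulrDl mul1r lerD2l.
  apply: le_trans (comb_bound _ hE) _; rewrite -!mulrA ler_wpM2l ?(ltW E0) //.
  apply: le_trans (ler_sum _ (fun i _ => hb i x)) _.
  by rewrite sumr_const card_ord mulr_natl.
have bP : bnd P by exists (1 + E * (k%:R * b)) => //; rewrite ltr_wpDr.
have PR y : rangeM S M y -> P y = y.
  move=> Ry; rewrite /P big1 ?subr0 // => i _.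
  by have [_ _ fR _] := hf i; rewrite fR // scale0r.
have RP y : M y -> rangeM S M (P y).
  move=> /se[a ha]; move: (ha); congr (rangeM S M _); congr (_ - _).
  apply: eq_bigr => i _; have [lf _ fR fe] := hf i; congr (_ *: _).
  have := fR _ ha; rewrite (linB lf) (lin_comb lf) (bigD1 i) //= fe eqxx.
  rewrite big1 => [|j ij]; last by rewrite fe eq_sym (negPf ij) scaler0.
  by rewrite addr0 /GRing.scale /= mulr1 => /eqP; rewrite subr_eq0 => /eqP.
(* The bound of [P] times c, doubled so that the residual l P x is at most half of the right-hand
   side. *)
pose K := 2 * ((1 + E * (k%:R * b)) * c).
have K0 : 0 < K by rewrite !mulr_gt0 // ltr_wpDr.
exists K^-1; first by rewrite invr_gt0.
move=> l /(invr_small K0) lK hcge; move: km; rewrite ltnNge => /negP; apply.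
have lA : lin (P \o shift S l) by move=> a x y /=; rewrite (lin_shift l lS) lP.
have bA : bnd (P \o shift S l) by apply: bnd_comp => //; exact: bnd_shift.
have sRl := subsp_range (lin_shift l lS) sM.
have solve y : rangeM S M y -> exists2 x, M x & P (shift S l x) = y.
  move=> Ry; have [|x [_ [Mx -> -> _ _]]] := approx_solve (ltW c0) lA bA cM closed_subspace0
      _ Ry; last by exists x; rewrite ?addr0.
  move=> {Ry} _ [x0 Mx0 <-]; have [x [Mx xE] nx] := hc Mx0.
  have D : S x0 - ((P \o shift S l) x + 0) = l *: P x.
    rewrite addr0 /= shiftE (linB lP) (linZ lP) PR; last by exists x.
    by rewrite xE; abelian_group.
  exists x, 0; rewrite D nr0; split => //.
  - by apply: (subspZ sR); exact: RP.
  - by split => //; rewrite mulr_ge0 ?nr_ge0 // ltW.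
  rewrite nrZ; have := ler_wpM2l (nr_ge0 l) (nP x).
  have := ler_wpM2l (nr_ge0 l) (ler_wpM2l (addr_ge0 ler01 K1) nx).
  have := ler_wpM2r (nr_ge0 (S x0)) (ltW lK); rewrite /K; lra.
apply: (steinitz sRl hcge); exists e; split => // y My.
have [x Mx xE] := solve _ (RP _ My).
exists (fun i => f i (y - shift S l x)).
have : P (y - shift S l x) = 0 by rewrite (linB lP) xE subrr.
move=> /eqP; rewrite subr_eq0 => /eqP <-; exists x => //; abelian_group.
Qed.
End Bound.
End Kato.

Definition same_dims S S' M : Prop := forall m,
  (cge (kerM S M) [set 0] m <-> cge (kerM S' M) [set 0] m) /\
  (cge M (rangeM S M) m <-> cge M (rangeM S' M) m).

Lemma kato_locally_constant S M m : lin S -> bnd S -> closed_subspace M -> invariant S M ->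
  KatoM S M -> exists2 d : R, 0 < d & forall l : C, nr l < d ->
    (cge (kerM S M) [set 0] m <-> cge (kerM (shift S l) M) [set 0] m) /\
    (cge M (rangeM S M) m <-> cge M (rangeM (shift S l) M) m).
Proof.
move=> lS bS cM iM KM; have [c c0 hc] := closed_range_bound lS bS cM (proj1 KM).
have [d1 d10 h1] : exists2 d : R, 0 < d & forall l : C, nr l < d ->
    (cge (kerM S M) [set 0] m <-> cge (kerM (shift S l) M) [set 0] m).
  have [h|h] := pselect (cge (kerM S M) [set 0] m).
    have [d d0 hd] := ker_lower lS bS cM iM KM c0 hc h.
    by exists d => // l ld; split => // _; exact: hd.
  have [d d0 hd] := ker_upper lS cM c0 hc h.
  by exists d => // l ld; split => // h'; case: (hd l ld h').
have [d2 d20 h2] : exists2 d : R, 0 < d & forall l : C, nr l < d ->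
    (cge M (rangeM S M) m <-> cge M (rangeM (shift S l) M) m).
  have [h|h] := pselect (cge M (rangeM S M) m).
    have [d d0 hd] := range_lower lS bS cM iM KM c0 hc h.
    by exists d => // l ld; split => // _; exact: hd.
  have [d d0 hd] := range_upper lS bS cM KM c0 hc h.
  by exists d => // l ld; split => // h'; case: (hd l ld h').
exists (Num.min d1 d2); first by rewrite lt_min d10.
by move=> l; rewrite lt_min => /andP[l1 l2]; split; [exact: h1|exact: h2].
Qed.

(* Local constancy of each predicate "dimension at least m" only holds with a radius that
   depends on m; connectedness of segments turns it into constancy on a fixed disc. *)
Theorem kato_perturbation S M : lin S -> bnd S -> closed_subspace M -> invariant S M ->
  KatoM S M -> exists2 d : R, 0 < d & forall l : C, nr l < d ->
    KatoM (shift S l) M /\ same_dims S (shift S l) M.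
Proof.
move=> lS bS cM iM KM; have [c c0 hc] := closed_range_bound lS bS cM (proj1 KM).
have K16 : 0 < 16 * c by rewrite mulr_gt0.
exists (16 * c)^-1; first by rewrite invr_gt0.
move=> l /(invr_small K16) lc.
(* The constant c of S serves the whole segment from 0 to l, whose points have modulus at most nr
   l. *)
have Kt (t : R) : 0 <= t <= 1 -> KatoM (shift S (t%:C * l)) M.
  move=> /andP[t0 t1]; apply: (shift_Kato lS bS cM iM KM c0 hc).
  rewrite nrM nrR ger0_norm //.
  have := nr_ge0 l; have := mulr_ge0 (nr_ge0 l) (ltW c0); nra.
split; first by have := Kt 1; rewrite mul1r; apply; rewrite ler01 lexx.
move=> m.
pose Q (t : R) := (cge (kerM S M) [set 0] m <-> cge (kerM (shift S (t%:C * l)) M) [set 0] m) /\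
  (cge M (rangeM S M) m <-> cge M (rangeM (shift S (t%:C * l)) M) m).
suff : Q 1 by rewrite /Q mul1r.
apply: segment_induction; last by rewrite /Q mul0r shift_zero.
move=> t t01.
have [d d0 hd] := kato_locally_constant m (lin_shift (t%:C * l) lS) (bnd_shift (t%:C * l) bS)
  cM (shift_invariant _ (closed_subsp cM) iM) (Kt t t01).
(* A smaller change of the parameter moves the point of the segment by less than d; the summand 1
   covers l = 0. *)
exists (d / (1 + nr l)); first by rewrite divr_gt0 // ltr_wpDr // nr_ge0.
move=> s _ st; have sl : nr ((s - t)%:C * l) < d.
  rewrite nrM nrR; move: st; rewrite ltr_pdivlMr ?ltr_wpDr ?nr_ge0 //.
  have := normr_ge0 (s - t); nra.
have := hd _ sl; rewrite shift_shift -mulrDl -rmorphD subrKC /Q; tauto.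
Qed.
End KatoPerturbation.

(** * Operator classes, Browder summands and Riesz operators *)

Section OperatorClasses.
Context {R : realType} {X : completeNormedModType R[i]}.
Local Notation C := R[i].
Local Notation "r %:C" := (real_complex R r).
Implicit Types (S : X -> X) (M N A B : set X) (l : C).

Definition regularity (c : opclass) : bool :=
  match c with cM | cQ | cInv => false | _ => true end.

Section Basics.
Variables (S : X -> X) (M : set X).
Hypotheses (lS : lin S) (cM : closed_subspace M) (iM : invariant S M).

Let sM : subsp M := closed_subsp cM.

Lemma upper_semiFredholmP : upper_semiFredholmM S M <->
  (exists k, cd (kerM S M) [set 0] k) /\ closed (rangeM S M).
Proof.
have sK := subsp_ker lS sM.
by split => -[[k hk] cR]; split => //; exists k; apply/dim_eqP.
Qed.

Lemma lower_semiFredholmP : lower_semiFredholmM S M <-> exists k, cd M (rangeM S M) k.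
Proof.
have sR := subsp_range lS sM.
by split => -[k hk]; exists k; apply/codim_eqP => //; exact: range_sub1.
Qed.

Lemma dim_kerP k : dim_eq (kerM S M) k <-> cd (kerM S M) [set 0] k.
Proof. exact/dim_eqP/subsp_ker. Qed.

Lemma codim_rangeP k : codim_eq M (rangeM S M) k <-> cd M (rangeM S M) k.
Proof.
apply: codim_eqP => //; first exact: subsp_range.
exact: range_sub1.
Qed.

Lemma finite_ascentP : finite_ascentM S M <->
  exists p, forall x, M x -> iter p.+1 S x = 0 -> iter p S x = 0.
Proof.
split=> -[p hp]; exists p.
  by move=> x Mx x0; have [] : kerM (iter p S) M x by rewrite hp.
apply/seteqP; split => x [Mx x0]; split => //; last exact: hp.
by rewrite iterS x0 (lin0 lS).
Qed.

Lemma finite_descentP : finite_descentM S M <->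
  exists q, forall x, M x -> exists2 y, M y & iter q S x = iter q.+1 S y.
Proof.
split=> -[q hq]; exists q.
  move=> x Mx; have [y My yE] : rangeM (iter q.+1 S) M (iter q S x).
    by rewrite -hq; exists x.
  by exists y.
apply/seteqP; split => [_ [x Mx <-]|_ [x Mx <-]].
  by have [y My ->] := hq x Mx; exists y.
by exists (S x); [exact: iM|rewrite -iterSr].
Qed.

Lemma ascent_le p q : (p <= q)%N ->
  (forall x, M x -> iter p.+1 S x = 0 -> iter p S x = 0) ->
  forall x, M x -> iter q.+1 S x = 0 -> iter q S x = 0.
Proof.
move=> /subnK <- hp; elim: (q - p)%N => [|k IH] //= x Mx.
by have := IH (S x) (iM Mx); rewrite -!iterSr.
Qed.

Lemma descent_le p q : (p <= q)%N ->
  (forall x, M x -> exists2 y, M y & iter p S x = iter p.+1 S y) ->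
  forall x, M x -> exists2 y, M y & iter q S x = iter q.+1 S y.
Proof.
move=> /subnK <- hp; elim: (q - p)%N => [|k IH] //= x Mx.
by have [y My yE] := IH x Mx; exists y => //; rewrite yE.
Qed.

(** A kernel vector is x = S^p z by the Kato condition, and S^(p + 1) z = 0 implies S^p z = 0 when p
    is the ascent. *)
Lemma Kato_ascent0 : KatoM S M -> finite_ascentM S M -> kerM S M `<=` [set 0].
Proof.
move=> [_ hK] /finite_ascentP[p hp] x kx; have [z Mz zE] := hK p x kx.
by rewrite -zE; apply: hp => //=; rewrite zE; case: kx.
Qed.

Lemma Kato_descent0 : KatoM S M -> finite_descentM S M -> M `<=` rangeM S M.
Proof.
move=> [_ hK] /finite_descentP[q hq] x Mx; have [y My yE] := hq x Mx.
(* The kernels of all powers, not only of S, lie in the ranges of all powers. *)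
have {}hK k n z : M z -> iter k S z = 0 -> rangeM (iter n S) M z.
  elim: k z n => [|k IH] z n Mz z0.
    by move: z0 => /= ->; exists 0; [exact: subsp0|exact: (lin0 (lin_iter _ lS))].
  have [|w Mw wE] := hK (n + k)%N (iter k S z).
    by split; [exact: invariant_iter|].
  rewrite -(subrK (iter n S w) z); apply: subspD; last by exists w.
    by apply: subsp_range => //; exact: lin_iter.
  apply: IH; first by apply: subspB => //; exact: invariant_iter.
  by rewrite (linB (lin_iter k lS)) -iterD addnC wE subrr.
have [||z Mz zE] := hK q 1%N (x - S y).
- by apply: subspB => //; exact: iM.
- by rewrite (linB (lin_iter q lS)) -iterSr yE subrr.
exists (z + y); first exact: subspD.
by rewrite (linD lS) [S z]zE subrK.
Qed.

Lemma ker0_ascent : kerM S M `<=` [set 0] -> finite_ascentM S M.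
Proof. by move=> h; apply/finite_ascentP; exists 0%N => x Mx Sx; exact: h. Qed.

Lemma onto_descent : M `<=` rangeM S M -> finite_descentM S M.
Proof.
by move=> h; apply/finite_descentP; exists 0%N => x /h[y My <-]; exists y.
Qed.
End Basics.

Lemma cd_same S S' M : same_dims S S' M ->
  (forall k, cd (kerM S M) [set 0] k <-> cd (kerM S' M) [set 0] k) /\
  (forall k, cd M (rangeM S M) k <-> cd M (rangeM S' M) k).
Proof.
move=> h; split => k; rewrite /cd; have [] := h k; have [] := h k.+1; tauto.
Qed.

(** For a Kato operator finite ascent means nullity 0 and finite descent means defect 0, so these
    classes are determined by nullity and defect alone. *)
Lemma Kato_class c S S' M : regularity c -> lin S -> lin S' -> closed_subspace M ->
  invariant S M -> invariant S' M -> KatoM S M -> KatoM S' M -> same_dims S S' M ->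
  in_classM c S M -> in_classM c S' M.
Proof.
move=> rc lS lS' cM iM iM' KM KM' /cd_same[hker hran].
have sM := closed_subsp cM.
have up : upper_semiFredholmM S M -> upper_semiFredholmM S' M.
  move=> /(upper_semiFredholmP lS cM)[[k hk] _]; apply/(upper_semiFredholmP lS' cM).
  by split; [exists k; apply/hker|case: KM'].
have low : lower_semiFredholmM S M -> lower_semiFredholmM S' M.
  move=> /(lower_semiFredholmP lS cM iM)[k hk]; apply/(lower_semiFredholmP lS' cM iM').
  by exists k; apply/hran.
have le0 : index_le0M S M -> index_le0M S' M.
  move=> h m n /(dim_kerP lS' cM)/hker/(dim_kerP lS cM) hm.
  by move=> /(codim_rangeP lS' cM iM')/hran/(codim_rangeP lS cM iM); exact: h.
have ge0 : index_ge0M S M -> index_ge0M S' M.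
  move=> h m n /(dim_kerP lS' cM)/hker/(dim_kerP lS cM) hm.
  by move=> /(codim_rangeP lS' cM iM')/hran/(codim_rangeP lS cM iM); exact: h.
have asc : finite_ascentM S M -> finite_ascentM S' M.
  move=> /(Kato_ascent0 lS KM)/cd_zero/hker h; apply: (ker0_ascent lS').
  by apply/(cd0P _ subsp_zero).
have desc : finite_descentM S M -> finite_descentM S' M.
  move=> /(Kato_descent0 lS cM iM KM)/cd_zero/hran h; apply: (onto_descent iM').
  by apply/(cd0P _ (subsp_range lS' sM)).
by case: c rc => //= _; rewrite /FredholmM; tauto.
Qed.

(* The common value d of nullity and defect encodes index zero. *)
Definition BrowderM S N : Prop := exists d, [/\ cd (kerM S N) [set 0] d,
  cd N (rangeM S N) d, closed (rangeM S N), finite_ascentM S N & finite_descentM S N].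

Section BrowderSummand.
Variables (S : X -> X) (M M1 N : set X).
Hypotheses (lS : lin S) (dM : ddec M M1 N) (iM1 : invariant S M1) (iN : invariant S N).
Hypothesis bN : BrowderM S N.

Let cM : closed_subspace M. Proof. by case: dM. Qed.
Let cM1 : closed_subspace M1. Proof. by case: dM. Qed.
Let cN : closed_subspace N. Proof. by case: dM. Qed.
Let iM : invariant S M. Proof. exact: ddec_invariant dM iM1 iN. Qed.

Lemma browder_upper : upper_semiFredholmM S M <-> upper_semiFredholmM S M1.
Proof.
have [d [hk hr cRN _ _]] := bN.
split => [/(upper_semiFredholmP lS cM)[[k h] cR]|/(upper_semiFredholmP lS cM1)[[k h] cR]].
  apply/(upper_semiFredholmP lS cM1); split; last exact: (ddec_closed_range_l lS dM).
  by have [m hm _] := ddec_cd_ker_l lS dM iM1 iN h hk; exists m.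
apply/(upper_semiFredholmP lS cM); split; last exact: (ddec_closed_range lS dM).
by exists (k + d)%N; exact: (ddec_cd_ker lS dM).
Qed.

Lemma browder_lower : lower_semiFredholmM S M <-> lower_semiFredholmM S M1.
Proof.
have [d [hk hr cRN _ _]] := bN.
split => [/(lower_semiFredholmP lS cM iM)[k h]|/(lower_semiFredholmP lS cM1 iM1)[k h]].
  apply/(lower_semiFredholmP lS cM1 iM1).
  by have [m hm _] := ddec_cd_range_l lS dM iM1 iN h hr; exists m.
apply/(lower_semiFredholmP lS cM iM).
by exists (k + d)%N; exact: (ddec_cd_range lS dM).
Qed.

(** Both index conditions are relations invariant under adding the same d to nullity and defect. *)
Lemma browder_index (P : nat -> nat -> Prop) :
  (forall m n d, P (m + d)%N (n + d)%N <-> P m n) ->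
  (forall m n, dim_eq (kerM S M) m -> codim_eq M (rangeM S M) n -> P m n) <->
  (forall m n, dim_eq (kerM S M1) m -> codim_eq M1 (rangeM S M1) n -> P m n).
Proof.
move=> hP; have [d [hk hr _ _ _]] := bN; split => h m n.
  move=> /(dim_kerP lS cM1) hm /(codim_rangeP lS cM1 iM1) hn; apply/(hP m n d)/h.
    by apply/(dim_kerP lS cM); exact: (ddec_cd_ker lS dM).
  by apply/(codim_rangeP lS cM iM); exact: (ddec_cd_range lS dM).
move=> /(dim_kerP lS cM) hm /(codim_rangeP lS cM iM) hn.
have [m' hm' ->] := ddec_cd_ker_l lS dM iM1 iN hm hk.
have [n' hn' ->] := ddec_cd_range_l lS dM iM1 iN hn hr.
by apply/hP/h; [apply/(dim_kerP lS cM1)|apply/(codim_rangeP lS cM1 iM1)].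
Qed.

Lemma browder_ascent : finite_ascentM S M <-> finite_ascentM S M1.
Proof.
have [d [_ _ _ /(finite_ascentP N lS)[q hq] _]] := bN.
have [_ _ _ [hM h0]] := dM.
split => [/(finite_ascentP M lS)[p hp]|/(finite_ascentP M1 lS)[p hp]].
  apply/(finite_ascentP M1 lS); exists p => x Mx; apply: hp.
  exact: (ddec_subl dM).
apply/(finite_ascentP M lS); exists (maxn p q) => x /hM[y [z [My Nz ->]]].
have sM1 := closed_subsp cM1; have sN := closed_subsp cN.
rewrite !(linD (lin_iter _ lS)) => /eqP; rewrite addr_eq0 => /eqP E.
have y0 : iter (maxn p q).+1 S y = 0.
  apply: h0; first exact: invariant_iter.
  by rewrite E; apply: subspN => //; exact: invariant_iter.
have z0 : iter (maxn p q).+1 S z = 0 by apply/eqP; rewrite -oppr_eq0 -E y0.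
rewrite (ascent_le iM1 (leq_maxl p q) hp My y0).
by rewrite (ascent_le iN (leq_maxr p q) hq Nz z0) addr0.
Qed.

Lemma browder_descent : finite_descentM S M <-> finite_descentM S M1.
Proof.
have [d [_ _ _ _ /(finite_descentP iN)[q hq]]] := bN.
have [_ _ _ [hM h0]] := dM.
have sM1 := closed_subsp cM1; have sN := closed_subsp cN.
split => [/(finite_descentP iM)[p hp]|/(finite_descentP iM1)[p hp]].
  apply/(finite_descentP iM1); exists p => x Mx.
  have [_ /hM[y [z [My Nz ->]]]] := hp x (ddec_subl dM Mx).
  rewrite (linD (lin_iter _ lS)) => E; exists y => //.
  apply/eqP; rewrite -subr_eq0; apply/eqP/h0.
    by apply: subspB => //; exact: invariant_iter.
  have -> : iter p S x - iter p.+1 S y = iter p.+1 S z by rewrite E; abelian_group.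
  exact: invariant_iter.
apply/(finite_descentP iM); exists (maxn p q) => x /hM[y [z [My Nz ->]]].
have [y' My' yE] := descent_le (leq_maxl p q) hp My.
have [z' Nz' zE] := descent_le (leq_maxr p q) hq Nz.
exists (y' + z'); first by apply/hM; exists y', z'.
by rewrite !(linD (lin_iter _ lS)) yE zE.
Qed.

Lemma browder_class c : regularity c -> in_classM c S M <-> in_classM c S M1.
Proof.
move=> rc; have := browder_upper; have := browder_lower.
have := browder_ascent; have := browder_descent.
have le0 : index_le0M S M <-> index_le0M S M1.
  by apply: browder_index => m n d; rewrite leq_add2r.
have ge0 : index_ge0M S M <-> index_ge0M S M1.
  by apply: (@browder_index (fun m n => (n <= m)%N)) => m n d; rewrite leq_add2r.
by case: c rc => //= _; rewrite /FredholmM; tauto.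
Qed.

Lemma browder_sum : BrowderM S M1 -> BrowderM S M.
Proof.
move=> [d1 [hk1 hr1 cR1 a1 e1]]; have [d [hk hr cR a e]] := bN.
exists (d1 + d)%N; split.
- exact: (ddec_cd_ker lS dM).
- exact: (ddec_cd_range lS dM).
- exact: (ddec_closed_range lS dM).
- exact/browder_ascent.
- exact/browder_descent.
Qed.
End BrowderSummand.

Definition bijM S M : Prop := kerM S M `<=` [set 0] /\ M `<=` rangeM S M.

Lemma bij_range S M : invariant S M -> bijM S M -> rangeM S M = M.
Proof. by move=> iM [_ h]; apply/seteqP; split => // _ [x Mx <-]; exact: iM. Qed.

Lemma bij_Browder S M : lin S -> closed_subspace M -> invariant S M -> bijM S M ->
  BrowderM S M.
Proof.
move=> lS cM iM bM; have [h1 h2] := bM; exists 0%N; split.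
- exact: cd_zero.
- exact: cd_zero.
- by rewrite bij_range //; case: cM.
- exact: ker0_ascent.
- exact: onto_descent.
Qed.

Lemma Browder_class c S M : regularity c -> lin S -> closed_subspace M -> invariant S M ->
  BrowderM S M -> in_classM c S M.
Proof.
move=> rc lS cM iM [d [hk hr cR a e]].
have up : upper_semiFredholmM S M.
  by apply/upper_semiFredholmP => //; split => //; exists d.
have low : lower_semiFredholmM S M by apply/lower_semiFredholmP => //; exists d.
have hm m n : dim_eq (kerM S M) m -> codim_eq M (rangeM S M) n -> m = n.
  move=> /dim_kerP hm /codim_rangeP hn.
  by rewrite (cd_uniq (hm lS cM) hk) (cd_uniq (hn lS cM iM) hr).
have le0 : index_le0M S M by move=> m n h1 h2; rewrite (hm m n).
have ge0 : index_ge0M S M by move=> m n h1 h2; rewrite (hm m n).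
by case: c rc => //= _; rewrite /FredholmM; tauto.
Qed.

(** The range is M, hence closed, and [closed_range_bound] bounds the inverse; this gives the three
    classes not covered by [Browder_class]. *)
Lemma bij_all_classes c S M : lin S -> bnd S -> closed_subspace M -> invariant S M ->
  bijM S M -> in_classM c S M.
Proof.
move=> lS bS cM iM bM; have [h1 h2] := bM; have sM := closed_subsp cM.
have [rc|] := boolP (regularity c).
  by apply: Browder_class => //; exact: bij_Browder.
have cR : closed (rangeM S M) by rewrite bij_range //; case: cM.
have [a a0 ha] := closed_range_bound lS bS cM cR.
have inj x y : M x -> M y -> S x = S y -> x = y.
  move=> Mx My E; apply/eqP; rewrite -subr_eq0; apply/eqP/h1.
  by split; [exact: subspB|rewrite (linB lS) E subrr].
have below x : M x -> nr x <= a * nr (S x).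
  by move=> Mx; have [x' [Mx' E] h] := ha x Mx; rewrite {1}(inj x x' Mx Mx' (esym E)).
case: c => //= _.
- exists (a^-1)%:C; split; first by rewrite ltcR invr_gt0.
  move=> x /below h; rewrite !normE -rmorphM lecR.
  by rewrite ler_pdivrMl.
- exact: bij_range.
have /choice[g hg] : forall y, exists x, M y -> M x /\ S x = y.
  move=> y; have [My|My] := pselect (M y); last by exists 0.
  by have [x Mx <-] := h2 y My; exists x.
exists g; split.
- by move=> x /hg[].
- by move=> x Mx; have [Mg E] := hg _ (iM _ Mx); exact: inj.
- by move=> x /hg[].
apply/subspace_continuousP => x Mx; move=> B /nbhs_nr[e e0 eB].
apply/nbhs_nr; exists (e / a); first by rewrite divr_gt0.
move=> y yx My; apply: eB; have [Mgy Ey] := hg y My; have [Mgx Ex] := hg x Mx.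
apply: le_lt_trans (below _ (subspB sM Mgy Mgx)) _.
by rewrite (linB lS) Ey Ex mulrC -ltr_pdivlMr.
Qed.

Lemma rank_nullity S N n k : lin S -> subsp N -> invariant S N ->
  cd N [set 0] n -> cd (kerM S N) [set 0] k -> cd N (rangeM S N) k.
Proof.
move=> lS sN iN hn hk; have sR := subsp_range lS sN; have sK := subsp_ker lS sN.
have z A : subsp A -> [set 0] `<=` A by move=> sA _ ->; exact: subsp0.
have ex A B : A `<=` N -> subsp A -> subsp B -> exists m, cd A B m.
  move=> AN sA sB; have [|m _ h] := @cd_exists _ _ A B n.+1; last by exists m.
  apply: contra_not (proj2 hn) => h; apply: cge_transfer_eq h => //.
  by move=> x _ ->; exact: subsp0.
have RN : rangeM S N `<=` N by exact: range_sub1.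
have KN : kerM S N `<=` N by move=> x [].
have [r hr] := ex N (rangeM S N) (fun _ h => h) sN sR.
have [s hs] := ex (rangeM S N) [set 0] RN sR (@subsp_zero R X).
have [t ht] := ex N (kerM S N) (fun _ h => h) sN sK.
(* The dimension of N is counted through S(N) and through the kernel. S identifies N modulo its
   kernel with S(N), so the remaining terms, defect and nullity, agree. *)
have E1 := cd_uniq hn (cd_tower sR (@subsp_zero R X) (z _ sR) RN hr hs).
have E2 := cd_uniq hn (cd_tower sK (@subsp_zero R X) (z _ sK) KN ht hk).
have quo j : cge N (kerM S N) j <-> cge (rangeM S N) [set 0] j.
  split.
    apply: (@cge_transfer _ _ _ _ _ _ (fun x x' => N x /\ x' = S x)).
    - by split; [exact: subsp0|rewrite (lin0 lS)].
    - move=> a x x' y y' [Nx ->] [Ny ->]; split; last by rewrite lS.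
      by apply: subspD => //; exact: subspZ.
    - by move=> x Nx; exists (S x) => //; exists x.
    - by move=> x x' [Nx ->].
  apply: (@cge_transfer _ _ _ _ _ _ (fun x x' => x = S x')).
  - by rewrite (lin0 lS).
  - by move=> a x x' y y' -> ->; rewrite lS.
  - by move=> _ [x Nx <-]; exists x.
  - by move=> x x' -> [].
have st : s = t.
  by apply: cd_uniq hs _; case: ht => h h'; split; [apply/quo|move/quo].
have -> : k = r by lia.
exact: hr.
Qed.

Lemma nilpotent_Browder S N n : lin S -> closed_subspace N -> invariant S N ->
  nilpotentM S N -> ~ cge N [set 0] n -> BrowderM S N.
Proof.
move=> lS cN iN [p hp] hn; have sN := closed_subsp cN.
have [k hk] : exists k, cd (kerM S N) [set 0] k by apply: cd_fin_sub hn => x [].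
have [d _ hd] := cd_exists hn.
have sR := subsp_range lS sN.
exists k; split => //.
- exact: rank_nullity hd hk.
- have [|m hm] := @cd_fin_sub _ _ (rangeM S N) N n _ hn; first exact: range_sub1.
  by apply: (finite_dim_closed sR (n := m.+1)); case: hm.
- by apply/finite_ascentP => //; exists p => x Nx _; exact: hp.
- apply/finite_descentP => //; exists p => x Nx; exists 0; first exact: subsp0.
  by rewrite hp // (lin0 (lin_iter _ lS)).
Qed.

Lemma nilpotent_shift_bij S N l : lin S -> subsp N -> invariant S N -> nilpotentM S N ->
  l != 0 -> bijM (shift S l) N.
Proof.
move=> lS sN iN [p hp] l0; split.
  move=> x [Nx] /eqP; rewrite shiftE subr_eq0 => /eqP Sx.
  have E k : iter k S x = l ^+ k *: x.
    elim: k => [|k IH]; first by rewrite scale1r.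
    by rewrite iterSr Sx (linZ (lin_iter k lS)) IH scalerA -exprS.
  have /eqP := hp x Nx; rewrite E scaler_eq0 expf_eq0 (negPf l0) andbF /= => /eqP.
  by [].
suff h k : forall x, N x -> iter k S x = 0 -> rangeM (shift S l) N x.
  by move=> x Nx; apply: (h p) => //; exact: hp.
elim: k => [|k IH] x Nx x0.
  move: x0 => /= ->; exists 0; [exact: subsp0|exact: (lin0 (lin_shift l lS))].
have [|y Ny yE] := IH (S x) (iN _ Nx); first by rewrite -iterSr.
exists (l^-1 *: (y - x)); first by apply: subspZ => //; exact: subspB.
rewrite (linZ (lin_shift l lS)) (linB (lin_shift l lS)) yE shiftE.
have -> : S x - (S x - l *: x) = l *: x by abelian_group.
by rewrite scalerA mulVf // scale1r.
Qed.

(** The approximate solution - y / l of (S - l) x = y leaves the residual S y / l; the factor 2 in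
    the hypothesis makes it at most half of y, as [approx_solve] requires. *)
Lemma neumann S N b l : lin S -> 0 < b -> (forall x, nr (S x) <= b * nr x) ->
  closed_subspace N -> invariant S N -> 2 * b <= nr l -> bijM (shift S l) N.
Proof.
move=> lS b0 hb cN iN bl; have sN := closed_subsp cN.
have lp : 0 < nr l by lra.
have l0 : l != 0 by apply: contraTneq lp => ->; rewrite nr0 ltxx.
split.
  move=> x [Nx] /eqP; rewrite shiftE subr_eq0 => /eqP Sx; apply: nr_eq0.
  by have := hb x; rewrite Sx nrZ; have := nr_ge0 x; nra.
move=> y Ny; have bS : bnd S by exists b.
have cl : 0 <= (nr l)^-1 by rewrite invr_ge0 ltW.
have [|x [_ [Nx -> -> _ _]]] := approx_solve cl (lin_shift l lS) (bnd_shift l bS) cN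
  closed_subspace0 _ Ny; last by exists x; rewrite ?addr0.
move=> {Ny} {}y Ny; exists (- (l^-1 *: y)), 0.
have -> : y - (shift S l (- (l^-1 *: y)) + 0) = l^-1 *: S y.
  rewrite (linN (lin_shift l lS)) shiftE (linZ lS) scalerA mulfV // scale1r.
  abelian_group.
split => //.
- by apply: subspN => //; exact: subspZ.
- by apply: subspZ => //; exact: iN.
- by rewrite nrN nrZ nrV nr0 lexx mulr_ge0 // nr_ge0.
rewrite nrZ nrV ler_pdivrMl //; apply: le_trans (hb y) _.
have := nr_ge0 y; nra.
Qed.

Lemma ddec_bij S M M1 N : lin S -> ddec M M1 N -> invariant S M1 -> invariant S N ->
  bijM S N -> bijM S M <-> bijM S M1.
Proof.
move=> lS dM iM1 iN [kN rN]; have [cM cM1 cN [hM h0]] := dM.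
split=> -[hk hr]; split.
- by move=> x [Mx Sx]; apply: hk; split => //; exact: (ddec_subl dM).
- by move=> x Mx; rewrite (ddec_range_l lS dM iM1 iN); split => //; exact/hr/(ddec_subl dM).
- move=> x /(proj1 (issum_ker lS dM iM1 iN))[y [z [/hk -> /kN -> ->]]].
  exact: addr0.
- move=> x /hM[y [z [/hr hy /rN hz ->]]]; apply/(ddec_range lS dM).
  by exists y, z.
Qed.

Lemma bij_cd S M : lin S -> closed_subspace M ->
  bijM S M <-> cd (kerM S M) [set 0] 0 /\ cd M (rangeM S M) 0.
Proof.
move=> lS cM; have sR := subsp_range lS (closed_subsp cM).
split=> [[h1 h2]|[/(cd0P _ (@subsp_zero R X)) h1 /(cd0P _ sR) h2]] //.
by split; exact: cd_zero.
Qed.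

Lemma punctured_translate (d : R) (v : C) : nr v < d -> exists2 e : R, 0 < e &
  forall u : C, 0 < nr u -> nr u < e -> 0 < nr (v + u) < d.
Proof.
move=> vd; have [->|/eqP/nr_gt0 v0] := eqVneq v 0.
  exists d; first by apply: le_lt_trans vd; exact: nr_ge0.
  by move=> u u0 ud; rewrite add0r u0.
(* The first bound keeps v + u in the disc, the second keeps it away from 0. *)
exists (Num.min (d - nr v) (nr v)); first by rewrite lt_min subr_gt0 vd.
move=> u u0; rewrite lt_min => /andP[h1 h2].
have := nrD v u; have := nrB (v + u) u; rewrite addrK => h3 h4.
by apply/andP; split; lra.
Qed.

Lemma punctured_point (e : R) : 0 < e -> exists2 u : C, 0 < nr u & nr u < e.
Proof.
by move=> e0; exists (e / 2)%:C; rewrite nrR gtr0_norm ?divr_gt0 //; lra.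
Qed.

Lemma Fredholm_semi S M : lin S -> closed_subspace M -> FredholmM S M -> semi_Fredholm S M.
Proof.
by move=> lS cM [/(upper_semiFredholmP lS cM)[[k hk] cR] _]; split => //; exists k; left.
Qed.

(** On the nilpotent summand S - u is bijective for every u other than 0, and on the Kato summand
    nullity and defect do not depend on small u. Since the right-hand side is free of u, bijectivity
    on N holds for all small nonzero u or for none. *)
Lemma Fredholm_punctured S N : lin S -> bnd S -> closed_subspace N -> invariant S N ->
  FredholmM S N -> exists N1 N2, [/\ ddec N N1 N2, invariant S N1, invariant S N2,
    BrowderM S N2 & exists2 d : R, 0 < d & forall u : C, 0 < nr u -> nr u < d ->
      (bijM (shift S u) N <-> bijM S N1)].
Proof.
move=> lS bS cN iN FN.
have [N1 [N2 [dN iN1 iN2 KN1 [nilN2 [n fN2]]]]] :=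
  kato_decomposition lS bS cN iN (Fredholm_semi lS cN FN).
have [_ cN1 cN2 _] := dN; have sN1 := closed_subsp cN1; have sN2 := closed_subsp cN2.
exists N1, N2; split => //; first exact: nilpotent_Browder fN2.
have [d d0 hd] := kato_perturbation lS bS cN1 iN1 KN1.
exists d => // u u0 ud; have [_ /cd_same[h1 h2]] := hd u ud.
have lSu := lin_shift u lS.
have un0 : u != 0 by apply: contraTneq u0 => ->; rewrite nr0 ltxx.
have b2 := nilpotent_shift_bij lS sN2 iN2 nilN2 un0.
apply: iff_trans (ddec_bij lSu dN (shift_invariant _ sN1 iN1) (shift_invariant _ sN2 iN2) b2) _.
apply: iff_trans (bij_cd lSu cN1) _; apply: iff_trans _ (iff_sym (bij_cd lS cN1)).
by have := h1 0%N; have := h2 0%N; tauto.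
Qed.

(* Along the ray from l to infinity, "invertible on a punctured neighbourhood" is a locally
   constant property of the point, and it holds far out. *)
Theorem Riesz_Browder S N l : lin S -> bnd S -> closed_subspace N -> invariant S N ->
  RieszM S N -> l != 0 -> BrowderM (shift S l) N.
Proof.
move=> lS bS cN iN RN l0; have sN := closed_subsp cN.
pose Q (z : C) := exists2 e : R, 0 < e & forall u : C, 0 < nr u -> nr u < e ->
  bijM (shift S (z + u)) N.
have loc z : z != 0 -> exists N1 N2, [/\ ddec N N1 N2, invariant (shift S z) N1,
    invariant (shift S z) N2, BrowderM (shift S z) N2 & exists2 d : R, 0 < d &
    forall v : C, nr v < d -> (Q (z + v) <-> bijM (shift S z) N1)].
  move=> z0; have [N1 [N2 [dN iN1 iN2 bN2 [d d0 hd]]]] :=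
    Fredholm_punctured (lin_shift z lS) (bnd_shift z bS) cN (shift_invariant _ sN iN) (RN z z0).
  exists N1, N2; split => //; exists d => // v vd.
  have [e e0 he] := punctured_translate vd.
  split => [[e' e'0 he']|bN1].
    (* One point near z + v and different from z suffices: by [hd] it decides whether S - z is
       bijective on [N1]. *)
    have [u u0] : exists2 u : C, 0 < nr u & nr u < Num.min e e'.
      by apply: punctured_point; rewrite lt_min e0.
    rewrite lt_min => /andP[ue ue']; have /andP[h1 h2] := he u u0 ue.
    by apply/(hd (v + u)) => //; rewrite shift_shift addrA; exact: he'.
  exists e => // u u0 ue; have /andP[h1 h2] := he u u0 ue.
  by rewrite -addrA -shift_shift; apply/hd.
have [b b0 hb] := bS.
have lp : 0 < nr l by apply: nr_gt0; apply/eqP.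
(* This makes nr (z 0) equal to nr l + 2 b + 1, so that every z 0 + u with nr u < 1 is within reach
   of [neumann]. *)
pose K := (2 * b + 1) / nr l.
have K0 : 0 < K by rewrite divr_gt0 // addr_gt0 // mulr_gt0.
pose z (t : R) : C := (1 + (1 - t) * K)%:C * l.
have z1 : z 1 = l by rewrite /z subrr mul0r addr0 mul1r.
have Ql : Q l.
  rewrite -z1; apply: (@segment_induction _ (fun t => Q (z t))) => [t /andP[t0 t1]|].
    (* The path stays on the ray through l, away from 0, where the Riesz condition provides Fredholm
       operators. *)
    have zt : z t != 0.
      rewrite mulf_neq0 // -[0]/(0%:C) (inj_eq (@complexI R)) gt_eqF //.
      by rewrite ltr_wpDr // mulr_ge0 ?subr_ge0 // ltW.
    have [N1 [N2 [_ _ _ _ [d d0 hd]]]] := loc _ zt.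
    exists (d / (K * nr l)); first by rewrite divr_gt0 // mulr_gt0.
    move=> s _ st; have zs : z s = z t + ((t - s) * K)%:C * l.
      by rewrite /z -mulrDl -rmorphD; congr (_%:C * _); ring.
    have := hd 0; rewrite nr0 addr0 => /(_ d0) h.
    have h' : Q (z s) <-> bijM (shift S (z t)) N1.
      rewrite zs; apply: hd; rewrite nrM nrR normrM (gtr0_norm K0) distrC -mulrA.
      by rewrite -ltr_pdivlMr // mulr_gt0.
    exact: iff_trans h' (iff_sym h).
  exists 1 => // u _ u1; apply: (neumann lS b0 hb cN iN).
  have zE : nr (z 0) = nr l + (2 * b + 1).
    rewrite /z subr0 mul1r nrM nrR ger0_norm ?addr_ge0 ?(ltW K0) //.
    by rewrite mulrDl mul1r divfK ?gt_eqF.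
  have := nrB (z 0 + u) u; rewrite addrK zE; lra.
(* [Q l] makes S - l bijective on [N1]; adding the Browder summand [N2] preserves the Browder
   property. *)
have [N1 [N2 [dN iN1 iN2 bN2 [d d0 hd]]]] := loc l l0.
have cN1 : closed_subspace N1 by case: dN.
apply: (browder_sum (lin_shift l lS) dN iN1 iN2 bN2).
apply: bij_Browder => //; first exact: lin_shift.
by apply/(hd 0); rewrite ?nr0 ?addr0.
Qed.
End OperatorClasses.

(** * Behaviour near a decomposable point and comparison of the decompositions *)

Section Spectra.
Context {R : realType} {X : completeNormedModType R[i]}.
Local Notation C := R[i].
Local Notation "r %:C" := (real_complex R r).
Implicit Types (S : X -> X) (M N : set X) (l : C).

Lemma closed_subspaceT : closed_subspace [set: X].
Proof. by split => //; exact: closedT. Qed.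

Lemma direct_decompP M N : direct_decomp M N <-> ddec [set: X] M N.
Proof.
split=> [[cM cN hs h0]|[_ cM cN [hs h0]]].
  by split => //.
by split => // x; apply/hs.
Qed.

Lemma same_dims_sym S S' M : same_dims S S' M -> same_dims S' S M.
Proof. by move=> h m; have [h1 h2] := h m; tauto. Qed.

(** The existential hides a condition free of l: membership in the class of S restricted to its Kato
    summand. *)
Lemma near_GKRD c S : regularity c -> lin S -> bnd S -> GKRD S ->
  exists P : Prop, exists2 d : R, 0 < d & forall l, 0 < nr l -> nr l < d ->
    (in_classM c (shift S l) setT <-> P).
Proof.
move=> rc lS bS [M [N [/direct_decompP dM iM iN KM RN]]].
have [_ cM cN _] := dM; have sM := closed_subsp cM; have sN := closed_subsp cN.
have [d d0 hd] := kato_perturbation lS bS cM iM KM.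
exists (in_classM c S M), d => // l l0 ld; have [KM' dims] := hd l ld.
have ln0 : l != 0 by apply: contraTneq l0 => ->; rewrite nr0 ltxx.
have lSl := lin_shift l lS; have iMl := shift_invariant l sM iM.
have bN := Riesz_Browder lS bS cN iN RN ln0.
apply: iff_trans (browder_class lSl dM iMl (shift_invariant l sN iN) bN rc) _.
split; first by apply: Kato_class => //; exact: same_dims_sym.
exact: Kato_class.
Qed.

Lemma regular_semi_Fredholm c S M : regularity c -> lin S -> bnd S -> closed_subspace M ->
  invariant S M -> in_classM c S M -> semi_Fredholm S M.
Proof.
move=> rc lS bS cM iM.
have up : upper_semiFredholmM S M -> semi_Fredholm S M.
  by move=> /(upper_semiFredholmP lS cM)[[k hk] cR]; split => //; exists k; left.
have low : lower_semiFredholmM S M -> semi_Fredholm S M.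
  move=> /(lower_semiFredholmP lS cM iM)[k hk]; split; last by exists k; right.
  exact: (finite_codim_closed lS bS cM iM (proj2 hk)).
by case: c rc => //= _; rewrite /FredholmM; tauto.
Qed.

(** The summand M in the class is itself split into a Kato part A and a nilpotent part B. Browder
    summands are dropped twice: B at the parameter 0, then N and B at l. What remains is the passage
    from S to S - l on A. *)
Lemma near_gDR c S : regularity c -> lin S -> bnd S ->
  decomp_with (in_classM c) RieszM S ->
  exists2 d : R, 0 < d & forall l, 0 < nr l -> nr l < d -> in_classM c (shift S l) setT.
Proof.
move=> rc lS bS [M [N [/direct_decompP dM iM iN cSM RN]]].
have [_ cM cN _] := dM; have sM := closed_subsp cM; have sN := closed_subsp cN.
have [A [B [dA iA iB KA [nilB [n fB]]]]] :=
  kato_decomposition lS bS cM iM (regular_semi_Fredholm rc lS bS cM iM cSM).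
have [_ cA cB _] := dA; have sA := closed_subsp cA; have sB := closed_subsp cB.
have [d d0 hd] := kato_perturbation lS bS cA iA KA.
exists d => // l l0 ld; have [KA' dims] := hd l ld.
have ln0 : l != 0 by apply: contraTneq l0 => ->; rewrite nr0 ltxx.
have lSl := lin_shift l lS.
apply/(browder_class lSl dM (shift_invariant l sM iM) (shift_invariant l sN iN)
  (Riesz_Browder lS bS cN iN RN ln0) rc).
have bB : BrowderM (shift S l) B.
  apply: bij_Browder => //; first exact: shift_invariant.
  exact: nilpotent_shift_bij.
apply/(browder_class lSl dA (shift_invariant l sA iA) (shift_invariant l sB iB) bB rc).
apply: (Kato_class rc lS lSl cA iA (shift_invariant l sA iA) KA KA' dims).
by apply/(browder_class lS dA iA iB (nilpotent_Browder lS cB iB nilB fB) rc).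
Qed.

Lemma direct_decomp_trivial : direct_decomp [set: X] [set 0].
Proof. exact/direct_decompP/ddec_trivial/closed_subspaceT. Qed.

Lemma invariant0 S : lin S -> invariant S [set 0].
Proof. by move=> lS _ ->; exact: lin0. Qed.

Lemma Riesz0 S : lin S -> bnd S -> RieszM S [set 0].
Proof.
move=> lS bS l _; have lSl := lin_shift l lS.
apply: (@bij_all_classes _ _ cPhi _ _ lSl (bnd_shift l bS) (@closed_subspace0 _ X)).
  exact: invariant0.
by split => [x []|_ ->] //; exists 0 => //; exact: lin0.
Qed.

Lemma class_gDR c S : lin S -> bnd S -> in_classM c S setT ->
  decomp_with (in_classM c) RieszM S.
Proof.
move=> lS bS h; exists setT, [set 0]; split => //; first exact: direct_decomp_trivial.
  exact: invariant0.
exact: Riesz0.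
Qed.

Lemma regular_essentially_Kato c S : regularity c -> lin S -> bnd S ->
  in_classM c S setT -> essentially_Kato S.
Proof.
move=> rc lS bS h; have iT : invariant S setT by [].
have [A [B [dA iA iB KA [nilB fB]]]] := kato_decomposition lS bS closed_subspaceT iT
  (regular_semi_Fredholm rc lS bS closed_subspaceT iT h).
exists A, B; split => //; first exact/direct_decompP.
by split => //; apply/finite_dimP => //; case: dA => _ _ /closed_subsp.
Qed.

Lemma Kato_essentially_Kato S : lin S -> Kato S -> essentially_Kato S.
Proof.
move=> lS KS; exists setT, [set 0]; split => //; first exact: direct_decomp_trivial.
  exact: invariant0.
split; last by exists 0%N.
by apply/finite_dimP; [exact: subsp_zero|exists 1%N; exact: zero_fd].
Qed.

Lemma essentially_Kato_Kato_type S : essentially_Kato S -> Kato_type S.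
Proof. by move=> [M [N [h1 h2 h3 h4 [_ h5]]]]; exists M, N. Qed.

Lemma Kato_type_GKD S : lin S -> bnd S -> Kato_type S -> GKD S.
Proof.
move=> lS bS [M [N [dM iM iN KM nilN]]]; exists M, N; split => // l l0.
have cN : closed_subspace N by case: dM.
have iNl := shift_invariant l (closed_subsp cN) iN.
apply: (@bij_all_classes _ _ cInv _ _ (lin_shift l lS) (bnd_shift l bS) cN iNl).
by apply: nilpotent_shift_bij => //; exact: closed_subsp.
Qed.

Lemma invertible_bij S M : lin S -> subsp M -> invertibleM S M -> bijM S M.
Proof.
move=> lS sM [g [gM gS Sg _]]; split=> [x [Mx Sx]|x Mx]; last first.
  by exists (g x); [exact: gM|exact: Sg].
have g0 : g 0 = 0 by rewrite -{1}(lin0 lS) gS //; exact: subsp0.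
by rewrite /= -(gS x Mx) Sx g0.
Qed.

Lemma GKD_GKRD S : lin S -> bnd S -> GKD S -> GKRD S.
Proof.
move=> lS bS [M [N [dM iM iN KM qN]]]; exists M, N; split => // l l0.
have cN : closed_subspace N by case: dM.
have sN := closed_subsp cN; have lSl := lin_shift l lS.
apply: (@bij_all_classes _ _ cPhi _ _ lSl (bnd_shift l bS) cN).
  exact: shift_invariant.
by apply: invertible_bij => //; exact: qN.
Qed.

Lemma range_iter_onto S M n : M `<=` rangeM S M -> M `<=` rangeM (iter n S) M.
Proof.
move=> h; elim: n => [|n IH] x Mx; first by exists x.
by rewrite range_iterS; have [y /IH My <-] := h x Mx; exists y.
Qed.

Lemma bounded_below_closed S M : lin S -> bnd S -> closed_subspace M ->
  bounded_belowM S M -> kerM S M `<=` [set 0] /\ closed (rangeM S M).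
Proof.
move=> lS bS cM [c [/posC[-> c0] hc]].
have hc' x : M x -> nr x <= (complex.Re c)^-1 * nr (S x).
  by move=> /hc; rewrite !normE -rmorphM lecR ler_pdivlMl.
split=> [x [/hc' + Sx]|]; first by rewrite Sx nr0 mulr0 /= => h; apply: nr_eq0;
  apply/eqP; rewrite eq_le h nr_ge0.
apply: (bound_closed_range lS bS cM (c := (complex.Re c)^-1)).
  by rewrite invr_ge0 ltW.
by move=> x Mx; exists x => //; exact: hc'.
Qed.

Lemma irregular_Kato c S M : ~~ regularity c -> lin S -> bnd S -> closed_subspace M ->
  invariant S M -> in_classM c S M -> KatoM S M.
Proof.
move=> rc lS bS cM iM; have sM := closed_subsp cM.
have onto : M `<=` rangeM S M -> KatoM S M.
  move=> h; split; last by move=> n x [Mx _]; exact: range_iter_onto.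
  rewrite (_ : rangeM S M = M); first by case: cM.
  by apply/seteqP; split => // _ [x Mx <-]; exact: iM.
case: c rc => //= _ => [/(bounded_below_closed lS bS cM)[k0 cR]|h|].
- by split => // n x /k0 ->; exists 0; [exact: subsp0|exact: (lin0 (lin_iter _ lS))].
- by apply: onto; rewrite h.
- by move=> /(invertible_bij lS sM)[_]; exact: onto.
Qed.

(* The class R' attached to R in part (b); in part (a) R' is R. *)
Definition enlarge (c : opclass) : opclass :=
  match c with cM => cBp | cQ => cBm | cInv => cB | _ => c end.

Lemma regularity_enlarge c : regularity (enlarge c).
Proof. by case: c. Qed.

Lemma class_enlarge c S M : lin S -> bnd S -> closed_subspace M -> invariant S M ->
  in_classM c S M -> in_classM (enlarge c) S M.
Proof.
move=> lS bS cM iM; case: c => //=.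
- move=> /(bounded_below_closed lS bS cM)[k0 cR]; split; last exact: ker0_ascent.
  by apply/upper_semiFredholmP => //; split => //; exists 0%N; exact: cd_zero.
- move=> h; have MR : M `<=` rangeM S M by rewrite h.
  split; last exact: onto_descent.
  by apply/lower_semiFredholmP => //; exists 0%N; exact: cd_zero.
- move=> /(invertible_bij lS (closed_subsp cM)) h.
  exact: (@bij_all_classes _ _ cB).
Qed.

(** * Boundaries and hulls in the plane *)

Section Planar.
Implicit Types K A : set C.

Lemma boundary_approx K l : boundaryC K l ->
  (forall e : R, 0 < e -> exists2 m, K m & nr (m - l) < e) /\
  (forall e : R, 0 < e -> exists2 m, ~ K m & nr (m - l) < e).
Proof.
move=> [cl int]; split => e e0.
  have /cl[m [Km ml]] : nbhs (l : C^o) [set m : C^o | nr (m - l) < e].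
    by apply/nbhs_nr; exists e.
  by exists m.
apply: contrapT => h; apply: int; apply/nbhs_nr; exists e => // m ml.
by apply: contrapT => Km; apply: h; exists m.
Qed.

Lemma boundary_intro K l : K l ->
  (forall e : R, 0 < e -> exists2 m, ~ K m & nr (m - l) < e) -> boundaryC K l.
Proof.
move=> Kl h; split; first exact: subset_closure.
by move=> /nbhs_nr[e e0 he]; have [m Km /he] := h e e0.
Qed.

Lemma acc_approx K l (e : R) : accC K l -> 0 < e ->
  exists2 m, K m & 0 < nr (m - l) < e.
Proof.
move=> aKl e0; have [|m Km [ml h]] := aKl e%:C; first by rewrite ltcR.
exists m => //; move: h; rewrite normE ltcR => ->; rewrite andbT.
by apply: nr_gt0; apply/eqP; rewrite subr_eq0.
Qed.

(** Off the boundary, K coincides with its interior and with its closure, so its trace on D is both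
    open and closed. *)
Lemma connected_boundary K (D : set C^o) : boundaryC K `<=` K -> connected D ->
  (forall z, D z -> ~ boundaryC K z) -> (exists2 z, D z & K z) -> D `<=` K.
Proof.
move=> bK cD Db [z Dz Kz].
have KE u : D u -> K u -> interior (K : set C^o) u.
  move=> Du Ku; apply: contrapT => h; apply: (Db u Du); split => //.
  exact: subset_closure.
have <- : D `&` K = D; last by move=> u [].
apply: cD.
- by exists z.
- exists (interior (K : set C^o)); first exact: open_interior.
  apply/seteqP; split => u [Du Ku]; split => //; first exact: KE.
  exact: interior_subset Ku.
- exists (closure (K : set C^o)); first exact: closed_closure.
  apply/seteqP; split => u [Du Ku]; split => //; first exact: subset_closure.
  apply: contrapT => nK; apply: (Db u Du); split => // /interior_subset.
  by [].
Qed.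

Lemma boundedC_sub A K : A `<=` K -> boundedC K -> boundedC A.
Proof. by move=> AK [r hr]; exists r => z /AK; exact: hr. Qed.

(** An unbounded component of the complement of A misses the boundary of K. If it met K it would lie
    in K, which is bounded; hence it lies in the complement of K. *)
Lemma eta_between K A : boundaryC K `<=` A -> A `<=` K -> boundedC K ->
  etaC K = etaC A.
Proof.
move=> bA AK bK.
suff h l : (~ K l /\ ~ boundedC (connected_component (~` K : set C^o) l)) <->
    (~ A l /\ ~ boundedC (connected_component (~` A : set C^o) l)).
  by apply/seteqP; split => l h'; apply: contra_not h' => /h.
have dich : ~ A l -> ~ boundedC (connected_component (~` A : set C^o) l) ->
    connected_component (~` A : set C^o) l `<=` ~` K.
  move=> nl ub z Dz Kz; apply: ub; apply: boundedC_sub bK.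
  apply: connected_boundary; first exact: subset_trans AK.
  + exact: component_connected.
  + by move=> u /connected_component_sub Au /bA.
  + by exists z.
split=> -[nl ub]; split.
- by move/AK.
- apply: contra_not ub; apply: boundedC_sub.
  apply: (@connected_component_max (C^o : topologicalType)); last exact: component_connected.
    exact: connected_component_refl.
  by move=> z /connected_component_sub Kz /AK.
- exact: (dich nl ub l (connected_component_refl nl)).
- apply: contra_not (ub); apply: boundedC_sub.
  apply: (@connected_component_max (C^o : topologicalType)); last exact: component_connected.
    exact: connected_component_refl.
  exact: dich.
Qed.
End Planar.

(** * Inclusions between the spectra of T *)

Section Operator.
Variable T : X -> X.
Hypotheses (lT : lin T) (bT : bnd T).

Let lTl l : lin (shift T l). Proof. exact: lin_shift. Qed.
Let bTl l : bnd (shift T l). Proof. exact: bnd_shift. Qed.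

Lemma sigma_bounded c : boundedC (sigma_cls c T).
Proof.
have [b b0 hb] := bT; exists (2 * b)%:C => z hz; rewrite normE lecR leNgt.
apply/negP => bz; apply: hz; apply: bij_all_classes => //.
by apply: (neumann lT b0 hb closed_subspaceT) => //; exact: ltW.
Qed.

Lemma sigma_gKR_gK : sigma_gKR T `<=` sigma_gK T.
Proof. by move=> l h1 h2; apply: h1; exact: GKD_GKRD. Qed.

Lemma sigma_gK_Kt : sigma_gK T `<=` sigma_Kt T.
Proof. by move=> l h1 h2; apply: h1; exact: Kato_type_GKD. Qed.

Lemma sigma_Kt_eK : sigma_Kt T `<=` sigma_eK T.
Proof. by move=> l h1 h2; apply: h1; exact: essentially_Kato_Kato_type. Qed.

Lemma sigma_eK_K : sigma_eK T `<=` sigma_K T.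
Proof. by move=> l h1 h2; apply: h1; exact: Kato_essentially_Kato. Qed.

Lemma sigma_gDR_cls c : sigma_gDR c T `<=` sigma_cls c T.
Proof. by move=> l h1 h2; apply: h1; exact: class_gDR. Qed.

Lemma sigma_eK_cls c : regularity c -> sigma_eK T `<=` sigma_cls c T.
Proof. by move=> rc l h1 h2; apply: h1; exact: regular_essentially_Kato h2. Qed.

Lemma sigma_K_cls c : ~~ regularity c -> sigma_K T `<=` sigma_cls c T.
Proof.
by move=> rc l h1 h2; apply: h1; apply: irregular_Kato h2 => //.
Qed.

Lemma sigma_gKR_gDR c : ~~ regularity c -> sigma_gKR T `<=` sigma_gDR c T.
Proof.
move=> rc l h1 [M [N [dM iM iN cSM RN]]]; apply: h1; exists M, N; split => //.
by apply: irregular_Kato cSM => //; case: dM.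
Qed.

Lemma acc_near c l (d : R) : 0 < d ->
  (forall u : C, 0 < nr u -> nr u < d -> in_classM c (shift (shift T l) u) setT) ->
  ~ accC (sigma_cls c T) l.
Proof.
move=> d0 h /acc_approx/(_ d0)[m hm /andP[m0 md]]; apply: hm.
by have := h _ m0 md; rewrite shift_shift subrKC.
Qed.

Lemma gDR_not_acc c l : decomp_with (in_classM (enlarge c)) RieszM (shift T l) ->
  ~ accC (sigma_cls (enlarge c) T) l.
Proof.
move=> /(near_gDR (regularity_enlarge c) (lTl l) (bTl l))[d d0 hd].
exact: acc_near d0 hd.
Qed.

(** Near a boundary point there are points off the spectrum, which decides the alternative of
    [near_GKRD] in favour of membership in the larger class; the point then is not an accumulation
    point. *)
Lemma boundary_gKR c :
  boundaryC (sigma_cls c T) `<=` accC (sigma_cls (enlarge c) T) ->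
  boundaryC (sigma_cls c T) `<=` sigma_gKR T.
Proof.
move=> hacc l bl gk; have al := hacc l bl; have [_ out] := boundary_approx bl.
(* If T - l belongs to the class, the nearby point off the spectrum could be l itself, about which
   [near_GKRD] says nothing; this case goes through [gDR_not_acc]. *)
have [hl|hl] := pselect (in_classM c (shift T l) setT).
  apply: gDR_not_acc al; apply: class_gDR => //.
  by apply: class_enlarge => //.
have [P [d d0 hd]] := near_GKRD (regularity_enlarge c) (lTl l) (bTl l) gk.
have [m /contrapT hm md] := out d d0.
have m0 : 0 < nr (m - l).
  by apply: nr_gt0 => /eqP; rewrite subr_eq0 => /eqP E; apply: hl; rewrite -E.
have hP : P.
  apply/(hd _ m0 md); rewrite shift_shift subrKC.
  by apply: class_enlarge => //.
by apply: (acc_near d0) al => u u0 ud; apply/hd.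
Qed.

(* A point of sigma_c outside sigma_gDR would be isolated in sigma_c, hence a boundary point
   that is not an accumulation point. *)
Lemma sigma_cls_gDR c : regularity c ->
  boundaryC (sigma_cls c T) `<=` accC (sigma_cls c T) ->
  sigma_cls c T `<=` sigma_gDR c T.
Proof.
move=> rc hacc l hl gd.
have [d d0 hd] := near_gDR rc (lTl l) (bTl l) gd.
apply: (acc_near d0 hd); apply: hacc; apply: boundary_intro => // e e0.
have [|u u0] := @punctured_point _ (Num.min d e); first by rewrite lt_min d0.
rewrite lt_min => /andP[ud ue]; exists (l + u); last by rewrite addrAC subrr add0r.
by move=> h; apply: h; rewrite -shift_shift; exact: hd.
Qed.
End Operator.
End Spectra.

Theorem theorem3p20 (R : realType) (X : completeNormedModType (R[i]))
    (T : {linear X -> X}) :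
  continuous T -> @infinite_dimensional R X ->
  (forall c : opclass,
     (c = cBp \/ c = cBm \/ c = cB \/ c = cPhip \/ c = cPhim \/ c = cPhi \/
      c = cWp \/ c = cWm \/ c = cW) ->
     boundaryC (sigma_cls c T) `<=` accC (sigma_cls c T) ->
     (boundaryC (sigma_cls c T) `<=` sigma_gKR T  /\
         sigma_gKR T `<=` sigma_gK T  /\
         sigma_gK T `<=` sigma_Kt T  /\
         sigma_Kt T `<=` sigma_eK T  /\
         sigma_eK T `<=` sigma_cls c T  /\
         sigma_gK T `<=` sigma_gDR c T  /\
         sigma_gDR c T `<=` sigma_cls c T /\
         (etaC (sigma_cls c T) = etaC (sigma_gKR T)  /\
             etaC (sigma_gKR T) = etaC (sigma_gK T)  /\
             etaC (sigma_gK T) = etaC (sigma_Kt T)  /\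
             etaC (sigma_Kt T) = etaC (sigma_eK T) /\
             etaC (sigma_eK T) = etaC (sigma_gDR c T)))) /\
  (forall c c' : opclass,
     ((c, c') = (cM, cBp) \/ (c, c') = (cQ, cBm) \/ (c, c') = (cInv, cB)) ->
     boundaryC (sigma_cls c T) `<=` accC (sigma_cls c' T) ->
     (boundaryC (sigma_cls c T) `<=` sigma_gKR T  /\
         sigma_gKR T `<=` sigma_gK T  /\
         sigma_gK T `<=` sigma_Kt T  /\
         sigma_Kt T `<=` sigma_eK T  /\
         sigma_eK T `<=` sigma_K T  /\
         sigma_K T `<=` sigma_cls c T /\
         (etaC (sigma_cls c T) = etaC (sigma_gKR T)  /\
             etaC (sigma_gKR T) = etaC (sigma_gK T)  /\
             etaC (sigma_gK T) = etaC (sigma_Kt T)  /\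
             etaC (sigma_Kt T) = etaC (sigma_eK T)  /\
             etaC (sigma_eK T) = etaC (sigma_K T) /\
             etaC (sigma_K T) = etaC (sigma_gDR c T)))).

Proof.
move=> cT _.
have lT : lin T by move=> a x y; rewrite linearP.
have bT : bnd T by exact: lin_bnd_continuous.
have gKR_gK := sigma_gKR_gK lT bT; have gK_Kt := sigma_gK_Kt lT bT.
have Kt_eK := @sigma_Kt_eK _ _ T; have eK_K := sigma_eK_K lT.
have gKR_Kt := subset_trans gKR_gK gK_Kt; have gKR_eK := subset_trans gKR_Kt Kt_eK.
split=> [c hc hacc|c c' hc hacc].
  have rc : regularity c by case: hc => [->|]; do ?[case=> [->|]] => //; move=> ->.
  have ce : enlarge c = c by case: c rc {hc hacc}.
  have b_gKR : boundaryC (sigma_cls c T) `<=` sigma_gKR T.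
    by apply: boundary_gKR; rewrite ?ce.
  have eK_c := sigma_eK_cls lT bT rc.
  have gDR_c := @sigma_gDR_cls _ _ T lT bT c.
  have c_gDR := sigma_cls_gDR lT bT rc hacc.
  (* In part (a) the spectrum of the class equals [sigma_gDR c T], so the chain through [sigma_eK T]
     ends there as well. *)
  have gK_gDR : sigma_gK T `<=` sigma_gDR c T.
    by move=> l /gK_Kt/Kt_eK/eK_c/c_gDR.
  (* Each spectrum in the statement lies between [sigma_gKR T] and the spectrum of the class, so
     every hull is replaced by that of the latter. *)
  have eta A : sigma_gKR T `<=` A -> A `<=` sigma_cls c T -> etaC (sigma_cls c T) = etaC A.
    by move=> h1 h2; apply: eta_between (sigma_bounded lT bT c) => // l /b_gKR/h1.
  have gK_c : sigma_gK T `<=` sigma_cls c T by move=> l /gK_gDR/gDR_c.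
  have Kt_c : sigma_Kt T `<=` sigma_cls c T by move=> l /Kt_eK/eK_c.
  do 7 (split; first by []).
  rewrite -(eta (sigma_gKR T)) // -?(eta (sigma_gK T)) // -?(eta (sigma_Kt T)) //;
    last by move=> l /gKR_gK/gK_c.
  rewrite -?(eta (sigma_eK T)) // -?(eta (sigma_gDR c T)) //.
  by move=> l /gKR_gK/gK_gDR.
have [rc ce] : ~~ regularity c /\ enlarge c = c' by case: hc => [|[]] [-> ->].
have b_gKR : boundaryC (sigma_cls c T) `<=` sigma_gKR T.
  by apply: boundary_gKR; rewrite ?ce.
have K_c := sigma_K_cls lT bT rc.
have gDR_c := @sigma_gDR_cls _ _ T lT bT c.
(* In part (b) the members of the class are Kato, so a decomposition with a summand in the class is
   already a GKRD. *)
have gKR_gDR := sigma_gKR_gDR lT bT rc.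
have eta A : sigma_gKR T `<=` A -> A `<=` sigma_cls c T -> etaC (sigma_cls c T) = etaC A.
  by move=> h1 h2; apply: eta_between (sigma_bounded lT bT c) => // l /b_gKR/h1.
have eK_c := subset_trans eK_K K_c; have Kt_c := subset_trans Kt_eK eK_c.
have gK_c := subset_trans gK_Kt Kt_c; have gKR_c := subset_trans gKR_gK gK_c.
have gKR_K := subset_trans gKR_eK eK_K.
do 6 (split; first by []).
rewrite -(eta (sigma_gKR T)) // -(eta (sigma_gK T)) // -(eta (sigma_Kt T)) //.
by rewrite -(eta (sigma_eK T)) // -(eta (sigma_K T)) // -(eta (sigma_gDR c T)).
Qed.
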